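(* Let $n\ge 2$, $0<\beta<n$ and $1<p<q<\infty$ with $\frac1q=\frac1p-\frac{\beta}{n}$. Suppose that $\Omega\in L^\infty(\mathbb{S}^{n-1})$ is homogeneous of degree zero on $\mathbb{R}^n$ and satisfies $\int_{\mathbb{S}^{n-1}}\Omega(x')\,d\sigma(x')=0$. Then there is a constant $C(n,p,q)>0$ depending only on $n,p,q$ such that for every weight $\omega\in A_{p,q}$ and every $f\in L^p(\omega^p)$ the following hold. (i) If $0<\beta<1/2$, then $$\|\mu_{\Omega,\beta}f\|_{L^q(\omega^q)}\le C(n,p,q)\,\|\Omega\|_{\infty}\,[\omega]_{A_{p,q}}^{\max\{1,\frac{p'}{q}\}}\,[\omega]_{A_{p,q}}^{\max\{\frac{p'}{q}(1-\frac{\beta}{n}),\,\frac12-\frac{\beta}{n}\}}\,\|f\|_{L^p(\omega^p)}.$$ (ii) If $1/2\le\beta<n$, then $$\|\mu_{\Omega,\beta}f\|_{L^q(\omega^q)}\le C(n,p,q)\,\|\Omega\|_{\infty}\,[\omega]_{A_{p,q}}^{\max\{\frac{p'}{q}(1-\frac{\beta}{n}),\,1-\frac{\beta}{n}\}}\,\|f\|_{L^p(\omega^p)}.$$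
   Context: $\mathbb{S}^{n-1}$ is the unit sphere of $\mathbb{R}^n$ with normalized Lebesgue measure $d\sigma$, and $x'=x/|x|$ for $x\ne0$. The fractional type Marcinkiewicz integral is $$\mu_{\Omega,\beta}f(x)=\left(\int_0^\infty\left|\int_{|x-y|\le t}\frac{\Omega(x-y)}{|x-y|^{n-1-\beta}}f(y)\,dy\right|^2\frac{dt}{t^3}\right)^{1/2}.$$ A weight is a nonnegative locally integrable function on $\mathbb{R}^n$. For $1<p,q<\infty$, with $p'=p/(p-1)$, $\omega\in A_{p,q}$ means $$[\omega]_{A_{p,q}}:=\sup_Q\Big(\frac1{|Q|}\int_Q\omega^q\Big)\Big(\frac1{|Q|}\int_Q\omega^{-p'}\Big)^{q/p'}<\infty,$$ the supremum being over all cubes $Q\subset\mathbb{R}^n$. $\|f\|_{L^p(\omega^p)}=\big(\int_{\mathbb{R}^n}|f|^p\omega^p\big)^{1/p}$, and similarly for $L^q(\omega^q)$; $\|\Omega\|_\infty=\|\Omega\|_{L^\infty(\mathbb{S}^{n-1})}$. *)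

(* Defs.v *)
From HB Require Import structures.
From mathcomp Require Import all_boot all_order all_algebra.
From mathcomp Require Import all_classical all_reals all_analysis.
From mathcomp Require Import measurable_realfun.

Set Implicit Arguments.
Unset Strict Implicit.
Unset Printing Implicit Defensive.

Import Order.TTheory GRing.Theory Num.Theory.
Import numFieldNormedType.Exports.

Local Open Scope classical_set_scope.
Local Open Scope ring_scope.

Definition euclid_display : measure_display.
Proof. by constructor. Qed.

Section borel_rV.
Context {R : realType} {n : nat}.

Let coord (i : 'I_n) (x : 'rV[R]_n) : measurableTypeR R := x ord0 i.

Let coord_set0 : g_sigma_preimage coord set0.
Proof. exact: sigma_algebra0. Qed.

Let coord_setC A : g_sigma_preimage coord A -> g_sigma_preimage coord (~` A).
Proof. exact: sigma_algebraC. Qed.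

Let coord_bigcup (F : (set 'rV[R]_n)^nat) :
  (forall i, g_sigma_preimage coord (F i)) ->
  g_sigma_preimage coord (\bigcup_i F i).
Proof. exact: sigma_algebra_bigcup. Qed.

(* Borel sets of R^n, generated by the coordinate functions *)
HB.instance Definition _ := @isMeasurable.Build euclid_display 'rV[R]_n
  (g_sigma_preimage coord) coord_set0 coord_setC coord_bigcup.

Lemma measurable_coord (i : 'I_n) :
  measurable_fun [set: 'rV[R]_n] (fun x : 'rV[R]_n => x ord0 i).
Proof.
move=> _ Y mY; rewrite setTI; apply: sub_sigma_algebra => /=.
rewrite -bigcup_seq/=; exists i => /=; first by rewrite mem_index_enum.
by exists Y => //; rewrite setTI.
Qed.

Lemma measurable_fun_rV d (T : measurableType d) (f : T -> 'rV[R]_n) :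
  (forall i, measurable_fun [set: T] (fun t => f t ord0 i)) ->
  measurable_fun [set: T] f.
Proof.
move=> mf.
have mi i Y : measurable (Y : set (measurableTypeR R)) ->
    measurable (f @^-1` (coord i @^-1` Y)).
  by move=> mY; rewrite -[X in measurable X]setTI; exact: mf.
have H : g_sigma_preimage coord `<=`
    [set A | measurable (f @^-1` A)].
  apply: smallest_sub.
    split=> /=; first by rewrite preimage_set0.
      by move=> A mA; rewrite setTD preimage_setC; exact: measurableC.
    by move=> F mF; rewrite preimage_bigcup; exact: bigcup_measurable.
  move=> A; rewrite -bigcup_seq/= => -[i _ [Y mY <-]] /=.
  by rewrite setTI; exact: mi.
by move=> _ A mA; rewrite setTI; exact: H.
Qed.

End borel_rV.

Section lebesgue_rV.
Context {R : realType}.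

Definition cons_rV n (xy : measurableTypeR R * 'rV[R]_n) : 'rV[R]_n.+1 :=
  \row_i if unlift ord0 i is Some j then xy.2 ord0 j else xy.1.

Definition uncons_rV n (x : 'rV[R]_n.+1) : measurableTypeR R * 'rV[R]_n :=
  (x ord0 ord0, \row_i x ord0 (lift ord0 i)).

Lemma cons_rVK n : cancel (@cons_rV n) (@uncons_rV n).
Proof.
move=> [a y]; rewrite /uncons_rV /cons_rV; congr pair.
  by rewrite mxE unlift_none.
by apply/rowP => i; rewrite !mxE liftK.
Qed.

Lemma measurable_cons_rV n : measurable_fun [set: _] (@cons_rV n).
Proof.
apply: measurable_fun_rV => i; rewrite /cons_rV.
case: (unliftP ord0 i) => [j|] ->.
  rewrite (_ : (fun _ => _) = (fun x : 'rV[R]_n => x ord0 j) \o snd).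
    by apply: measurableT_comp => //; exact: measurable_coord.
  by apply/funext => t; rewrite mxE liftK.
rewrite (_ : (fun _ => _) = fst) //.
by apply/funext => t; rewrite mxE unlift_none.
Qed.

Lemma measurable_uncons_rV n : measurable_fun [set: _] (@uncons_rV n).
Proof.
apply/measurable_fun_pairP; split; first exact: measurable_coord.
apply: measurable_fun_rV => i /=.
rewrite (_ : (fun _ => _) = (fun x : 'rV[R]_n.+1 => x ord0 (lift ord0 i))).
  exact: measurable_coord.
by apply/funext => t /=; rewrite mxE.
Qed.

HB.instance Definition _ n :=
  isMeasurableFun.Build _ _ _ _ (@cons_rV n) (@measurable_cons_rV n).

Section step.
Variables (n : nat) (m : {sigma_finite_measure set 'rV[R]_n -> \bar R}).

Definition lebesgue_step : set 'rV[R]_n.+1 -> \bar R :=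
  pushforward (@lebesgue_measure R \x m)%E (@cons_rV n).

Let step0 : lebesgue_step set0 = 0%E.
Proof. exact: measure0. Qed.

Let step_ge0 A : (0 <= lebesgue_step A)%E.
Proof. exact: measure_ge0. Qed.

Let step_sigma_additive : semi_sigma_additive lebesgue_step.
Proof. exact: measure_semi_sigma_additive. Qed.

HB.instance Definition _ := isMeasure.Build _ _ _ lebesgue_step
  step0 step_ge0 step_sigma_additive.

Let step_sigma_finite : sigma_finite setT lebesgue_step.
Proof.
have /sigma_finiteP[F [FT ndF Foo]] := sigma_finiteT (@lebesgue_measure R).
have /sigma_finiteP[G [GT ndG Goo]] := sigma_finiteT m.
exists (fun k => @uncons_rV n @^-1` (F k `*` G k)).
  apply/esym; rewrite -subTset => x _.
  have : (setT : set (measurableTypeR R)) (uncons_rV x).1 by [].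
  have : (setT : set 'rV[R]_n) (uncons_rV x).2 by [].
  rewrite {1}FT {1}GT => -[k _ Gk] [l _ Fl]; exists (maxn k l) => //; split.
    by move: Fl; exact/subsetPset/ndF/leq_maxr.
  by move: Gk; exact/subsetPset/ndG/leq_maxl.
move=> k; have [mFk Fkoo] := Foo k; have [mGk Gkoo] := Goo k; split.
  rewrite -[X in measurable X]setTI; apply: measurable_uncons_rV => //.
  exact: measurableX.
rewrite /lebesgue_step /pushforward -comp_preimage.
rewrite (_ : _ \o _ = id) ?preimage_id; last exact/funext/cons_rVK.
by rewrite product_measure1E// lte_mul_pinfty// ge0_fin_numE.
Qed.

HB.instance Definition _ := Measure_isSigmaFinite.Build _ _ _ lebesgue_step
  step_sigma_finite.

End step.

(* Lebesgue measure on the Borel sets of R^n, as an iterated product *)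
Fixpoint borel_lebesgue n : {sigma_finite_measure set 'rV[R]_n -> \bar R} :=
  if n is n'.+1 then lebesgue_step (borel_lebesgue n')
  else \d_(0 : 'rV[R]_0).

(* R^n with the sigma-algebra of Lebesgue measurable sets *)
Definition euclid n : measurableType _ :=
  caratheodory_type ((borel_lebesgue n)^*)%mu.

Definition leb n : set (euclid n) -> \bar R :=
  @completed_measure_extension _ _ _ (borel_lebesgue n).

HB.instance Definition _ n := Measure.on (@leb n).

End lebesgue_rV.

Arguments leb {R} n.

Section sphere.
Context {R : realType} {n : nat}.

(* Euclidean norm; the library norm on 'rV[R]_n is the maximum norm *)
Definition enorm (x : 'rV[R]_n) : R := Num.sqrt (\sum_i x ord0 i ^+ 2).

Definition unitv (x : 'rV[R]_n) : 'rV[R]_n := (enorm x)^-1 *: x.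

Definition sphere : set 'rV[R]_n := [set x | enorm x = 1].

Definition punctured_ball : set (euclid n) := [set x | 0 < enorm x <= 1].

Lemma measurable_enorm : measurable_fun [set: 'rV[R]_n] enorm.
Proof.
rewrite /enorm; apply: (measurableT_comp (f := @Num.sqrt R)).
  by apply: continuous_measurable_fun; exact: sqrt_continuous.
apply: measurable_sum => i.
by apply: measurable_funX; exact: measurable_coord.
Qed.

Lemma measurable_punctured_ball : measurable punctured_ball.
Proof.
apply: sub_caratheodory; apply: sub_sigma_algebra.
rewrite (_ : punctured_ball = setT `&` enorm @^-1` `]0, 1]); last first.
  by rewrite setTI; apply/seteqP; split => x /=; rewrite in_itv.
exact: measurable_enorm.
Qed.

(* Sets of directions: A is measurable when the cone {x | x' in A} is Lebesgue
   measurable; on subsets of the sphere this is the Lebesgue sigma-algebra. *)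
Definition directions := 'rV[R]_n.

HB.instance Definition _ := Pointed.on directions.

Definition directions_display : measure_display.
Proof. by constructor. Qed.

Let measurable_dir : set (set directions) :=
  image_set_system [set: euclid n] unitv measurable.

Let sigma_dir : sigma_algebra setT measurable_dir.
Proof.
exact/sigma_algebra_image/sigma_algebra_measurable.
Qed.

Let dir0 : measurable_dir set0.
Proof. by have [] := sigma_dir. Qed.

Let dirC A : measurable_dir A -> measurable_dir (~` A).
Proof. by move=> mA; rewrite -setTD; have [_ /(_ _ mA)] := sigma_dir. Qed.

Let dir_bigcup (F : (set directions)^nat) :
  (forall i, measurable_dir (F i)) -> measurable_dir (\bigcup_i F i).
Proof. by have [_ _] := sigma_dir; exact. Qed.

HB.instance Definition _ := @isMeasurable.Build directions_display directions
  measurable_dir dir0 dirC dir_bigcup.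

Lemma measurable_unitv :
  measurable_fun [set: euclid n] (unitv : euclid n -> directions).
Proof. by move=> _ A; exact. Qed.

HB.instance Definition _ := isMeasurableFun.Build _ _ _ _
  (unitv : euclid n -> directions) measurable_unitv.

(* Normalized surface measure of the unit sphere, as the cone measure
   A |-> |{x in B : x' in A}| / |B|, where B is the unit ball without 0. *)
Definition sphere_measure (A : set directions) : \bar R :=
  ((fine (leb n punctured_ball))^-1%:E *
   leb n (unitv @^-1` A `&` punctured_ball))%E.

Let ball_ge0 : 0 <= (fine (leb n punctured_ball))^-1.
Proof. by rewrite invr_ge0 fine_ge0. Qed.

Let sigma : set directions -> \bar R :=
  pushforward (mscale (NngNum ball_ge0) (mrestr (leb n) measurable_punctured_ball))
    (unitv : euclid n -> directions).

Let sphere0 : sphere_measure set0 = 0%E.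
Proof. by change (sigma set0 = 0%E); exact: measure0. Qed.

Let sphere_ge0 A : (0 <= sphere_measure A)%E.
Proof. by change (0 <= sigma A)%E; exact: measure_ge0. Qed.

Let sphere_sigma_additive : semi_sigma_additive sphere_measure.
Proof.
by change (semi_sigma_additive sigma); exact: measure_semi_sigma_additive.
Qed.

HB.instance Definition _ := isMeasure.Build _ _ _ sphere_measure
  sphere0 sphere_ge0 sphere_sigma_additive.

End sphere.

Arguments sphere R n : clear implicits.
Arguments directions R n : clear implicits.
Arguments sphere_measure R n : clear implicits.

Section marcinkiewicz.
Local Open Scope ereal_scope.
Context {R : realType} {n : nat}.
Implicit Types (w f Omega : 'rV[R]_n -> R) (p q beta : R).

Definition marcinkiewicz Omega beta f (x : 'rV[R]_n) : \bar R :=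
  (\int[@lebesgue_measure R]_(t in `]0%R, +oo[%classic)
     (`|\int[leb n]_(y in [set y | enorm (x - y) <= t]%R)
          (Omega (x - y) / enorm (x - y) `^ (n%:R - 1 - beta) * f y)%:E| ^+ 2
      * ((t ^+ 3)^-1)%:E)) `^ 2^-1.

Definition weight w : Prop :=
  [/\ forall x, (0 <= w x)%R,
      measurable_fun [set: euclid n] w &
      forall K : set 'rV[R]_n, compact K -> \int[leb n]_(x in K) (w x)%:E < +oo].

Definition cube (a : 'rV[R]_n) (l : R) : set 'rV[R]_n :=
  [set x | forall i, (a ord0 i <= x ord0 i <= a ord0 i + l)%R].

Definition average (Q : set (euclid n)) (g : 'rV[R]_n -> \bar R) : \bar R :=
  (leb n Q)^-1 * \int[leb n]_(x in Q) g x.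

(* w ^ (-p') is written with the inverse of extended reals, so that it is +oo
   where w vanishes (powR would give 0 there). *)
Definition Apq_char p q w : \bar R :=
  let p' := (p / (p - 1))%R in
  ereal_sup [set average (cube al.1 al.2) (fun x => (w x `^ q)%:E) *
                 average (cube al.1 al.2) (fun x => ((w x `^ p')%:E)^-1)
                   `^ (q / p')
            | al in [set al : 'rV[R]_n * R | (0 < al.2)%R]].

Definition Apq p q w : Prop := weight w /\ Apq_char p q w < +oo.

(* ||g||_{L^p(w^p)} *)
Definition wnorm p w (g : 'rV[R]_n -> \bar R) : \bar R :=
  (\int[leb n]_x (`|g x| `^ p * (w x `^ p)%:E)) `^ p^-1.

Definition in_wLp p w f : Prop :=
  measurable_fun [set: euclid n] f /\ wnorm p w (EFin \o f) < +oo.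

Definition homogeneous0 Omega : Prop :=
  forall (c : R) (x : 'rV[R]_n), (0 < c)%R -> Omega (c *: x)%R = Omega x.

(* ||Omega||_{L^oo(S^{n-1})} *)
Definition sphere_supnorm Omega : \bar R :=
  'N[sphere_measure R n]_+oo [EFin \o Omega].

Definition in_sphere_Loo Omega : Prop :=
  measurable_fun (sphere R n : set (directions R n)) (Omega : directions R n -> R)
  /\ sphere_supnorm Omega < +oo.

End marcinkiewicz.

(* Main.v *)
(* For fixed [x] put [I x := \int |f y| / |x - y|^(n - beta) dy].  The inner
   integral at scale [t] is at most [||Omega|| F t] with
   [F t := \int_(|x - y| <= t) |f y| / |x - y|^(n - beta) |x - y| dy <= t (I x)],
   so Tonelli gives [\int F(t)^2 / t^3 dt <= I x \int F(t) / t^2 dt = (I x)^2] and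
   the Marcinkiewicz integral is dominated by [||Omega||_oo I x].  It remains to bound the Riesz
   potential with the exponent of (ii), which is at most that of (i) because
   [[w] >= 1].  Every ball lies in a cell of comparable size of one of [2^n]
   dyadic grids shifted by thirds, so [I] is at most a liminf of multiples of sums of dyadic
   potentials on finite grids, and by Fatou's lemma a uniform bound for those
   suffices.  On a finite grid the potential is dominated by a sum over stopping
   cells; pairing with a dual function and summing by parts in the scale leaves
   geometric sums over descendants, controlled by the [A_(p,q)] condition and
   bounded through two maximal functions (Doob) and Hoelder.  A weight that
   vanishes almost everywhere on one cube vanishes almost everywhere, as
   [w^(-p') = +oo] there. *)

Require Import Defs.
From HB Require Import structures.
From mathcomp Require Import all_boot all_order all_algebra.
From mathcomp Require Import all_classical all_reals all_analysis.
From mathcomp Require Import ring lra zify measurable_realfun ess_sup_inf.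

Import Order.TTheory GRing.Theory Num.Theory.
Import numFieldNormedType.Exports.
Local Open Scope classical_set_scope.
Local Open Scope ring_scope.

(** * Finite inequalities *)

Section finite_inequalities.
Context {R : realType}.
Implicit Types a b c s t p q x y : R.

(** The power of [[w]] dictates the shape of the dyadic part. Put [g = beta / n], [u = w^q],
    [sigma = w^(-p')], [K = [w]^(1/q)]. The weight condition says [u(Q)^(1/q) sigma(Q)^(1/p') <= K
    |Q|^(1/q + 1/p')], and since [g + 1/q = 1/p] and [g + 1/p' = 1/q'] it gives [|Q|^(g-1) sigma(Q)
    u(Q) <= K sigma(Q)^(1/p) u(Q)^(1/q')]. Summing the left side over all descendants of [Q] costs
    only a constant more, so [K] is spent once there. It is spent a second time when [sigma(Q)] or
    [u(Q)] of a stopping cell is compared with the mass outside the later stopping cells: the loss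
    is of order [K^p'] or [K^q], and after Hoelder only its power [1/q] or [1/p'] remains. The
    products [K K^(p'/q)] and [K K^(q/p')] are exactly the powers [p'/q (1 - beta/n)] and
    [1 - beta/n] of [[w]]. All of this takes place on a finite tree whose leaves carry the integrals
    of [|f|], [u] and [sigma], so every quantity is a finite real and powers of it may be
    absorbed. *)

Lemma powRD_gt0 x s t : 0 < x -> x `^ (s + t) = x `^ s * x `^ t.
Proof. by move=> x0; rewrite powRD// (gt_eqF x0) implybT. Qed.

Lemma weighted_am_gm x y s t : 0 <= x -> 0 <= y -> 0 < s -> 0 < t -> s + t = 1 ->
  x `^ s * y `^ t <= s * x + t * y.
Proof.
move=> x0 y0 s0 t0 st.
have := @conjugate_powR R (x `^ s) (y `^ t) s^-1 t^-1 (powR_ge0 _ _) (powR_ge0 _ _).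
rewrite !invr_gt0 !invrK => /(_ s0 t0 st).
rewrite -!powRrM !divff ?gt_eqF// !powRr1//.
by rewrite [x * s]mulrC [y * t]mulrC.
Qed.

Lemma sum_powR_le (I : finType) (A B : I -> R) s t :
  (forall i, 0 <= A i) -> (forall i, 0 <= B i) -> 0 < s -> 0 < t -> s + t = 1 ->
  \sum_i A i `^ s * B i `^ t <= (\sum_i A i) `^ s * (\sum_i B i) `^ t.
Proof.
move=> A0 B0 s0 t0 st.
have SA0 : 0 <= \sum_i A i by apply: sumr_ge0.
have SB0 : 0 <= \sum_i B i by apply: sumr_ge0.
have [SA|SA] := eqVneq (\sum_i A i) 0.
  rewrite big1 ?mulr_ge0 ?powR_ge0// => i _.
  have /psumr_eq0P -> // : \sum_i A i = 0 by [].
  by rewrite powR0 ?gt_eqF// mul0r.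
have [SB|SB] := eqVneq (\sum_i B i) 0.
  rewrite big1 ?mulr_ge0 ?powR_ge0// => i _.
  have /psumr_eq0P -> // : \sum_i B i = 0 by [].
  by rewrite [in X in _ * X]powR0 ?gt_eqF// mulr0.
have SAp : 0 < \sum_i A i by rewrite lt_neqAle eq_sym SA.
have SBp : 0 < \sum_i B i by rewrite lt_neqAle eq_sym SB.
set a := \sum_i A i in SAp SA *; set b := \sum_i B i in SBp SB *.
have E i : A i `^ s * B i `^ t = a `^ s * b `^ t * ((A i / a) `^ s * (B i / b) `^ t).
  rewrite -{1}(divfK SA (A i)) -{1}(divfK SB (B i)) !powRM ?mulr_ge0 ?invr_ge0 ?(ltW SAp) ?(ltW SBp)//.
  by ring.
rewrite (eq_bigr _ (fun i _ => E i)).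
rewrite -mulr_sumr -[leRHS]mulr1; apply: ler_wpM2l; first by rewrite mulr_ge0 ?powR_ge0.
apply: (@le_trans _ _ (\sum_i (s * (A i / a) + t * (B i / b)))).
  by apply: ler_sum => i _; apply: weighted_am_gm => //; rewrite divr_ge0 ?(ltW SAp) ?(ltW SBp).
by rewrite big_split/= -!mulr_sumr -!mulr_suml -/a -/b !divff// !mulr1 st.
Qed.

Lemma sum_powR3_le (I : finType) (A B D : I -> R) r s t :
  (forall i, 0 <= A i) -> (forall i, 0 <= B i) -> (forall i, 0 <= D i) ->
  0 < r -> 0 < s -> 0 < t -> r + s + t = 1 ->
  \sum_i A i `^ r * (B i `^ s * D i `^ t) <=
  (\sum_i A i) `^ r * ((\sum_i B i) `^ s * (\sum_i D i) `^ t).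
Proof.
move=> A0 B0 D0 r0 s0 t0 rst.
have st0 : 0 < s + t by rewrite addr_gt0.
have st1 : s / (s + t) + t / (s + t) = 1 by rewrite -mulrDl divff ?gt_eqF.
have E x y : x `^ s * y `^ t = (x `^ (s / (s + t)) * y `^ (t / (s + t))) `^ (s + t).
  by rewrite powRM ?powR_ge0// -!powRrM !divfK ?gt_eqF.
rewrite (eq_bigr _ (fun i _ => congr1 ( *%R _) (E _ _))).
apply: (le_trans (@sum_powR_le _ _ _ r (s + t) A0 _ r0 st0 _)).
- by move=> i; rewrite mulr_ge0 ?powR_ge0.
- by rewrite addrA.
apply: ler_wpM2l; first exact: powR_ge0.
rewrite [leRHS]E; apply: (ge0_ler_powR (ltW st0)); rewrite ?nnegrE.
- by apply: sumr_ge0 => i _; rewrite mulr_ge0 ?powR_ge0.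
- by rewrite mulr_ge0 ?powR_ge0.
- by apply: sum_powR_le => //; rewrite divr_gt0.
Qed.

Lemma hoelder_sum (I : finType) (A B : I -> R) p q :
  (forall i, 0 <= A i) -> (forall i, 0 <= B i) -> 0 < p -> 0 < q -> p^-1 + q^-1 = 1 ->
  \sum_i A i * B i <= (\sum_i A i `^ p) `^ p^-1 * (\sum_i B i `^ q) `^ q^-1.
Proof.
move=> A0 B0 p0 q0 pq.
have := @sum_powR_le I (fun i => A i `^ p) (fun i => B i `^ q) p^-1 q^-1
  (fun=> powR_ge0 _ _) (fun=> powR_ge0 _ _).
rewrite !invr_gt0 => /(_ p0 q0 pq) H; apply: le_trans H.
by apply: ler_sum => i _; rewrite -!powRrM !divff ?gt_eqF// !powRr1.
Qed.

(** Concavity at 1. In [cell_step] it converts a drop of [h ^ g] into a drop proportional to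
    [1 - h]. *)
Lemma powR_le_tangent x s : 0 <= x -> 0 < s -> s < 1 -> s * (1 - x) <= 1 - x `^ s.
Proof.
move=> x0 s0 s1.
have := @weighted_am_gm x 1 s (1 - s) x0 ler01 s0.
rewrite subr_gt0 s1 => /(_ isT); rewrite addrC subrK => /(_ erefl).
rewrite powR1 mulr1; lra.
Qed.

(** Young's inequality for [b * a ^ (p - 1)]. With [a] and [b] the values of a running maximum
    before and after a jump, this is the pathwise form of Doob's inequality. *)
Lemma powR_sub_le a b p : 0 <= a -> a <= b -> 1 < p ->
  b `^ p - a `^ p <= p / (p - 1) * (b * (b `^ (p - 1) - a `^ (p - 1))).
Proof.
move=> a0 ab p1; have b0 := le_trans a0 ab.
have p0 : 0 < p by lra.
have H := @weighted_am_gm (b `^ p) (a `^ p) p^-1 (1 - p^-1) (powR_ge0 _ _) (powR_ge0 _ _).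
have {}H := H _ _ _.
have ip1 : p^-1 < 1 by rewrite invf_lt1.
have {H} := H _ _ _; rewrite invr_gt0 subr_gt0 => /(_ p0 ip1).
rewrite addrC subrK => /(_ erefl).
have pE : p * (1 - p^-1) = p - 1 by field; rewrite gt_eqF.
rewrite -!powRrM divff ?gt_eqF// powRr1// pE => H.
rewrite mulrBr mulr_powRB1//.
have p1n : p - 1 != 0 by rewrite gt_eqF// subr_gt0.
rewrite -subr_ge0.
have -> : p / (p - 1) * (b `^ p - b * a `^ (p - 1)) - (b `^ p - a `^ p) =
  p / (p - 1) * (p^-1 * b `^ p + (1 - p^-1) * a `^ p - b * a `^ (p - 1)).
  by field; rewrite p1n gt_eqF.
by rewrite mulr_ge0 ?subr_ge0// divr_ge0// ?subr_ge0 ltW.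
Qed.

(** Makes the [p]-th powers of the increments of a running maximum summable by telescoping. *)
Lemma powR_superadditive a b p : 0 <= a -> a <= b -> 1 <= p ->
  (b - a) `^ p <= b `^ p - a `^ p.
Proof.
move=> a0 ab p1; have b0 := le_trans a0 ab.
have p0 : 0 < p by lra.
have ba0 : 0 <= b - a by rewrite subr_ge0.
have H x : 0 <= x -> x <= b -> x `^ p <= x * b `^ (p - 1).
  move=> x0 xb; rewrite -(mulr_powRB1 x0 p0) ler_wpM2l//.
  by rewrite ge0_ler_powR ?nnegrE// subr_ge0.
rewrite lerBrDr; apply: (le_trans (lerD (H _ ba0 _) (H _ a0 ab))); first by rewrite gerBl.
by rewrite -mulrDl subrK mulr_powRB1.
Qed.

End finite_inequalities.

(** * A weighted inequality for dyadic potentials on a finite tree *)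

Lemma weighted_hoelder_sum {R : realType} (I : finType) (w A B : I -> R) p q :
  (forall i, 0 <= w i) -> (forall i, 0 <= A i) -> (forall i, 0 <= B i) ->
  0 < p -> 0 < q -> p^-1 + q^-1 = 1 ->
  \sum_i w i * (A i * B i) <=
  (\sum_i w i * A i `^ p) `^ p^-1 * (\sum_i w i * B i `^ q) `^ q^-1.
Proof.
move=> w0 A0 B0 p0 q0 pq.
have H := @hoelder_sum R I (fun i => w i `^ p^-1 * A i) (fun i => w i `^ q^-1 * B i) p q.
have {H} := H _ _ p0 q0 pq.
have -> : \sum_i (w i `^ p^-1 * A i * (w i `^ q^-1 * B i)) = \sum_i w i * (A i * B i).
  apply: eq_bigr => i _; rewrite mulrACA -powRD ?pq ?oner_eq0//.
  by rewrite powRr1.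
have E (C : I -> R) r : 0 < r -> (forall i, 0 <= C i) ->
    \sum_i (w i `^ r^-1 * C i) `^ r = \sum_i w i * C i `^ r.
  move=> r0 C0; apply: eq_bigr => i _.
  by rewrite powRM ?powR_ge0// -powRrM mulVf ?gt_eqF// powRr1.
by rewrite !E//; apply => i; rewrite mulr_ge0 ?powR_ge0.
Qed.

(** Divides by [X ^ q^-1], which is legitimate because [X] is a real number; it closes both Doob's
    inequality and the duality argument. *)
Lemma powR_self_improve {R : realType} (X c p q : R) : 0 <= X -> 0 <= c -> 0 < p ->
  p^-1 + q^-1 = 1 -> X <= c * X `^ q^-1 -> X `^ p^-1 <= c.
Proof.
move=> X0 c0 p0 pq H; have [->|Xn0] := eqVneq X 0; first by rewrite powR0// invr_eq0 gt_eqF.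
have Xp : 0 < X by rewrite lt_neqAle eq_sym Xn0.
rewrite -(ler_pM2r (powR_gt0 q^-1 Xp)) -powRD ?Xn0 ?implybT// pq powRr1//.
Qed.

(** * Running maxima over selected levels *)

Section running_max.
Context {R : realType}.
Implicit Types (S : nat -> bool) (a : nat -> R).

(** Index [l] sees the levels strictly before [l], so [rmax S a l.+1] is the maximum up to and
    including level [l]. The start value 0 removes the boundary term from every telescoping sum. *)
Fixpoint rmax S a (l : nat) : R :=
  if l is k.+1 then (if S k then Num.max (rmax S a k) (a k) else rmax S a k) else 0.

Lemma rmax_le_succ S a l : rmax S a l <= rmax S a l.+1.
Proof. by rewrite /=; case: ifP => // _; rewrite le_max lexx. Qed.

Lemma rmax_ge0 S a l : 0 <= rmax S a l.
Proof. by elim: l => // l IH; exact: (le_trans IH (rmax_le_succ _ _ _)). Qed.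

Lemma rmax_homo S a : {homo rmax S a : l k / (l <= k)%N >-> l <= k}.
Proof. by apply: homo_leq => //; [exact: le_trans | exact: rmax_le_succ]. Qed.

Lemma rmax_ge S a l : S l -> a l <= rmax S a l.+1.
Proof. by move=> /= ->; rewrite le_max lexx orbT. Qed.

(** A nonzero increment at level [l] forces both a selected level and the new value [a l] itself.
    This lets averages be compared with the maximum, and lets a stopping indicator be inserted for
    free. *)
Variant rmax_step_spec S a l : Prop :=
| RmaxSame of rmax S a l.+1 = rmax S a l
| RmaxJump of S l & rmax S a l.+1 = a l & rmax S a l <= a l.

Lemma rmax_stepP S a l : rmax_step_spec S a l.
Proof.
case Sl : (S l); last by apply: RmaxSame => /=; rewrite Sl.
have [al|al] := leP (rmax S a l) (a l).
  by apply: RmaxJump => //=; rewrite Sl; apply/max_idPr.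
by apply: RmaxSame => /=; rewrite Sl; apply/max_idPl/ltW.
Qed.

Lemma eq_rmax S S' a a' l : (forall k, (k < l)%N -> S k = S' k) ->
  (forall k, (k < l)%N -> a k = a' k) -> rmax S a l = rmax S' a' l.
Proof.
elim: l => // l IH HS Ha /=; rewrite HS// Ha// IH// => k kl.
  by rewrite HS// ltnW.
by rewrite Ha// ltnW.
Qed.

End running_max.

(** * Finite trees of cells, described by their leaves *)

Section filtration.
Context {R : realType} {J : finType} {T : eqType}.
Variables (L : nat) (r : nat -> J -> T) (V : nat -> R).
Hypothesis r_fine : forall l x y, r l.+1 x = r l.+1 y -> r l x = r l y.
Hypothesis V_gt0 : forall l, 0 < V l.
Hypothesis r_card : forall l x, (l <= L)%N ->
  \sum_(y | r l y == r l x) 1 = V l / V L.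

(** [J] is the set of leaves and [r l x] names the level-[l] cell through the leaf [x]. A function
    of cells is encoded as a function of leaves constant on the fibres of [r l], so that no type of
    cells is needed. *)
Definition level_meas {U : Type} l (psi : J -> U) :=
  forall x y, r l x = r l y -> psi x = psi y.

Definition mass (phi : J -> R) l x := \sum_(y | r l y == r l x) phi y.

Lemma r_homo l k x y : (l <= k)%N -> r k x = r k y -> r l x = r l y.
Proof. by move/subnK <-; elim: (k - l)%N => // m IH /r_fine. Qed.

Lemma level_meas_homo {U : Type} l k (psi : J -> U) :
  (l <= k)%N -> level_meas l psi -> level_meas k psi.
Proof. by move=> lk H x y /(r_homo _ _ _ _ lk) /H. Qed.

Lemma level_meas_mass phi l : level_meas l (mass phi l).
Proof. by move=> x y xy; rewrite /mass xy. Qed.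

Lemma mass_ge0 phi l x : (forall x, 0 <= phi x) -> 0 <= mass phi l x.
Proof. by move=> H; apply: sumr_ge0. Qed.

Lemma le_mass phi psi l x : (forall x, phi x <= psi x) -> mass phi l x <= mass psi l x.
Proof. by move=> H; apply: ler_sum. Qed.

Lemma mass_gt0 phi l x : (forall x, 0 < phi x) -> 0 < mass phi l x.
Proof.
move=> H; rewrite /mass (bigD1 x)//=; apply: ltr_wpDr => //.
by apply: sumr_ge0 => y _; exact: ltW.
Qed.

Lemma mass_pull psi phi l x : level_meas l psi ->
  mass (fun y => psi y * phi y) l x = psi x * mass phi l x.
Proof.
by move=> H; rewrite /mass mulr_sumr; apply: eq_bigr => y /eqP /H ->.
Qed.

Lemma sum_mass_sym phi psi l : \sum_x phi x * mass psi l x = \sum_x mass phi l x * psi x.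
Proof.
under eq_bigr do rewrite /mass mulr_sumr big_mkcond/=.
rewrite exchange_big/=; apply: eq_bigr => y _; rewrite /mass mulr_suml [RHS]big_mkcond/=.
by apply: eq_bigr => x _; rewrite eq_sym.
Qed.

Lemma mass_meas psi l x : (l <= L)%N -> level_meas l psi ->
  mass psi l x = psi x * (V l / V L).
Proof.
move=> lL mpsi; rewrite -(r_card l x lL) mulr_sumr; apply: eq_bigr => y /eqP /mpsi ->.
by rewrite mulr1.
Qed.

(* [V L / V l] is the inverse of the number of leaves in a cell of level [l]:
   weighting leaves by it turns sums over leaves into sums over cells. *)
Lemma sum_mass psi phi l : (l <= L)%N -> level_meas l psi ->
  \sum_x psi x * mass phi l x * (V L / V l) = \sum_x psi x * phi x.
Proof.
move=> lL mpsi; rewrite -mulr_suml sum_mass_sym.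
rewrite mulr_suml; apply: eq_bigr => x _; rewrite mass_meas//; field.
by rewrite !gt_eqF.
Qed.

(** The identity [sum_mass] inside one cell of level [k]: cutting [psi] off outside that cell keeps
    it constant on cells of the finer level [l]. *)
Lemma mass_tower psi phi k l x : (k <= l)%N -> (l <= L)%N -> level_meas l psi ->
  mass (fun y => psi y * mass phi l y * (V L / V l)) k x = mass (fun y => psi y * phi y) k x.
Proof.
move=> kl lL mpsi; rewrite /mass !(big_mkcond (fun y => r k y == r k x))/=.
pose psi' y := if r k y == r k x then psi y else 0.
have E (P : J -> R) : \sum_y (if r k y == r k x then psi y * P y else 0) = \sum_y psi' y * P y.
  by apply: eq_bigr => y _; rewrite /psi'; case: ifP; rewrite ?mul0r.
under eq_bigr do rewrite -mulrA; rewrite !E.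
under eq_bigr do rewrite mulrA.
apply: sum_mass => // y z yz; rewrite /psi' (mpsi _ _ yz).
by rewrite (r_homo _ _ _ _ kl yz).
Qed.

Lemma mass_tower1 phi k l x : (k <= l)%N -> (l <= L)%N ->
  mass (fun y => mass phi l y * (V L / V l)) k x = mass phi k x.
Proof.
move=> kl lL; transitivity (mass (fun y => 1 * mass phi l y * (V L / V l)) k x).
  by apply: eq_bigr => y _; rewrite mul1r.
by rewrite (mass_tower (fun=> 1))//; apply: eq_bigr => y _; rewrite mul1r.
Qed.

(** * Doob's maximal inequality for an arbitrary positive measure on the leaves *)

Section doob.
Variables (S : nat -> J -> bool) (sg f : J -> R).
Hypothesis mS : forall l, level_meas l (S l).
Hypothesis sg_gt0 : forall x, 0 < sg x.
Hypothesis f_ge0 : forall x, 0 <= f x.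

Definition avg l x := mass (fun y => sg y * f y) l x / mass sg l x.

Definition maxf l x := rmax (S ^~ x) (avg ^~ x) l.

Lemma level_meas_avg l : level_meas l (avg l).
Proof. by move=> x y xy; rewrite /avg !(level_meas_mass _ l x y xy). Qed.

Lemma level_meas_maxf l : level_meas l (maxf l.+1).
Proof.
move=> x y xy; apply: eq_rmax => k; rewrite ltnS => /r_homo /(_ xy) kxy; first exact: mS.
exact: level_meas_avg.
Qed.

Lemma level_meas_maxf_pred l : level_meas l (maxf l).
Proof. by case: l => [x y _//|l]; apply: level_meas_homo (level_meas_maxf l). Qed.

Lemma avg_ge0 l x : 0 <= avg l x.
Proof. by apply: divr_ge0; apply: mass_ge0 => y; rewrite ?mulr_ge0 ?(ltW (sg_gt0 y)). Qed.

(** [avg l] is the conditional expectation of [f] at level [l] under the measure [sg]; against a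
    function known at level [l] it can be exchanged for [f]. *)
Lemma sum_avg psi l : (l <= L)%N -> level_meas l psi ->
  \sum_x sg x * avg l x * psi x = \sum_x sg x * f x * psi x.
Proof.
move=> lL mpsi.
transitivity (\sum_x psi x * mass (fun y => sg y * f y) l x * (V L / V l)); last first.
  by rewrite sum_mass//; apply: eq_bigr => x _; rewrite mulrC.
transitivity (\sum_x psi x * avg l x * sg x); first by apply: eq_bigr => x _; ring.
rewrite -(sum_mass _ sg l lL); last first.
  by move=> x y xy; rewrite (mpsi _ _ xy) (level_meas_avg _ _ _ xy).
apply: eq_bigr => x _; rewrite /avg; congr (_ * _); rewrite -mulrA divfK//.
by rewrite gt_eqF// mass_gt0.
Qed.

(** At a jump the new maximum is the current average, so [powR_sub_le] turns the increment of the
    [p]-th power into that average times the increment of the [(p - 1)]-th power. The latter is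
    known at level [l], hence the average may be replaced by [f], and the increments telescope back.
    The constant depends neither on [sg] nor on the selected levels. *)
Lemma doob p : 1 < p ->
  (\sum_x sg x * maxf L.+1 x `^ p) `^ p^-1 <= p / (p - 1) * (\sum_x sg x * f x `^ p) `^ p^-1.
Proof.
move=> p1; have p0 : 0 < p by lra.
have p1n : 0 < p - 1 by lra.
set X := \sum_x sg x * maxf L.+1 x `^ p; set c := p / (p - 1).
have c0 : 0 <= c by apply: divr_ge0; exact: ltW.
have maxf_ge0 l x : 0 <= maxf l x by exact: rmax_ge0.
have H1 : X <= c * \sum_x sg x * (f x * maxf L.+1 x `^ (p - 1)).
  have tel (s : R) x : s != 0 ->
      maxf L.+1 x `^ s = \sum_(0 <= l < L.+1) (maxf l.+1 x `^ s - maxf l x `^ s).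
    by move=> s0; rewrite (telescope_sumr (fun l => maxf l x `^ s))// [maxf 0 x]/= powR0// subr0.
  rewrite /X; under eq_bigr => x _ do rewrite tel ?gt_eqF// mulr_sumr.
  under [in leRHS]eq_bigr => x _ do rewrite tel ?gt_eqF// !mulr_sumr.
  rewrite exchange_big/= [in leRHS]exchange_big/= mulr_sumr !big_nat.
  apply: ler_sum => l /andP[_ lL].
  set psi := fun x => maxf l.+1 x `^ (p - 1) - maxf l x `^ (p - 1).
  have -> : \sum_i sg i * (f i * (maxf l.+1 i `^ (p - 1) - maxf l i `^ (p - 1)))
      = \sum_x sg x * avg l x * psi x.
    rewrite sum_avg//; first by apply: eq_bigr => x _; rewrite mulrA.
    move=> x y xy; rewrite /psi (level_meas_maxf _ _ _ xy).
    by rewrite (level_meas_maxf_pred _ _ _ xy).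
  rewrite mulr_sumr; apply: ler_sum => x _; rewrite /psi -mulrA mulrCA.
  apply: ler_wpM2l; first exact: ltW.
  rewrite /maxf; case: (rmax_stepP (S ^~ x) (avg ^~ x) l) => [->|_ -> H].
    by rewrite !subrr !mulr0.
  by apply: powR_sub_le => //; exact: rmax_ge0.
have q0 : 0 < p / (p - 1) by rewrite divr_gt0.
have pq : p^-1 + (p / (p - 1))^-1 = 1 by field; rewrite !gt_eqF.
have H2 := @weighted_hoelder_sum R J sg f (fun x => maxf L.+1 x `^ (p - 1)) p (p / (p - 1))
   (fun x => ltW (sg_gt0 x)) f_ge0 (fun=> powR_ge0 _ _) p0 q0 pq.
have XE : \sum_x sg x * (maxf L.+1 x `^ (p - 1)) `^ (p / (p - 1)) = X.
  by apply: eq_bigr => x _; rewrite -powRrM [(p - 1) * _]mulrC divfK ?gt_eqF.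
rewrite XE in H2.
have X0 : 0 <= X by apply: sumr_ge0 => x _; rewrite mulr_ge0 ?powR_ge0 ?ltW.
have H3 : X <= c * (\sum_x sg x * f x `^ p) `^ p^-1 * X `^ (p / (p - 1))^-1.
  by apply: (le_trans H1); rewrite -mulrA; apply: ler_wpM2l.
exact: (powR_self_improve _ _ _ _ X0 (mulr_ge0 c0 (powR_ge0 _ _)) p0 pq H3).
Qed.

End doob.

(** * Stopping cells and their disjoint parts *)

Section stopping.
Variables (F : J -> R).
Hypothesis F_ge0 : forall x, 0 <= F x.

Let A l x := mass F l x / V l.

(** The average of [F] over the last stopping cell among the levels strictly before [l]. Starting
    from 0 makes the root stop as soon as its average is positive. *)
Fixpoint stop_value l x : R :=
  if l is k.+1 then (if 2 * stop_value k x < A k x then A k x else stop_value k x) else 0.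

Definition stops l x := 2 * stop_value l x < A l x.

Lemma stop_valueS l x :
  stop_value l.+1 x = if stops l x then A l x else stop_value l x.
Proof. by []. Qed.

Let A_ge0 l x : 0 <= A l x.
Proof. by rewrite divr_ge0 ?mass_ge0// ltW. Qed.

Lemma stop_value_ge0 l x : 0 <= stop_value l x.
Proof. by elim: l => // l IH; rewrite stop_valueS; case: ifP. Qed.

Let level_meas_A l : level_meas l (A l).
Proof. by move=> x y xy; rewrite /A (level_meas_mass _ _ _ _ xy). Qed.

Lemma level_meas_stop_value l : level_meas l (stop_value l.+1).
Proof.
elim: l => [|l IH] x y xy; first by rewrite /= (level_meas_A _ _ _ xy).
by rewrite stop_valueS [RHS]stop_valueS /stops (IH _ _ (r_fine _ _ _ xy)) (level_meas_A _ _ _ xy).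
Qed.

Lemma level_meas_stops l : level_meas l (stops l).
Proof.
move=> x y xy; rewrite /stops (level_meas_A _ _ _ xy).
by case: l xy => // l /r_fine /level_meas_stop_value ->.
Qed.

Lemma average_le_stop_value l x : A l x <= 2 * stop_value l.+1 x.
Proof.
rewrite stop_valueS; case: ifPn => [|]; last by rewrite /stops -leNgt.
by move=> _; rewrite mulr_natl mulr2n lerDl.
Qed.

Lemma stop_value_le_succ l x : stop_value l x <= stop_value l.+1 x.
Proof.
rewrite stop_valueS; case: ifP => // /ltW; apply: le_trans.
by rewrite mulr_natl mulr2n lerDl stop_value_ge0.
Qed.

Lemma stop_increment_le l x :
  stop_value l.+1 x - stop_value l x <= (stops l x)%:R * A l x.
Proof.
rewrite stop_valueS; case: ifP => _; last by rewrite subrr mul0r.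
by rewrite mul1r gerBl stop_value_ge0.
Qed.

(* Abel summation in the scale: only the increments of the stopping values
   matter because the weights decay geometrically. *)
Lemma sparse_domination (d : nat -> R) D x : 0 <= D -> (forall l, 0 <= d l) ->
  (forall k, (k <= L)%N -> \sum_(k <= l < L.+1) d l <= D * d k) ->
  \sum_(0 <= l < L.+1) d l * A l x <=
  2 * D * \sum_(0 <= l < L.+1) (stops l x)%:R * (d l * A l x).
Proof.
move=> D0 d0 dD.
apply: (@le_trans _ _ (2 * \sum_(0 <= l < L.+1) d l * stop_value l.+1 x)).
  rewrite mulr_sumr; apply: ler_sum => l _; rewrite [leRHS]mulrCA.
  by rewrite ler_wpM2l// average_le_stop_value.
rewrite -mulrA ler_pM2l//.
have E l : (l < L.+1)%N -> d l * stop_value l.+1 x =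
    \sum_(0 <= k < L.+1 | true && (k < l.+1)%N) d l * (stop_value k.+1 x - stop_value k x).
  move=> lL; rewrite -big_nat_widen// -mulr_sumr.
  by rewrite (telescope_sumr (stop_value ^~ x))// subr0.
rewrite big_nat; under eq_bigr => l /andP[_ lL] do rewrite E//.
rewrite -big_nat (exchange_big_dep xpredT)//= mulr_sumr !big_nat; apply: ler_sum => k /andP[_ kL].
rewrite -mulr_suml (eq_bigl (fun l => true && (k <= l)%N))//.
rewrite -big_nat_widenl//.
apply: (@le_trans _ _ (D * d k * (stop_value k.+1 x - stop_value k x))).
  by rewrite ler_wpM2r ?subr_ge0 ?stop_value_le_succ// dD.
rewrite -mulrA; apply: ler_wpM2l => //.
by rewrite mulrCA; apply: ler_wpM2l => //; exact: stop_increment_le.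
Qed.

Definition stops_from l x := has (stops ^~ x) (iota l (L.+1 - l)).

Lemma stops_fromS l x : (l <= L)%N -> stops_from l x = stops l x || stops_from l.+1 x.
Proof. by move=> lL; rewrite /stops_from subSn//= subSS. Qed.

(** Sort the covered leaves by their first stop after [l]. Over each such cell the average of [F]
    exceeds [2 * A l x], and these cells are disjoint inside the given one, so [2 * A l x] times
    their volume is at most the integral of [F], which is [A l x] times the volume of the cell. *)
Lemma mass_stops_from l x : (l <= L)%N -> stops l x ->
  mass (fun y => (stops_from l.+1 y)%:R) l x <= (V l / V L) / 2.
Proof.
move=> lL Slx; pose P k y := has (stops ^~ y) (iota l.+1 (k - l.+1)).
have PS k y : (l < k)%N -> P k.+1 y = P k y || stops k y.
  by move=> lk; rewrite /P subSn// -[(k - l.+1).+1]addn1 iotaD has_cat /= orbF subnKC.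
(* Until the first later stop the threshold stays frozen at its value just after level [l]. *)
have svP k y : (l < k)%N -> ~~ P k y -> stop_value k y = stop_value l.+1 y.
  move=> /subnKC <-; elim: (k - l.+1)%N => [|m IH]; first by rewrite addn0.
  rewrite addnS PS ?leq_addr// negb_or => /andP[/IH <- Sn].
  by rewrite stop_valueS (negbTE Sn).
have mP k : (l < k)%N -> level_meas k (P k).
  move=> lk y z yz; rewrite /P; apply: eq_in_has => i; rewrite mem_iota subnKC//.
  move=> /andP[_ ik]; apply: (level_meas_stops i); exact: r_homo (ltnW ik) yz.
pose first k y : R := (stops k y && ~~ P k y)%:R.
have mfirst k : (l < k)%N -> level_meas k (first k).
  by move=> lk y z yz; rewrite /first (mP k lk _ _ yz) (level_meas_stops k _ _ yz).
have E y : (stops_from l.+1 y)%:R = \sum_(l.+1 <= k < L.+1) first k y.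
  have -> : stops_from l.+1 y = P L.+1 y by [].
  rewrite -[LHS]subr0 -[X in _ - X]/(false%:R); have -> : false = P l.+1 y by rewrite /P subnn.
  rewrite -(telescope_sumr (fun k => (P k y)%:R))//.
  rewrite [LHS]big_nat [RHS]big_nat; apply: eq_bigr => k /andP[lk _].
  rewrite PS// /first; case: (P k y); rewrite ?subrr ?andbF//= andbT subr0.
  by case: stops.
have Alx : 0 < A l x.
  by apply: le_lt_trans Slx; rewrite mulr_ge0// stop_value_ge0.
have Ale k y : (l < k)%N -> (k <= L)%N -> r l y == r l x -> 2 * A l x * first k y <= first k y * A k y.
  move=> lk kL /eqP yx; rewrite /first; case: (boolP (_ && _)); last by rewrite mulr0 mul0r.
  move=> /andP[Sk nP]; rewrite mulr1 mul1r ltW//.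
  have Sly : stops l y by rewrite (level_meas_stops l _ _ yx).
  by move: Sk; rewrite {1}/stops svP// stop_valueS Sly (level_meas_A l _ _ yx).
have : 2 * A l x * mass (fun y => (stops_from l.+1 y)%:R) l x <= A l x * (V l / V L).
  apply: (@le_trans _ _ (\sum_(l.+1 <= k < L.+1) mass (fun y => first k y * F y) l x / V L)).
    rewrite /mass mulr_sumr; under eq_bigr do rewrite E mulr_sumr.
    rewrite exchange_big/= !big_nat; apply: ler_sum => k /andP[lk kL].
    rewrite -[leRHS]/(mass _ l x / V L) -(mass_tower _ _ l k x (ltnW lk))//; last exact: mfirst.
    rewrite /mass mulr_suml; apply: ler_sum => y yx.
    apply: (le_trans (Ale k y lk kL yx)); rewrite le_eqVlt; apply/orP; left; apply/eqP.
    by rewrite /A /mass; field; rewrite !gt_eqF.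
  rewrite -mulr_suml mulrA /A divfK ?gt_eqF// ler_pM2r ?invr_gt0//.
  rewrite /mass exchange_big/=; apply: ler_sum => y _.
  rewrite -mulr_suml -E; case: stops_from; rewrite ?mul1r ?mul0r//.
rewrite -mulrA mulrCA ler_pM2l// => H.
by rewrite ler_pdivlMr// mulrC.
Qed.

(** A leaf has at most one last stop, so the parts of stopping cells left uncovered by later stops
    are disjoint; the indicators are differences of a sequence of booleans and telescope. *)
Lemma sum_last_stop_le (a : nat -> R) x : (forall l, 0 <= a l) -> {homo a : l k / (l <= k)%N >-> l <= k} ->
  \sum_(0 <= l < L.+1) (stops l x && ~~ stops_from l.+1 x)%:R * a l <= a L.
Proof.
move=> a0 ha; apply: (@le_trans _ _ (\sum_(0 <= l < L.+1)
   (((~~ stops_from l.+1 x)%:R - (~~ stops_from l x)%:R) * a L))).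
  rewrite !big_nat; apply: ler_sum => l /andP[_ lL].
  rewrite [in X in _ - X]stops_fromS//.
  case: (stops l x); case: (stops_from l.+1 x) => /=; rewrite ?subrr ?mul0r ?subr0 ?mul1r//.
  exact: ha.
rewrite -mulr_suml telescope_sumr// -[leRHS]mul1r; apply: ler_wpM2r => //.
by case: stops_from; case: stops_from => /=; rewrite ?subr0 ?subrr ?sub0r// lerN10.
Qed.

End stopping.
Lemma massE phi l x : mass phi l x = \sum_y (if r l y == r l x then phi y else 0).
Proof. by rewrite /mass big_mkcond. Qed.

Lemma mass_powR_le (A B : J -> R) s t l x :
  (forall y, 0 <= A y) -> (forall y, 0 <= B y) -> 0 < s -> 0 < t -> s + t = 1 ->
  mass (fun y => A y `^ s * B y `^ t) l x <= mass A l x `^ s * mass B l x `^ t.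
Proof.
move=> A0 B0 s0 t0 st; rewrite !massE.
apply: le_trans (sum_powR_le _ _ _ _ _ _ _ s0 t0 st); last 2 first.
- by move=> y; case: ifP.
- by move=> y; case: ifP.
by apply: ler_sum => y _; case: ifP => // _; rewrite mulr_ge0 ?powR_ge0.
Qed.

Lemma mass_powR3_le (A B D : J -> R) q s t l x :
  (forall y, 0 <= A y) -> (forall y, 0 <= B y) -> (forall y, 0 <= D y) ->
  0 < q -> 0 < s -> 0 < t -> q + s + t = 1 ->
  mass (fun y => A y `^ q * (B y `^ s * D y `^ t)) l x <=
  mass A l x `^ q * (mass B l x `^ s * mass D l x `^ t).
Proof.
move=> A0 B0 D0 q0 s0 t0 qst; rewrite !massE.
apply: le_trans (sum_powR3_le _ _ _ _ _ _ _ _ _ _ q0 s0 t0 qst); last 3 first.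
- by move=> y; case: ifP.
- by move=> y; case: ifP.
- by move=> y; case: ifP.
by apply: ler_sum => y _; case: ifP => // _; rewrite !mulr_ge0 ?powR_ge0.
Qed.

Lemma mass_homo phi k l x : (forall y, 0 <= phi y) -> (k <= l)%N ->
  mass phi l x <= mass phi k x.
Proof.
move=> phi0 kl; rewrite !massE; apply: ler_sum => y _.
by case: (eqVneq (r l y)) => [/(r_homo _ _ _ _ kl) ->|_]; rewrite ?eqxx//; case: ifP.
Qed.

Lemma sparse_mass_le (F sg u : J -> R) (al al' N : R) l x :
  (forall y, 0 <= F y) -> (forall y, 0 < sg y) -> (forall y, 0 < u y) ->
  0 < al -> 0 < al' -> al + al' <= 1 -> 0 <= N ->
  (forall y, V L `^ (al + al') <= u y `^ al * sg y `^ al') ->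
  mass u l x `^ al * mass sg l x `^ al' <= N * V l `^ (al + al') ->
  (l <= L)%N -> stops F l x ->
  mass sg l x <= (2 * N) `^ al'^-1 * mass (fun y => (~~ stops_from F l.+1 y)%:R * sg y) l x.
Proof.
move=> F0 sg0 u0 al0 al'0 al1 N0 leaf Apq lL Sl.
set m := mass (fun y => _ * sg y) l x; set U := mass u l x.
have d0 : 0 < al + al' by rewrite addr_gt0.
have U0 : 0 < U by apply: mass_gt0.
have m0 : 0 <= m by apply: mass_ge0 => y; rewrite mulr_ge0// ltW.
have H1 : V l / 2 <= U `^ (al / (al + al')) * m `^ (al' / (al + al')).
  apply: le_trans (mass_powR_le _ _ _ _ _ _ _ _ _ _ _); last 5 first.
  - by move=> y; exact: ltW.
  - by move=> y; rewrite mulr_ge0// ltW.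
  - exact: divr_gt0.
  - exact: divr_gt0.
  - by rewrite -mulrDl divff ?gt_eqF.
  apply: (@le_trans _ _ (mass (fun y => V L - V L * (stops_from F l.+1 y)%:R) l x)).
    rewrite /mass sumrB -mulr_sumr -![\sum_(_ | _) _]/(mass _ l x) mass_meas//.
    have := mass_stops_from F F0 l x lL Sl.
    set mm := mass _ _ _ => mmle.
    have : V L * mm <= V l / 2.
      rewrite -ler_pdivlMl ?invr_gt0// ?V_gt0//; apply: (le_trans mmle).
      by rewrite le_eqVlt; apply/orP; left; apply/eqP; ring.
    have -> : V L * (V l / V L) = V l by rewrite mulrC divfK ?gt_eqF.
    lra.
  apply: le_mass => y; case: stops_from; first by rewrite mulr1 subrr mulr_ge0 ?powR_ge0.
  rewrite mulr0 subr0 mul1r.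
  have -> : V L = (V L `^ (al + al')) `^ (al + al')^-1.
    by rewrite -powRrM divff ?gt_eqF// powRr1// ltW.
  rewrite [al / _]mulrC [al' / _]mulrC ![_^-1 * _]mulrC !powRrM -powRM ?powR_ge0//.
  rewrite ge0_ler_powR ?nnegrE ?powR_ge0// ?mulr_ge0 ?powR_ge0//.
  by rewrite invr_ge0 ltW.
have H2 : V l `^ (al + al') <= 2 * (U `^ al * m `^ al').
  have Vl0 := ltW (V_gt0 l).
  have : (V l / 2) `^ (al + al') <= U `^ al * m `^ al'.
    apply: (@le_trans _ _ ((U `^ (al / (al + al')) * m `^ (al' / (al + al'))) `^ (al + al'))).
      apply: ge0_ler_powR => //; rewrite ?nnegrE ?mulr_ge0 ?powR_ge0 ?divr_ge0//.
      exact: ltW.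
    by rewrite powRM ?powR_ge0// -!powRrM !divfK ?gt_eqF.
  rewrite powRM// ?invr_ge0//; set X := _ * m `^ _ => H.
  (* As [al + al' <= 1], halving the volume costs at most a factor 2 after raising to the power
     [al + al']. *)
  have p2 : (2^-1 : R) `^ (al + al') >= 2^-1.
    by apply: ger1_powR => //; apply/andP; split; lra.
  have : V l `^ (al + al') * 2^-1 <= X.
    by apply: le_trans H; rewrite ler_wpM2l ?powR_ge0.
  lra.
have H3 : mass sg l x `^ al' <= 2 * N * m `^ al'.
  rewrite -(ler_pM2l (powR_gt0 al U0)); apply: (le_trans Apq).
  apply: (le_trans (ler_wpM2l N0 H2)); rewrite le_eqVlt; apply/orP; left; apply/eqP; ring.
have sg0' : 0 <= mass sg l x by apply: mass_ge0 => y; exact: ltW.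
have -> : mass sg l x = (mass sg l x `^ al') `^ al'^-1.
  by rewrite -powRrM divff ?gt_eqF// powRr1.
have -> : m = (m `^ al') `^ al'^-1 by rewrite -powRrM divff ?gt_eqF// powRr1.
have N20 : 0 <= 2 * N by rewrite mulr_ge0.
rewrite -powRM ?powR_ge0//; apply: ge0_ler_powR => //.
- by rewrite invr_ge0 ltW.
- by rewrite nnegrE powR_ge0.
- by rewrite nnegrE mulr_ge0 ?powR_ge0.
Qed.

(** * Geometric sums over all descendants of a cell *)

Section descendants.
Variables (sg u : J -> R) (al al' g b N : R).
Hypothesis sg_gt0 : forall x, 0 < sg x.
Hypothesis u_gt0 : forall x, 0 < u x.
Hypothesis al_gt0 : 0 < al.
Hypothesis al'_gt0 : 0 < al'.
Hypothesis g_gt0 : 0 < g.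
Hypothesis exps : g + al + al' = 1.
Hypothesis b_gt1 : 1 < b.
Hypothesis V_step : forall l, (l < L)%N -> V l = b * V l.+1.
Hypothesis N_ge0 : 0 <= N.
Hypothesis Apq : forall l x, (l <= L)%N ->
  mass u l x `^ al * mass sg l x `^ al' <= N * V l `^ (al + al').

Definition cell_coef l x := V l `^ (g - 1) * (mass sg l x * mass u l x).

(** For [al = 1/q], [al' = 1/p'] and [g = 1/p - 1/q] this is [sg(Q)^(1/p) * u(Q)^(1/q')], the
    product suited to Hoelder. Its exponents [g + al] and [g + al'] split as [g], [al] for [sg] and
    [g], [al'] for [u], which is what three-factor Hoelder needs below. *)
Definition cell_prod l x := mass sg l x `^ (g + al) * mass u l x `^ (g + al').

Definition geom_ratio : R := b `^ (1 - g).

(** The geometric series factor, enlarged by [1 / g] because [powR_le_tangent] is used with exponent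
    [g]. *)
Definition geom_const : R := geom_ratio / (geom_ratio - 1) / g.

Lemma geom_ratio_gt1 : 1 < geom_ratio.
Proof.
have g1 : 0 < 1 - g by move: exps al_gt0 al'_gt0; lra.
have := gt0_ltr_powR g1 _ _ b_gt1; rewrite powR1; apply; rewrite nnegrE//.
by rewrite ltW// (lt_trans ltr01).
Qed.

Lemma geom_const_ge : geom_ratio / (geom_ratio - 1) <= geom_const.
Proof.
have r1 := geom_ratio_gt1.
have g1 : g < 1 by move: exps al_gt0 al'_gt0; lra.
rewrite /geom_const ler_pdivlMr// -[leRHS]mulr1 ler_wpM2l ?(ltW g1)//.
by rewrite divr_ge0// ?subr_ge0 ltW// (lt_trans ltr01).
Qed.

Lemma cell_coef_step l : (l < L)%N -> V l.+1 `^ (g - 1) = geom_ratio * V l `^ (g - 1).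
Proof.
move=> lL; have b0 : 0 < b by apply: lt_trans b_gt1.
rewrite (V_step l lL) powRM ?(ltW b0) ?(ltW (V_gt0 _))// mulrA /geom_ratio.
by rewrite -powRD_gt0// (_ : 1 - g + (g - 1) = 0) ?powRr0 ?mul1r//; ring.
Qed.

(** One factor [u^al * sg^al'] is split off from [sg * u] and estimated by the weight condition; the
    powers of the volume cancel since [g + al + al' = 1]. *)
Lemma cell_coef_le l x : (l <= L)%N -> cell_coef l x <= N * cell_prod l x.
Proof.
move=> lL; rewrite /cell_coef /cell_prod.
have s0 := mass_gt0 _ l x sg_gt0; have u0 := mass_gt0 _ l x u_gt0.
set s := mass sg l x in s0 *; set v := mass u l x in u0 *.
have vE : v = v `^ al * v `^ (g + al').
  rewrite -powRD_gt0//.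
  by rewrite addrCA addrA exps powRr1// ltW.
have sE : s = s `^ al' * s `^ (g + al).
  rewrite -powRD_gt0//.
  by rewrite [al' + _]addrC exps powRr1// ltW.
have VE : V l `^ (g - 1) * V l `^ (al + al') = 1.
  rewrite -powRD_gt0//.
  by rewrite addrAC addrA exps subrr powRr0.
rewrite [in leLHS]vE [in leLHS]sE.
set X := s `^ (g + al) * v `^ (g + al').
have X0 : 0 <= X by rewrite mulr_ge0 ?powR_ge0.
have := Apq l x lL; rewrite -/s -/v => H.
have {}H := ler_wpM2r X0 (ler_wpM2l (powR_ge0 (V l) (g - 1)) H).
apply: le_trans (le_trans H _); rewrite le_eqVlt; apply/orP; left; apply/eqP.
  by rewrite /X; ring.
by rewrite [V l `^ (g - 1) * _]mulrCA VE mulr1.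
Qed.

Let wt k := V L / V k.

(** Let [h] be the share of [sg(Q) * u(Q)] kept by the sum of these products over the children. The
    coefficients of the children add up to [geom_ratio * h] times that of [Q], so the left side is
    [(1 - h) * geom_ratio / (geom_ratio - 1)] times [cell_coef]. Either [h] is near 1 and the next
    generation carries more, or [cell_prod] falls by a proportion of at least
    [1 - h^g >= g * (1 - h)], which pays. *)
Lemma cell_step l x : (l < L)%N ->
  (geom_ratio / (geom_ratio - 1)) * cell_coef l x
    - (geom_ratio - 1)^-1 * mass (fun y => cell_coef l.+1 y * wt l.+1) l x
  <= geom_const * N * (cell_prod l x - mass (fun y => cell_prod l.+1 y * wt l.+1) l x).
Proof.
move=> lL; have lL' := ltnW lL.
have r1 := geom_ratio_gt1.
have w0 k : 0 < wt k by rewrite divr_gt0.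
have m0 k y : 0 < mass sg k y by exact: mass_gt0.
have m0' k y : 0 < mass u k y by exact: mass_gt0.
have tow phi : mass (fun y => mass phi l.+1 y * wt l.+1) l x = mass phi l x.
  exact: mass_tower1.
set s := mass sg l x; set v := mass u l x.
pose H := mass (fun y => mass sg l.+1 y * mass u l.+1 y * wt l.+1) l x.
have s0 : 0 < s by exact: m0.
have v0 : 0 < v by exact: m0'.
have sv0 : 0 < s * v by rewrite mulr_gt0.
have H0 : 0 <= H by apply: mass_ge0 => y; apply: mulr_ge0; [apply: mulr_ge0|]; exact: ltW.
have Hle : H <= s * v.
  rewrite /H /v -(tow u) /mass mulr_sumr; apply: ler_sum => y /eqP yx.
  rewrite -mulrA; apply: ler_wpM2r; first exact: mulr_ge0 (ltW (m0' _ _)) (ltW (w0 _)).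
  rewrite /s -(level_meas_mass _ _ _ _ yx); apply: (mass_homo _ l l.+1) => // z; exact: ltW.
have coefE : mass (fun y => cell_coef l.+1 y * wt l.+1) l x = geom_ratio * V l `^ (g - 1) * H.
  rewrite /H /mass mulr_sumr; apply: eq_bigr => y _.
  by rewrite /cell_coef cell_coef_step// !mulrA.
(* Hoelder over the children with exponents [g], [al], [al'] applied to [sg * u], [sg] and [u]; the
   weight [wt l.+1] is split into the same three powers. *)
have prodle : mass (fun y => cell_prod l.+1 y * wt l.+1) l x <= H `^ g * (s `^ al * v `^ al').
  rewrite /H /s /v -(tow sg) -(tow u).
  apply: le_trans (mass_powR3_le _ _ _ _ _ _ _ _ _ _ _ g_gt0 al_gt0 al'_gt0 exps); last 3 first.
  - by move=> y; apply: mulr_ge0; [apply: mulr_ge0|]; exact: ltW.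
  - by move=> y; apply: mulr_ge0; exact: ltW.
  - by move=> y; apply: mulr_ge0; exact: ltW.
  apply: le_mass => y; rewrite le_eqVlt; apply/orP; left; apply/eqP.
  rewrite /cell_prod; move: (wt l.+1) (w0 l.+1) => z z0.
  rewrite !powRM ?mulr_ge0// ?ltW// !powRD_gt0//.
  have zE : z = z `^ g * z `^ al * z `^ al'.
    by rewrite -!powRD_gt0// exps powRr1// ltW.
  by rewrite [X in _ * X = _]zE; ring.
have prodE : cell_prod l x = (s * v) `^ g * (s `^ al * v `^ al').
  rewrite /cell_prod -/s -/v powRM ?ltW// !powRD_gt0//.
  by ring.
have g1 : g < 1 by move: exps al_gt0 al'_gt0; lra.
pose h := H / (s * v).
have HE : H = h * (s * v) by rewrite /h divfK// gt_eqF.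
have h0 : 0 <= h by rewrite divr_ge0// ltW.
have tang := powR_le_tangent h g h0 g_gt0 g1.
have c0 : 0 <= geom_const by rewrite /geom_const !divr_ge0 ?subr_ge0// ltW// (lt_trans ltr01).
apply: (@le_trans _ _ (geom_const * N * (cell_prod l x * (1 - h `^ g)))); last first.
  apply: ler_wpM2l; first by rewrite mulr_ge0.
  rewrite mulrBr mulr1; apply: lerB => //; apply: (le_trans prodle).
  rewrite (_ : _ * (_ * _) = cell_prod l x * h `^ g)//.
  rewrite prodE HE [(h * _) `^ g]powRM//; last exact: ltW.
  ring.
apply: (@le_trans _ _ (geom_const * g * cell_coef l x * (1 - h))).
  rewrite coefE /cell_coef -/s -/v HE le_eqVlt; apply/orP; left; apply/eqP.
  rewrite /geom_const; field.
  by rewrite (gt_eqF g_gt0) subr_eq0 (gt_eqF r1).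
have cp0 : 0 <= cell_prod l x by rewrite /cell_prod mulr_ge0 ?powR_ge0.
have h1 : 0 <= 1 - h by rewrite subr_ge0 ler_pdivrMr// mul1r.
apply: (@le_trans _ _ (geom_const * g * (N * cell_prod l x) * (1 - h))).
  apply: ler_wpM2r => //; apply: ler_wpM2l; last exact: cell_coef_le.
  by rewrite mulr_ge0// ltW.
have -> : geom_const * g * (N * cell_prod l x) * (1 - h) =
  geom_const * N * (cell_prod l x * (g * (1 - h))) by ring.
by apply: (ler_wpM2l (mulr_ge0 c0 N_ge0)); exact: (ler_wpM2l cp0 tang).
Qed.

(** Adding [cell_step] over the generations, the differences of [G] and of [Y] telescope. The
    surviving terms at level [L] are covered by [cell_coef_le], and the surviving term in [G l] has
    the favourable sign. *)
Lemma sum_descendants l x : (l <= L)%N ->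
  \sum_(l <= k < L.+1) mass (fun y => cell_coef k y * wt k) l x <= geom_const * N * cell_prod l x.
Proof.
move=> lL; pose G k := mass (fun y => cell_coef k y * wt k) l x.
pose Y k := mass (fun y => cell_prod k y * wt k) l x.
have r1 := geom_ratio_gt1.
have w0 k : 0 < wt k by rewrite divr_gt0.
have G0 k : 0 <= G k.
  apply: mass_ge0 => y; rewrite mulr_ge0 ?(ltW (w0 _))// /cell_coef !mulr_ge0 ?powR_ge0//.
  - by apply: mass_ge0 => z; exact: ltW.
  - by apply: mass_ge0 => z; exact: ltW.
have Yl : Y l = cell_prod l x.
  rewrite /Y mass_meas//; last first.
    by move=> y z yz; rewrite /cell_prod !(level_meas_mass _ _ _ _ yz).
  by rewrite /wt; field; rewrite !gt_eqF.
have tow k phi : (l <= k)%N -> (k < L)%N ->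
    mass (fun y => mass (fun z => phi z * wt k.+1) k y * wt k) l x = mass (fun z => phi z * wt k.+1) l x.
  by move=> lk kL; apply: (mass_tower1 (fun z => phi z * wt k.+1)) => //; exact: ltnW.
have step k : (l <= k < L)%N ->
    geom_ratio / (geom_ratio - 1) * G k - (geom_ratio - 1)^-1 * G k.+1 <= geom_const * N * (Y k - Y k.+1).
  move=> /andP[lk kL]; rewrite /G /Y -(tow k (cell_coef k.+1) lk kL) -(tow k (cell_prod k.+1) lk kL).
  rewrite /mass !mulr_sumr -!sumrB mulr_sumr; apply: ler_sum => y _.
  have := ler_wpM2r (ltW (w0 k)) (cell_step k y kL); rewrite /mass => H.
  apply: le_trans (le_trans H _); rewrite le_eqVlt; apply/orP; left; apply/eqP; ring.
have c0 : 0 <= geom_const * N.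
  by rewrite mulr_ge0// /geom_const !divr_ge0 ?subr_ge0// ltW// (lt_trans ltr01).
have last : geom_ratio / (geom_ratio - 1) * G L <= geom_const * N * Y L.
  rewrite /G /Y /mass !mulr_sumr; apply: ler_sum => y _; rewrite [leLHS]mulrA [leRHS]mulrA.
  apply: (ler_wpM2r (ltW (w0 L))).
  rewrite -[leRHS]mulrA; apply: ler_pM geom_const_ge (cell_coef_le _ _ _) => //.
  - by rewrite divr_ge0 ?subr_ge0// ltW// (lt_trans ltr01).
  - rewrite /cell_coef !mulr_ge0 ?powR_ge0//.
    + by apply: mass_ge0 => z; exact: ltW.
    + by apply: mass_ge0 => z; exact: ltW.
have stepS : \sum_(l <= k < L) (geom_ratio / (geom_ratio - 1) * G k - (geom_ratio - 1)^-1 * G k.+1)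
    <= geom_const * N * (Y l - Y L).
  apply: (@le_trans _ _ (\sum_(l <= k < L) geom_const * N * (Y k - Y k.+1))).
    by rewrite !big_nat; apply: ler_sum => k; exact: step.
  rewrite -mulr_sumr -opprB -(telescope_sumr Y)// -sumrN.
  by under [in leRHS]eq_bigr do rewrite opprB.
have E k : geom_ratio / (geom_ratio - 1) * G k - (geom_ratio - 1)^-1 * G k.+1
    = G k - ((geom_ratio - 1)^-1 * G k.+1 - (geom_ratio - 1)^-1 * G k).
  by field; rewrite subr_eq0 (gt_eqF r1).
move: stepS; under eq_bigr do rewrite E.
rewrite sumrB (telescope_sumr (fun k => (geom_ratio - 1)^-1 * G k))// => stepS.
rewrite big_nat_recr//= -/(G L) -Yl.
have : 0 <= (geom_ratio - 1)^-1 * G l by rewrite mulr_ge0// invr_ge0 subr_ge0 ltW.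
have rE : geom_ratio / (geom_ratio - 1) * G L = G L + (geom_ratio - 1)^-1 * G L.
  by field; rewrite subr_eq0 (gt_eqF r1).
move: stepS last; rewrite rE /G /Y.
set S1 := \sum_(_ <= _ < _) _; move: (mass _ l x) => GL; lra.
Qed.

End descendants.
(** Hoelder over all cells with exponents [Q'] and [Q]. The increments give a telescoping sum of
    [Q']-th powers; the other factor is a Carleson embedding, in which each stopping cell is charged
    to its own uncovered part at the price [kap]. *)
Lemma carleson_term (F sg u f h : J -> R) (P Q' Q kap : R) :
  (forall y, 0 <= F y) -> (forall y, 0 < sg y) -> (forall y, 0 < u y) ->
  (forall y, 0 <= f y) -> (forall y, 0 <= h y) ->
  1 < P -> 1 < Q' -> Q'^-1 + Q^-1 = 1 -> P <= Q -> 0 <= kap ->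
  (forall l x, (l <= L)%N -> stops F l x ->
     mass sg l x <= kap * mass (fun y => (~~ stops_from F l.+1 y)%:R * sg y) l x) ->
  \sum_(0 <= l < L.+1) \sum_x (maxf (stops F) u h l.+1 x - maxf (stops F) u h l x) *
     maxf (stops F) sg f l.+1 x *
     (mass sg l x `^ P^-1 * mass u l x `^ Q'^-1) * (V L / V l)
  <= (\sum_x u x * maxf (stops F) u h L.+1 x `^ Q') `^ Q'^-1 *
     (kap `^ Q^-1 * (\sum_x sg x * maxf (stops F) sg f L.+1 x `^ P) `^ P^-1).
Proof.
move=> F0 sg0 u0 f0 h0 P1 Q'1 QQ PQ kap0 sparse.
set M := maxf (stops F) sg f; set N := maxf (stops F) u h.
have P0 : 0 < P by apply: lt_trans P1.
have Q'0 : 0 < Q' by apply: lt_trans Q'1.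
have Q0 : 0 < Q by apply: lt_le_trans PQ.
have M0 l x : 0 <= M l x by exact: rmax_ge0.
have N0 l x : 0 <= N l x by exact: rmax_ge0.
have Nle l x : N l x <= N l.+1 x by exact: rmax_le_succ.
have n0 l x : 0 <= N l.+1 x - N l x by rewrite subr_ge0.
have w0 l : 0 < V L / V l by rewrite divr_gt0.
have ms0 l x : 0 <= mass sg l x by apply: mass_ge0 => y; exact: ltW.
have mu0 l x : 0 <= mass u l x by apply: mass_ge0 => y; exact: ltW.
have mM l : level_meas l (M l.+1) by apply: level_meas_maxf; exact: level_meas_stops.
have mN l : level_meas l (N l.+1) by apply: level_meas_maxf; exact: level_meas_stops.
have mN' l : level_meas l (N l) by apply: level_meas_maxf_pred; exact: level_meas_stops.
pose a (z : 'I_L.+1 * J) := (N z.1.+1 z.2 - N z.1 z.2) * mass u z.1 z.2 `^ Q'^-1.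
pose c (z : 'I_L.+1 * J) := (stops F z.1 z.2)%:R * M z.1.+1 z.2 * mass sg z.1 z.2 `^ P^-1.
pose w (z : 'I_L.+1 * J) := V L / V z.1.
have w'0 z : 0 <= w z := ltW (w0 z.1).
have a0 z : 0 <= a z by rewrite mulr_ge0 ?powR_ge0.
have c0 z : 0 <= c z by rewrite !mulr_ge0 ?powR_ge0.
have H := weighted_hoelder_sum _ w a c Q' Q w'0 a0 c0 Q'0 Q0 QQ.
have pairE (G : nat -> J -> R) :
    \sum_(z : 'I_L.+1 * J) G z.1 z.2 = \sum_(0 <= l < L.+1) \sum_x G l x.
  by rewrite big_mkord pair_bigA.
(* The stopping indicator hidden in [c] changes nothing: where the cell does not stop, the increment
   of [N] is zero. *)
have E : \sum_z w z * (a z * c z) = \sum_(0 <= l < L.+1) \sum_x (N l.+1 x - N l x) * M l.+1 x *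
     (mass sg l x `^ P^-1 * mass u l x `^ Q'^-1) * (V L / V l).
  rewrite -pairE; apply: eq_bigr => -[l x] _; rewrite /w /a /c /=.
  rewrite /N /maxf; case: (rmax_stepP (stops F ^~ x) (avg u h ^~ x) l) => [->|-> -> _].
    by rewrite subrr !mul0r mulr0.
  rewrite mul1r; ring.
rewrite -E; apply: (le_trans H); apply: ler_pM; rewrite ?powR_ge0//.
  apply: ge0_ler_powR; first by rewrite invr_ge0 ltW.
  - by rewrite nnegrE; apply: sumr_ge0 => z _; rewrite mulr_ge0 ?powR_ge0.
  - by rewrite nnegrE; apply: sumr_ge0 => z _; rewrite mulr_ge0 ?powR_ge0// ltW.
  have -> : \sum_z w z * a z `^ Q' =
      \sum_(0 <= l < L.+1) \sum_x (N l.+1 x - N l x) `^ Q' * mass u l x * (V L / V l).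
    rewrite -pairE; apply: eq_bigr => -[l x] _; rewrite /w /a /=.
    rewrite powRM ?powR_ge0// -[in mass _ _ _ `^ _ `^ _]powRrM mulVf ?gt_eqF// powRr1//.
    by rewrite mulrC.
  have tel x : N L.+1 x `^ Q' = \sum_(0 <= l < L.+1) (N l.+1 x `^ Q' - N l x `^ Q').
    by rewrite (telescope_sumr (fun l => N l x `^ Q'))// [N 0 x]/= powR0 ?gt_eqF// subr0.
  under [leRHS]eq_bigr => x _ do rewrite tel mulr_sumr.
  rewrite [leRHS]exchange_big/= !big_nat; apply: ler_sum => l /andP[_ lL].
  rewrite sum_mass//; last by move=> x y xy; rewrite (mN _ _ _ xy) (mN' _ _ _ xy).
  apply: ler_sum => x _; rewrite mulrC; apply: ler_wpM2l; first exact: ltW.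
  by apply: powR_superadditive => //; exact: ltW.
set B := \sum_x sg x * M L.+1 x `^ P.
have B0 : 0 <= B by apply: sumr_ge0 => x _; rewrite mulr_ge0 ?powR_ge0// ltW.
have BE : kap `^ Q^-1 * B `^ P^-1 = (kap * B `^ (Q / P)) `^ Q^-1.
  by rewrite powRM ?powR_ge0// -powRrM mulrAC divff ?gt_eqF// mul1r.
rewrite BE; apply: ge0_ler_powR; first by rewrite invr_ge0 ltW.
- by rewrite nnegrE; apply: sumr_ge0 => z _; rewrite mulr_ge0 ?powR_ge0.
- by rewrite nnegrE mulr_ge0 ?powR_ge0.
have QP : 0 <= Q / P - 1 by rewrite subr_ge0 ler_pdivlMr// mul1r.
have MP l x : (l <= L)%N -> M l.+1 x `^ P * mass sg l x <= B.
  move=> lL; rewrite -(mass_pull (fun x => M l.+1 x `^ P)); last by move=> y z yz; rewrite (mM _ _ _ yz).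
  rewrite massE; apply: ler_sum => y _; case: ifP => _; last by rewrite mulr_ge0 ?powR_ge0// ltW.
  rewrite mulrC; apply: ler_wpM2l; first exact: ltW.
  apply: ge0_ler_powR; rewrite ?nnegrE ?M0//; first exact: ltW.
  by apply: (rmax_homo (stops F ^~ y)); rewrite ltnS.
have cle z : c z `^ Q <= B `^ (Q / P - 1) *
   ((stops F z.1 z.2)%:R * (M z.1.+1 z.2 `^ P * mass sg z.1 z.2)).
  case: z => l x; rewrite /c /=; case: (stops F l x); last first.
    by rewrite !mul0r powR0 ?gt_eqF// mulr0.
  rewrite !mul1r; have lL : (l <= L)%N by rewrite -ltnS.
  set Y := M l.+1 x `^ P * mass sg l x.
  have Y0 : 0 <= Y by rewrite mulr_ge0 ?powR_ge0.
  have -> : (M l.+1 x * mass sg l x `^ P^-1) `^ Q = Y `^ (Q / P).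
    rewrite /Y !powRM ?powR_ge0// -!powRrM; congr (_ `^ _ * _ `^ _).
      by rewrite mulrC divfK ?gt_eqF.
    by rewrite mulrC.
  have QP0 : 0 < Q / P by rewrite divr_gt0.
  rewrite -(mulr_powRB1 Y0 QP0) mulrC; apply: ler_wpM2r => //.
  by apply: ge0_ler_powR; rewrite ?nnegrE// MP.
apply: (@le_trans _ _ (B `^ (Q / P - 1) * (kap * B))); last first.
  have QP0 : 0 < Q / P by rewrite divr_gt0.
  rewrite -(mulr_powRB1 B0 QP0) le_eqVlt; apply/orP; left; apply/eqP; ring.
apply: (@le_trans _ _ (\sum_z B `^ (Q / P - 1) *
   (w z * ((stops F z.1 z.2)%:R * (M z.1.+1 z.2 `^ P * mass sg z.1 z.2))))).
  apply: ler_sum => z _; rewrite [leRHS]mulrCA; apply: ler_wpM2l => //.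
rewrite -mulr_sumr; apply: ler_wpM2l; first exact: powR_ge0.
pose kept l y : R := (~~ stops_from F l.+1 y)%:R.
apply: (@le_trans _ _ (\sum_(0 <= l < L.+1) \sum_x
   kap * (((stops F l x)%:R * M l.+1 x `^ P) * mass (fun y => kept l y * sg y) l x * (V L / V l)))).
  rewrite -pairE; apply: ler_sum => -[l x] _; rewrite /w /=.
  have lL : (l <= L)%N by rewrite -ltnS.
  case: (boolP (stops F l x)) => [Sl|_]; last by rewrite !mul0r !mulr0.
  rewrite !mul1r.
  have := ler_wpM2l (mulr_ge0 (powR_ge0 (M l.+1 x) P) (ltW (w0 l))) (sparse l x lL Sl).
  move=> K; apply: le_trans (le_trans K _); rewrite le_eqVlt; apply/orP; left; apply/eqP; rewrite /kept; ring.
under eq_bigr do rewrite -mulr_sumr; rewrite -mulr_sumr; apply: ler_wpM2l => //.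
apply: (@le_trans _ _ (\sum_(0 <= l < L.+1) \sum_x
   sg x * ((stops F l x && ~~ stops_from F l.+1 x)%:R * M l.+1 x `^ P))).
  rewrite !big_nat; apply: ler_sum => l /andP[_ lL].
  rewrite sum_mass//; last by move=> x y xy; rewrite (mM _ _ _ xy) (level_meas_stops _ _ _ _ xy).
  apply: ler_sum => x _; rewrite /kept; case: (stops F l x); case: (stops_from F l.+1 x) => /=;
    rewrite ?mul0r ?mulr0 ?mul1r// le_eqVlt; apply/orP; left; apply/eqP; ring.
rewrite exchange_big/=; apply: ler_sum => x _; rewrite -mulr_sumr.
apply: ler_wpM2l; first exact: ltW.
apply: (sum_last_stop_le _ (fun l => M l.+1 x `^ P)) => [l|l k lk]; first exact: powR_ge0.
apply: ge0_ler_powR; rewrite ?nnegrE ?M0//; first exact: ltW.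
by apply: (rmax_homo (stops F ^~ x)); rewrite ltnS.
Qed.

(* Abel summation in both running maxima: the increments of the product are
   split into one sum with increments of [maxf sg f] and one with [maxf u h]. *)
Lemma sum_maxf_mul_le (S : nat -> J -> bool) (sg u f h : J -> R) (c X : nat -> J -> R) (G : R) :
  (forall l, level_meas l (S l)) -> (forall y, 0 < sg y) -> (forall y, 0 < u y) ->
  (forall y, 0 <= f y) -> (forall y, 0 <= h y) ->
  (forall l y, 0 <= c l y) ->
  (forall l x, (l <= L)%N ->
    \sum_(l <= k < L.+1) mass (fun y => c k y * (V L / V k)) l x <= G * X l x) ->
  \sum_(0 <= l < L.+1) \sum_x c l x * (maxf S sg f l.+1 x * maxf S u h l.+1 x) * (V L / V l) <=
  G * (\sum_(0 <= l < L.+1) \sum_x (maxf S sg f l.+1 x - maxf S sg f l x) *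
           maxf S u h l.+1 x * X l x * (V L / V l) +
       \sum_(0 <= l < L.+1) \sum_x (maxf S u h l.+1 x - maxf S u h l x) *
           maxf S sg f l.+1 x * X l x * (V L / V l)).
Proof.
move=> mS sg0 u0 f0 h0 c0 desc.
set M := maxf S sg f; set N := maxf S u h.
have M0 l x : 0 <= M l x by exact: rmax_ge0.
have N0 l x : 0 <= N l x by exact: rmax_ge0.
have Mle l x : M l x <= M l.+1 x by exact: rmax_le_succ.
have Nle l x : N l x <= N l.+1 x by exact: rmax_le_succ.
have w0 l : 0 < V L / V l by rewrite divr_gt0.
have mM l : level_meas l (M l.+1) by exact: level_meas_maxf.
have mN l : level_meas l (N l.+1) by exact: level_meas_maxf.
have mM' l : level_meas l (M l) by exact: level_meas_maxf_pred.
have mN' l : level_meas l (N l) by exact: level_meas_maxf_pred.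
pose H k x := (M k.+1 x - M k x) * N k.+1 x + (N k.+1 x - N k x) * M k.+1 x.
have mH k : level_meas k (H k).
  by move=> x y xy; rewrite /H (mM _ _ _ xy) (mN _ _ _ xy) (mM' _ _ _ xy) (mN' _ _ _ xy).
have H0 k x : 0 <= H k x by rewrite addr_ge0 ?mulr_ge0 ?subr_ge0.
(* The increment of the product falls short of [H] by the product of the two increments, which is
   nonnegative. *)
have MN l x : (l < L.+1)%N -> M l.+1 x * N l.+1 x <= \sum_(0 <= k < L.+1 | true && (k < l.+1)%N) H k x.
  move=> lL; rewrite -big_nat_widen//.
  apply: (@le_trans _ _ (\sum_(0 <= k < l.+1) (M k.+1 x * N k.+1 x - M k x * N k x))).
    by rewrite (telescope_sumr (fun k => M k x * N k x))// [M 0 x]/= mul0r subr0.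
  apply: ler_sum => k _; rewrite /H -subr_ge0.
  rewrite (_ : _ - _ = (M k.+1 x - M k x) * (N k.+1 x - N k x)); last by ring.
  by rewrite mulr_ge0 ?subr_ge0.
apply: (@le_trans _ _ (\sum_(0 <= l < L.+1) \sum_(0 <= k < L.+1 | true && (k < l.+1)%N)
   \sum_x H k x * (c l x * (V L / V l)))).
  rewrite !big_nat; apply: ler_sum => l /andP[_ lL].
  rewrite exchange_big/=; apply: ler_sum => x _.
  rewrite -mulr_suml mulrAC mulrC; apply: ler_wpM2r; last exact: MN.
  by rewrite mulr_ge0// ltW.
rewrite (exchange_big_dep xpredT)//= -big_split/= mulr_sumr [leLHS]big_nat [leRHS]big_nat.
apply: ler_sum => k /andP[_ kL].
rewrite (eq_bigl (fun l => true && (k <= l)%N))// -big_nat_widenl//.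
apply: (@le_trans _ _ (\sum_(k <= l < L.+1) \sum_x
     H k x * mass (fun y => c l y * (V L / V l)) k x * (V L / V k))).
  by apply: ler_sum => l _; rewrite sum_mass.
rewrite exchange_big/= -big_split/= mulr_sumr; apply: ler_sum => x _.
rewrite -mulr_suml -mulr_sumr.
rewrite [leRHS](_ : _ = H k x * (G * X k x) * (V L / V k)); last by rewrite /H; ring.
by apply: (ler_wpM2r (ltW (w0 k))); apply: ler_wpM2l => //; exact: desc.
Qed.

(** * The weighted bound for dyadic potentials *)

Section dyadic_potential.
Variables (F sg u : J -> R) (p q g b D K : R).
Hypothesis F_ge0 : forall x, 0 <= F x.
Hypothesis sg_gt0 : forall x, 0 < sg x.
Hypothesis u_gt0 : forall x, 0 < u x.
Hypothesis p_gt1 : 1 < p.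
Hypothesis pq : p < q.
Hypothesis gE : q^-1 = p^-1 - g.
Hypothesis g_gt0 : 0 < g.
Hypothesis b_gt1 : 1 < b.
Hypothesis V_step : forall l, (l < L)%N -> V l = b * V l.+1.
Hypothesis K_ge0 : 0 <= K.
Hypothesis leaf : forall x, V L `^ (q^-1 + (1 - p^-1)) <= u x `^ q^-1 * sg x `^ (1 - p^-1).
Hypothesis Apq : forall l x, (l <= L)%N ->
  mass u l x `^ q^-1 * mass sg l x `^ (1 - p^-1) <= K * V l `^ (q^-1 + (1 - p^-1)).
Hypothesis D_ge0 : 0 <= D.
Hypothesis V_geom : forall k, (k <= L)%N -> \sum_(k <= l < L.+1) V l `^ g <= D * V k `^ g.

Definition potential x := \sum_(0 <= l < L.+1) V l `^ (g - 1) * mass F l x.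

(** Duality with the extremal function: testing against [h = potential^(q - 1)] produces the same
    sum [X] on the right to the power [1 / q'], which is then absorbed. The two powers of [2 * K]
    come from the two halves [T1] and [T2] of the summation by parts, and [p / (p - 1)] and [q] are
    the two Doob constants. *)
Lemma dyadic_potential_le :
  (\sum_x u x * potential x `^ q) `^ q^-1 <=
  2 * D * (geom_const g b * K *
    ((2 * K) `^ ((1 - p^-1) / q^-1) + (2 * K) `^ (q^-1 / (1 - p^-1)))) * (p / (p - 1)) * q *
  (\sum_x F x `^ p * sg x `^ (1 - p)) `^ p^-1.
Proof.
have p0 : 0 < p by exact: lt_trans p_gt1.
have q1 : 1 < q by exact: lt_trans pq.
have q0 : 0 < q by exact: lt_trans q1.
have al0 : 0 < q^-1 by rewrite invr_gt0.
have al'0 : 0 < 1 - p^-1 by rewrite subr_gt0 invf_lt1.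
have exps : g + q^-1 + (1 - p^-1) = 1 by rewrite gE; ring.
have w0 l : 0 < V L / V l by rewrite divr_gt0.
set X := \sum_x u x * potential x `^ q.
have pot0 x : 0 <= potential x.
  by apply: sumr_ge0 => l _; rewrite mulr_ge0 ?powR_ge0 ?mass_ge0.
have X0 : 0 <= X by apply: sumr_ge0 => x _; rewrite mulr_ge0 ?powR_ge0// ltW.
pose q' := q / (q - 1); pose p' := p / (p - 1).
have q1n : 0 < q - 1 by rewrite subr_gt0.
have p1n : 0 < p - 1 by rewrite subr_gt0.
have q'V : q'^-1 = 1 - q^-1 by rewrite /q'; field; rewrite !gt_eqF.
have p'V : p'^-1 = 1 - p^-1 by rewrite /p'; field; rewrite !gt_eqF.
have q'0 : 0 < q' by rewrite divr_gt0.
have p'0 : 0 < p' by rewrite divr_gt0.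
have q'1 : 1 < q' by rewrite /q' ltr_pdivlMr// mul1r gtrBl.
have q'p' : q' <= p' by rewrite -lef_pV2 ?posrE// q'V p'V lerB// lef_pV2 ?posrE// ltW.
pose h x := potential x `^ (q - 1); pose f x := F x / sg x.
have h0 x : 0 <= h x by exact: powR_ge0.
have f0 x : 0 <= f x by rewrite divr_ge0// ltW.
have sgf x : sg x * f x = F x by rewrite /f mulrC divfK// gt_eqF.
pose S := stops F; have mS l : level_meas l (S l) by exact: level_meas_stops.
pose M := maxf S sg f; pose N := maxf S u h.
pose c := cell_coef sg u g; pose Z := cell_prod sg u q^-1 (1 - p^-1) g.
have c0 l x : 0 <= c l x.
  by rewrite /c /cell_coef !mulr_ge0 ?powR_ge0//; apply: mass_ge0 => y; exact: ltW.
have H1 : X <= 2 * D * \sum_(0 <= l < L.+1) \sum_x c l x * (M l.+1 x * N l.+1 x) * (V L / V l).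
  apply: (@le_trans _ _ (\sum_x u x * h x * (2 * D * \sum_(0 <= l < L.+1)
      (S l x)%:R * (V l `^ g * (mass F l x / V l))))).
    apply: ler_sum => x _; rewrite -mulrA; apply: ler_wpM2l; first exact: ltW.
    rewrite /h -(mulr_powRB1 (pot0 x) q0) mulrC; apply: ler_wpM2l; first exact: powR_ge0.
    apply: le_trans (sparse_domination F F_ge0 (fun l => V l `^ g) D x D_ge0 (fun=> powR_ge0 _ _) V_geom).
    apply: ler_sum => l _; rewrite powRB ?(gt_eqF (V_gt0 _)) ?implybT// powRr1 ?(ltW (V_gt0 _))//.
    by rewrite le_eqVlt; apply/orP; left; apply/eqP; ring.
  under eq_bigr do rewrite mulrCA mulr_sumr.
  rewrite -mulr_sumr; apply: ler_wpM2l; first by rewrite mulr_ge0.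
  rewrite exchange_big/= !big_nat; apply: ler_sum => l /andP[_ lL].
  have -> : \sum_x u x * h x * ((S l x)%:R * (V l `^ g * (mass F l x / V l))) =
      \sum_x ((S l x)%:R * (V l `^ g * (mass F l x / V l))) * (u x * h x).
    by apply: eq_bigr => x _; rewrite mulrC.
  rewrite -(sum_mass _ _ l lL); last first.
    by move=> x y xy; rewrite (mS _ _ _ xy) (level_meas_mass _ _ _ _ xy).
  apply: ler_sum => x _; apply: ler_wpM2r; first exact: ltW.
  have avgF : mass F l x = avg sg f l x * mass sg l x.
    rewrite /avg divfK ?gt_eqF ?mass_gt0//.
    by apply: eq_bigr => y _; rewrite sgf.
  have avgh : mass (fun y => u y * h y) l x = avg u h l x * mass u l x.
    by rewrite /avg divfK ?gt_eqF ?mass_gt0.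
  case: (boolP (S l x)) => Sl; last first.
    by rewrite !mul0r; apply: mulr_ge0 (c0 l x) _; apply: mulr_ge0; exact: rmax_ge0.
  rewrite mul1r avgF avgh /c /cell_coef.
  rewrite powRB ?(gt_eqF (V_gt0 _)) ?implybT// powRr1 ?(ltW (V_gt0 _))//.
  apply: (@le_trans _ _ (V l `^ g / V l * (mass sg l x * mass u l x) * (avg sg f l x * avg u h l x))).
    by rewrite le_eqVlt; apply/orP; left; apply/eqP; ring.
  apply: ler_wpM2l.
    rewrite mulr_ge0 ?divr_ge0 ?powR_ge0 ?(ltW (V_gt0 _))//.
    by rewrite mulr_ge0//; apply: mass_ge0 => y; exact: ltW.
  by apply: ler_pM; rewrite ?avg_ge0//; exact: rmax_ge.
have G0 : 0 <= geom_const g b * K.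
  by rewrite mulr_ge0// (le_trans _ (geom_const_ge _ _ _ _ al0 al'0 g_gt0 exps b_gt1))//
     divr_ge0 ?subr_ge0// ltW// ?(lt_trans ltr01)// (geom_ratio_gt1 _ _ _ _ al0 al'0 exps b_gt1).
have desc l x : (l <= L)%N ->
    \sum_(l <= k < L.+1) mass (fun y => c k y * (V L / V k)) l x <= geom_const g b * K * Z l x.
  exact: sum_descendants.
have H2 := sum_maxf_mul_le S sg u f h c Z _ mS sg_gt0 u_gt0 f0 h0 c0 desc.
have K2 : 0 <= 2 * K by rewrite mulr_ge0.
have expsle : q^-1 + (1 - p^-1) <= 1 by move: exps g_gt0; lra.
(* Exponents [p <= q] in the Carleson step: [sparse_mass_le] loses [(2 * K)^p'] on [sg], of which
   the power [1 / q] remains. *)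
have T1 : \sum_(0 <= l < L.+1) \sum_x (N l.+1 x - N l x) * M l.+1 x * Z l x * (V L / V l) <=
   (\sum_x u x * N L.+1 x `^ q') `^ q'^-1 *
   ((2 * K) `^ (q^-1 / (1 - p^-1)) * (\sum_x sg x * M L.+1 x `^ p) `^ p^-1).
  have := carleson_term F sg u f h p q' q ((2 * K) `^ (1 - p^-1)^-1)
    F_ge0 sg_gt0 u_gt0 f0 h0 p_gt1 q'1.
  rewrite q'V subrK -powRrM [_ / _]mulrC => /(_ erefl (ltW pq) (powR_ge0 _ _)) H.
  rewrite /Z /cell_prod.
  have -> : g + q^-1 = p^-1 by rewrite gE; ring.
  have -> : g + (1 - p^-1) = 1 - q^-1 by rewrite gE; ring.
  apply: H => l x lL; apply: (sparse_mass_le _ _ u q^-1) => //.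
  exact: Apq.
(* The same with [sg] and [u] exchanged and the conjugate exponents [q' <= p']: the loss on [u] is
   [(2 * K)^q], of which the power [1 / p'] remains. *)
have T2 : \sum_(0 <= l < L.+1) \sum_x (M l.+1 x - M l x) * N l.+1 x * Z l x * (V L / V l) <=
   (\sum_x sg x * M L.+1 x `^ p) `^ p^-1 *
   ((2 * K) `^ ((1 - p^-1) / q^-1) * (\sum_x u x * N L.+1 x `^ q') `^ q'^-1).
  have := carleson_term F u sg h f q' p p' ((2 * K) `^ q^-1^-1)
    F_ge0 u_gt0 sg_gt0 h0 f0 q'1 p_gt1.
  rewrite q'V p'V addrC subrK -powRrM [_^-1 * _]mulrC => /(_ erefl q'p' (powR_ge0 _ _)) H.
  have ZE l x : Z l x = mass u l x `^ (1 - q^-1) * mass sg l x `^ p^-1.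
    by rewrite /Z /cell_prod mulrC; congr (_ `^ _ * _ `^ _); rewrite gE; ring.
  under eq_bigr do under eq_bigr do rewrite ZE.
  apply: H => l x lL; apply: (sparse_mass_le _ _ sg (1 - p^-1)) => //.
  - by rewrite addrC.
  - by move=> y; rewrite addrC mulrC.
  - by rewrite [1 - _ + _]addrC [leLHS]mulrC; exact: Apq.
have D1 := doob S sg f mS sg_gt0 f0 p p_gt1.
have D2 := doob S u h mS u_gt0 h0 q' q'1.
have fE : \sum_x sg x * f x `^ p = \sum_x F x `^ p * sg x `^ (1 - p).
  apply: eq_bigr => x _; rewrite /f powRM ?invr_ge0 ?(ltW (sg_gt0 _))//.
  rewrite -powR_inv1 ?(ltW (sg_gt0 _))// -powRrM mulN1r mulrCA; congr (_ * _).
  by rewrite powRD_gt0// powRr1// ltW.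
have hE : \sum_x u x * h x `^ q' = X.
  apply: eq_bigr => x _; rewrite /h -powRrM /q'; congr (_ * _ `^ _).
  by field; rewrite gt_eqF.
have q'q : q' / (q' - 1) = q.
  have -> : q' - 1 = (q - 1)^-1 by rewrite /q'; field; rewrite gt_eqF.
  by rewrite invrK /q' divfK// gt_eqF.
rewrite -/M fE in D1; rewrite -/N hE q'q in D2.
set Mn := (\sum_x sg x * M L.+1 x `^ p) `^ p^-1 in T1 T2 D1.
set Nn := (\sum_x u x * N L.+1 x `^ q') `^ q'^-1 in T1 T2 D2.
set Fn := (\sum_x F x `^ p * sg x `^ (1 - p)) `^ p^-1 in D1 *.
set k1 := (2 * K) `^ (q^-1 / (1 - p^-1)) in T1 *.
set k2 := (2 * K) `^ ((1 - p^-1) / q^-1) in T2 *.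
have k0 : 0 <= k2 + k1 by rewrite addr_ge0 ?powR_ge0.
have Mn0 : 0 <= Mn by exact: powR_ge0.
have Nn0 : 0 <= Nn by exact: powR_ge0.
have Fn0 : 0 <= Fn by exact: powR_ge0.
have H3 : X <= 2 * D * (geom_const g b * K * ((k2 + k1) * (Mn * Nn))).
  have D20 : 0 <= 2 * D by rewrite mulr_ge0.
  apply: (le_trans H1); apply: (ler_wpM2l D20).
  apply: (le_trans H2); apply: (ler_wpM2l G0).
  apply: (le_trans (lerD T2 T1)); clear; rewrite le_eqVlt; apply/orP; left; apply/eqP; ring.
have H4 : X <= 2 * D * (geom_const g b * K * (k2 + k1)) * (p / (p - 1)) * q * Fn * X `^ q'^-1.
  apply: (le_trans H3).
  have MNle := ler_pM Mn0 Nn0 D1 D2.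
  have C0 : 0 <= 2 * D * (geom_const g b * K * (k2 + k1)).
    exact: mulr_ge0 (mulr_ge0 (ler0n _ 2) D_ge0) (mulr_ge0 G0 k0).
  have := ler_wpM2l C0 MNle => H.
  apply: le_trans (le_trans H _); rewrite le_eqVlt; apply/orP; left; apply/eqP; ring.
have E0 : q^-1 + q'^-1 = 1 by rewrite q'V addrC subrK.
have C0 : 0 <= 2 * D * (geom_const g b * K * (k2 + k1)) * (p / (p - 1)) * q * Fn.
  apply: mulr_ge0 Fn0; apply: mulr_ge0 (ltW q0); apply: mulr_ge0 (ltW p'0).
  exact: mulr_ge0 (mulr_ge0 (ler0n _ 2) D_ge0) (mulr_ge0 G0 k0).
exact: (powR_self_improve X _ q q' X0 C0 q0 E0 H4).
Qed.

End dyadic_potential.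

End filtration.

(** * Lebesgue measure of boxes and affine images *)

Section lebesgue_facts.
Context {R : realType}.

Lemma measurable_euclid {n} (A : set 'rV[R]_n) :
  measurable A -> measurable (A : set (@euclid R n)).
Proof. by move=> mA; apply: sub_caratheodory; exact: sub_sigma_algebra. Qed.

Lemma leb_borel {n} (A : set 'rV[R]_n) : measurable A -> leb n A = borel_lebesgue n A.
Proof. by move=> mA; rewrite /leb /completed_measure_extension measurable_mu_extE. Qed.

Lemma measurable_fun_euclid {n d} {T : measurableType d} (f : 'rV[R]_n -> T) :
  measurable_fun [set: 'rV[R]_n] f -> measurable_fun [set: @euclid R n] f.
Proof. by move=> mf _ Y mY; apply: measurable_euclid; exact: mf. Qed.

Definition box {n} (I : 'I_n -> interval R) : set 'rV[R]_n :=
  [set x | forall i, x ord0 i \in I i].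

Lemma measurable_box {n} (I : 'I_n -> interval R) : measurable (box I).
Proof.
rewrite (_ : box I = \bigcap_(i in [set: 'I_n]) ((fun x : 'rV[R]_n => x ord0 i) @^-1` [set` I i])).
  apply: fin_bigcap_measurable => // i _; rewrite -[X in measurable X]setTI.
  by apply: measurable_coord => //; exact: measurable_itv.
by apply/seteqP; split => x /= H i; [move=> _; exact: H|exact: (H i)].
Qed.

Lemma borel_lebesgueS n (A : set 'rV[R]_n.+1) :
  borel_lebesgue n.+1 A = (@lebesgue_measure R \x borel_lebesgue n)%E (@cons_rV R n @^-1` A).
Proof. by []. Qed.

Lemma borel_lebesgue_box n (I : 'I_n -> interval R) :
  borel_lebesgue n (box I) = (\prod_(i < n) lebesgue_measure [set` I i])%E.
Proof.
elim: n I => [|n IH] I.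
  rewrite big_ord0 /= diracE mem_set//= => i; by case: i.
rewrite borel_lebesgueS big_ord_recl.
rewrite (_ : @cons_rV R n @^-1` box I = [set` I ord0] `*` box (fun i => I (lift ord0 i))).
  have mI : measurable ([set` I ord0] : set (measurableTypeR R)) by exact: measurable_itv.
  by rewrite (product_measure1E _ _ mI (measurable_box _)) IH.
apply/seteqP; split => [[a y] /= H|[a y] /= [Ha Hy] i].
  split; first by have := H ord0; rewrite mxE unlift_none.
  by move=> i; have := H (lift ord0 i); rewrite mxE liftK.
by rewrite mxE; case: unliftP => [j|] -> //; exact: Hy.
Qed.

Lemma leb_box n (I : 'I_n -> interval R) (l : R) : (0 <= l) ->
  (forall i, lebesgue_measure [set` I i] = l%:E) -> leb n (box I) = (l ^+ n)%:E.
Proof.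
move=> l0 H; rewrite leb_borel; last exact: measurable_box.
rewrite borel_lebesgue_box; under eq_bigr do rewrite H.
by rewrite big_const_ord; elim: n {I H} => //= n ->; rewrite exprS EFinM.
Qed.

End lebesgue_facts.

Section affine_images.
Context {R : realType}.

Definition aff1 (x t : R) : measurableTypeR R -> measurableTypeR R := fun a => x + t * a.

Lemma measurable_aff1 x t : measurable_fun setT (aff1 x t).
Proof. by apply: measurable_funD => //; apply: measurable_funM. Qed.

(** Both sides, rescaled, are measures agreeing on half-open intervals. For negative [t] the
    preimage is half-open on the other side, hence the two cases. *)
Lemma lebesgue_measure_affine (x t : R) (A : set (measurableTypeR R)) :
  t != 0 -> measurable A ->
  lebesgue_measure (aff1 x t @^-1` A) = (`|t|^-1%:E * lebesgue_measure A)%E.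
Proof.
move=> t0 mA.
have nt : 0 < `|t| by rewrite normr_gt0.
have [nu nuE0] : exists nu : {measure set (measurableTypeR R) -> \bar R},
    forall B, nu B = (`|t|%:E * lebesgue_measure (aff1 x t @^-1` B))%E.
  unshelve eexists (mscale (NngNum (ltW nt)) (pushforward (@lebesgue_measure R) (aff1 x t))) => //.
  exact: measurable_aff1.
have nuE : forall B, measurable B -> lebesgue_measure B = nu B.
  apply: lebesgue_measure_unique => _ [[a b] _ <-]; rewrite nuE0 /=.
  have [t1|t1] := ltP 0 t.
    have -> : aff1 x t @^-1` `]a, b] = [set` `](a - x) / t, (b - x) / t]].
      apply/seteqP; split => y /=; rewrite !in_itv/= /aff1 ltr_pdivrMr// ler_pdivlMr// ![y * t]mulrC.
        by move=> /andP[? ?]; apply/andP; split; lra.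
      by move=> /andP[? ?]; apply/andP; split; lra.
    rewrite !lebesgue_measure_itv/= !lte_fin ltr_pM2r ?invr_gt0// ltrD2r.
    case: ifPn => ab; last by rewrite mule0.
    by rewrite -!EFinB -EFinM gtr0_norm//; congr EFin; field; rewrite gt_eqF.
  have {}t1 : t < 0 by rewrite lt_neqAle t0.
  have -> : aff1 x t @^-1` `]a, b] = [set` `[(b - x) / t, (a - x) / t[].
    apply/seteqP; split => y /=; rewrite !in_itv/= /aff1 ltr_ndivlMr// ler_ndivrMr// ![y * t]mulrC.
      by move=> /andP[? ?]; apply/andP; split; lra.
    by move=> /andP[? ?]; apply/andP; split; lra.
  rewrite !lebesgue_measure_itv/= !lte_fin ltr_nM2r ?invr_lt0// ltrD2r.
  case: ifPn => ab; last by rewrite mule0.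
  by rewrite -!EFinB -EFinM ltr0_norm//; congr EFin; field; rewrite lt_eqF.
rewrite [in RHS]nuE// nuE0 muleA -EFinM mulVf ?gt_eqF//.
by rewrite mul1e.
Qed.

Definition affine {n} (x : 'rV[R]_n) (t : R) (y : 'rV[R]_n) : 'rV[R]_n := x + t *: y.

Lemma measurable_affine n (x : 'rV[R]_n) t : measurable_fun setT (affine x t).
Proof.
apply: measurable_fun_rV => i.
rewrite (_ : (fun y => _) = (fun y : 'rV[R]_n => x ord0 i + t * y ord0 i)).
  by apply: measurable_funD => //; apply: measurable_funM => //; exact: measurable_coord.
by apply/funext => y; rewrite /affine !mxE.
Qed.

(** Induction on the dimension: sections of the preimage are affine preimages of sections, and the
    outer integral is changed by the one-dimensional case. *)
Lemma borel_lebesgue_affine n (x : 'rV[R]_n) t (A : set 'rV[R]_n) : t != 0 -> measurable A ->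
  borel_lebesgue n (affine x t @^-1` A) = ((`|t| ^- n)%:E * borel_lebesgue n A)%E.
Proof.
move=> t0; elim: n x A => [|n IH] x A mA.
  rewrite expr0 invr1 mul1e /= !diracE.
  by rewrite (_ : affine x t @^-1` A = A)//; apply/seteqP; split => y /=; rewrite (_ : affine x t y = y)//; apply/rowP => -[].
have nt : 0 < `|t| by rewrite normr_gt0.
pose x' : 'rV[R]_n := \row_i x ord0 (lift ord0 i).
pose B := @cons_rV R n @^-1` A.
have mB : measurable B by rewrite -[X in measurable X]setTI; exact: measurable_cons_rV.
rewrite !borel_lebesgueS /product_measure1 -/B.
have nt0 : 0 <= `|t| ^- n by rewrite invr_ge0 exprn_ge0.
have mx : measurable_fun [set: measurableTypeR R] (borel_lebesgue n \o xsection B).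
  exact: measurable_fun_xsection.
transitivity (\int[@lebesgue_measure R]_a ((`|t| ^- n)%:E *
    ((borel_lebesgue n \o xsection B) \o aff1 (x ord0 ord0) t) a))%E.
  apply: eq_integral => a _ /=; rewrite -(IH x').
    congr (borel_lebesgue n _); apply/seteqP; split => y; rewrite /xsection /= !inE /= /B /=.
      rewrite (_ : affine _ _ _ = cons_rV (aff1 (x ord0 ord0) t a, affine x' t y))//.
      apply/rowP => i; rewrite !mxE; case: (unliftP ord0 i) => [j|] ->.
        by rewrite !mxE ?liftK.
      by rewrite ?unlift_none /aff1.
    rewrite (_ : affine _ _ _ = cons_rV (aff1 (x ord0 ord0) t a, affine x' t y))//.
    apply/rowP => i; rewrite !mxE; case: (unliftP ord0 i) => [j|] ->.
      by rewrite !mxE ?liftK.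
    by rewrite ?unlift_none /aff1.
  exact: measurable_xsection.
rewrite ge0_integralZl//; last exact: (measurableT_comp mx (measurable_aff1 _ _)).
have it0 : 0 <= `|t|^-1 by rewrite invr_ge0 ltW.
have -> : (\int[@lebesgue_measure R]_a ((borel_lebesgue n \o xsection B) \o aff1 (x ord0 ord0) t) a =
    `|t|^-1%:E * \int[@lebesgue_measure R]_a (borel_lebesgue n \o xsection B) a)%E.
  rewrite -(ge0_integral_pushforward (measurable_aff1 _ _) _ measurableT)//.
  transitivity (\int[mscale (NngNum it0) (@lebesgue_measure R)]_a (borel_lebesgue n \o xsection B) a)%E.
    apply: eq_measure_integral; first exact: measurable_aff1.
    by move=> ? C mC _; exact: (lebesgue_measure_affine (x ord0 ord0) t C t0 mC).
  by rewrite ge0_integral_mscale.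
by rewrite muleA -EFinM exprS invfM mulrC.
Qed.

(** Null sets of [leb] are arbitrary sets of outer measure zero, so the Borel scaling is transported
    through countable covers. *)
Lemma leb_affine_null n (x : 'rV[R]_n) t (A : set 'rV[R]_n) : t != 0 ->
  leb n A = 0%E -> leb n (affine x t @^-1` A) = 0%E.
Proof.
move=> t0 A0; apply/eqP; rewrite eq_le; apply/andP; split; last exact: mu_ext_ge0.
have nt : 0 < `|t| ^+ n by rewrite exprn_gt0// normr_gt0.
suff : ((`|t| ^+ n)%:E * leb n (affine x t @^-1` A) <= leb n A)%E.
  by rewrite A0 pmule_rle0// lte_fin.
apply: le_ereal_inf_tmp => _ [F [mF AF] <-].
have mF' k : measurable (affine x t @^-1` F k).
  by rewrite -[X in measurable X]setTI; exact: measurable_affine.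
have E k : borel_lebesgue n (F k) = ((`|t| ^+ n)%:E * borel_lebesgue n (affine x t @^-1` F k))%E.
  by rewrite borel_lebesgue_affine// muleA -EFinM divff ?gt_eqF// mul1e.
have -> : (\sum_(k <oo) borel_lebesgue n (F k) =
    \sum_(k <oo) (`|t| ^+ n)%:E * borel_lebesgue n (affine x t @^-1` F k))%E.
  by apply: eq_eseriesr => k _; exact: E.
rewrite nneseriesZl//.
rewrite lee_pmul2l ?fin_numE// ?lte_fin//.
apply: ereal_inf_lbound; exists (fun k => affine x t @^-1` F k) => //.
split => // y /AF [k _ Fk]; by exists k.
Qed.

End affine_images.

(** * Integrals of functions that need not be measurable *)

Section integral_bounds.
Context d (T : measurableType d) (R : realType) (mu : {measure set T -> \bar R}).
Implicit Types (D N : set T).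
Local Open Scope ereal_scope.

(* The integral of a nonnegative function is a supremum over simple functions
   below it, so no measurability is needed here. *)
Lemma le_integral_nomeas D (h H : T -> \bar R) :
  (forall x, D x -> 0 <= h x) -> (forall x, D x -> h x <= H x) ->
  \int[mu]_(x in D) h x <= \int[mu]_(x in D) H x.
Proof.
move=> h0 hH.
rewrite !ge0_integralE//; last by move=> x Dx; apply: le_trans (hH _ Dx); exact: h0.
apply: ge_ereal_sup => _ [g gh <-]; apply: ereal_sup_ubound; exists g => // x.
apply: (le_trans (gh x)).
by rewrite /patch; case: ifPn => //; rewrite inE => /hH.
Qed.

(** The positive and negative parts are each at most [H], and the absolute value of a difference of
    two nonnegative numbers is at most the larger one. Avoiding the sum of the two parts avoids
    additivity, which would require measurability. *)
Lemma abse_integral_le D (h H : T -> \bar R) :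
  (forall x, D x -> `|h x| <= H x) ->
  `|\int[mu]_(x in D) h x| <= \int[mu]_(x in D) H x.
Proof.
move=> hH.
have H0 : 0 <= \int[mu]_(x in D) H x.
  by apply: integral_ge0 => x Dx; apply: le_trans (hH _ Dx).
rewrite integralE.
have P : \int[mu]_(x in D) h^\+ x <= \int[mu]_(x in D) H x.
  apply: le_integral_nomeas => // x Dx; apply: le_trans (hH _ Dx).
  by rewrite funeposE ge_max abse_ge0 andbT; exact: lee_abs.
have N : \int[mu]_(x in D) h^\- x <= \int[mu]_(x in D) H x.
  apply: le_integral_nomeas => // x Dx; apply: le_trans (hH _ Dx).
  by rewrite funenegE ge_max abse_ge0 andbT -abseN; exact: lee_abs.
have P0 : 0 <= \int[mu]_(x in D) h^\+ x by exact: integral_ge0.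
have N0 : 0 <= \int[mu]_(x in D) h^\- x by exact: integral_ge0.
move: (\int[mu]_(x in D) H x) H0 P N => [c| |]// c0; last by move=> _ _; rewrite leey.
move: (\int[mu]_(x in D) h^\+ x) (\int[mu]_(x in D) h^\- x) P0 N0 => [a| |] [b| |]//=.
rewrite !lee_fin => a0 b0 ac bc; rewrite ler_norml; apply/andP; split; lra.
Qed.

(** Adding [+oo] times the indicator of [N] makes the bound hold everywhere and leaves the integral
    of [H] unchanged. *)
Lemma abse_integral_le_ae D N (h H : T -> \bar R) :
  measurable D -> measurable N -> mu N = 0 -> measurable_fun D H ->
  (forall x, D x -> 0 <= H x) -> (forall x, D x -> ~ N x -> `|h x| <= H x) ->
  `|\int[mu]_(x in D) h x| <= \int[mu]_(x in D) H x.
Proof.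
move=> mD mN N0 mH H0 hH.
pose g (x : T) : \bar R := +oo * (\1_N x)%:E.
have mg : measurable_fun D g.
  apply: emeasurable_funM => //; apply/measurable_EFinP; exact: measurable_indic.
have g0 x : 0 <= g x by rewrite mule_ge0// lee_fin.
have -> : \int[mu]_(x in D) H x = \int[mu]_(x in D) (H x + g x).
  rewrite ge0_integralD//.
  suff -> : \int[mu]_(x in D) g x = 0 by rewrite adde0.
  rewrite ge0_integralZl//; last by apply/measurable_EFinP; exact: measurable_indic.
  rewrite integral_indic// (subset_measure0 _ _ _ N0) ?mule0//.
  exact: measurableI.
apply: abse_integral_le => x Dx; have [Nx|Nx] := pselect (N x).
  rewrite /g indicE mem_set// mule1 addey ?leey//.
  by rewrite gt_eqF// (lt_le_trans _ (H0 _ Dx))// ltNye.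
by rewrite /g indicE memNset// mule0 adde0; exact: hH.
Qed.

(** The best choice is [s = (B / A)^(1 - th)]. When [A] or [B] vanishes no [s] is optimal, and one
    that makes the remaining term smaller than a positive [X] gives a contradiction. *)
Lemma interpolation_bound (X A B th : R) : (0 <= A -> 0 <= B -> 0 < th -> th < 1 ->
  (forall s, 0 < s -> X <= th * s * A + (1 - th) * s `^ (- (th / (1 - th))) * B) ->
  X <= A `^ th * B `^ (1 - th))%R.
Proof.
move=> A0 B0 th0 th1 H.
have th1' : (0 < 1 - th)%R by rewrite subr_gt0.
have k0 : (0 < th / (1 - th))%R by rewrite divr_gt0.
have AB0 : (0 <= A `^ th * B `^ (1 - th))%R by rewrite mulr_ge0 ?powR_ge0.
have [X0|X0] := leP X 0%R; first exact: le_trans AB0.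
move: A0; rewrite le_eqVlt => /predU1P[A0|A0].
  exfalso; pose s := ((X / (2 * (1 - th) * (B + 1))) `^ (- (th / (1 - th))^-1))%R.
  have a0 : (0 < X / (2 * (1 - th) * (B + 1)))%R.
    by rewrite divr_gt0// !mulr_gt0//; lra.
  have s0 : (0 < s)%R by rewrite powR_gt0.
  have sE : (s `^ (- (th / (1 - th))) = X / (2 * (1 - th) * (B + 1)))%R.
    by rewrite /s -powRrM mulrNN mulVf ?gt_eqF// powRr1// ltW.
  have := H s s0; rewrite -A0 mulr0 add0r sE; apply/negP; rewrite -ltNge.
  rewrite [ltLHS](_ : _ = (X * ((B / (B + 1)) / 2))%R); last first.
    by field; rewrite !gt_eqF//; lra.
  have : (B / (B + 1) <= 1)%R by rewrite ler_pdivrMr; lra.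
  have : (0 <= B / (B + 1))%R by rewrite divr_ge0//; lra.
  by move=> ? ?; rewrite -[ltRHS]mulr1 ltr_pM2l//; lra.
move: B0; rewrite le_eqVlt => /predU1P[B0|B0].
  exfalso; have s0 : (0 < X / (2 * th * A))%R by rewrite divr_gt0// !mulr_gt0.
  have := H _ s0; rewrite -B0 mulr0 addr0.
  rewrite [leRHS](_ : _ = (X / 2)%R); last by field; rewrite !gt_eqF.
  by lra.
pose s := ((B / A) `^ (1 - th))%R.
have BA0 : (0 < B / A)%R by rewrite divr_gt0.
have s0 : (0 < s)%R by rewrite powR_gt0.
apply: le_trans (H s s0) _.
have A1 : A = (A `^ th * A `^ (1 - th))%R by rewrite -powRD_gt0// addrC subrK powRr1// ltW.
have B1 : B = (B `^ th * B `^ (1 - th))%R by rewrite -powRD_gt0// addrC subrK powRr1// ltW.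
have An0 : (A != 0)%R by rewrite gt_eqF.
have Ai t : ((A^-1) `^ t = (A `^ t)^-1)%R by rewrite -powR_inv1 ?ltW// -powRrM mulN1r powRN.
have sA : (s * A = A `^ th * B `^ (1 - th))%R.
  rewrite /s powRM ?invr_ge0 ?(ltW A0) ?(ltW B0)// [X in (_ * X)%R]A1.
  rewrite Ai; field.
  by rewrite gt_eqF// powR_gt0.
have sB : (s `^ (- (th / (1 - th))) * B = A `^ th * B `^ (1 - th))%R.
  have -> : (s `^ (- (th / (1 - th))) = (B / A) `^ (- th))%R.
    by rewrite /s -powRrM mulrN mulrCA divff ?gt_eqF// mulr1.
  rewrite powRN powRM ?invr_ge0 ?(ltW A0) ?(ltW B0)// [X in (_ * X)%R]B1.
  rewrite Ai; field.
  by rewrite !gt_eqF// powR_gt0.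
by rewrite -!mulrA sA sB -mulrDl addrC subrK mul1r.
Qed.

Lemma weighted_young (a b th s : R) : (0 < a -> 0 < b -> 0 < th -> th < 1 -> 0 < s ->
  a `^ th * b `^ (1 - th) <= th * s * a + (1 - th) * s `^ (- (th / (1 - th))) * b)%R.
Proof.
move=> a0 b0 th0 th1 s0; have th1' : (0 < 1 - th)%R by rewrite subr_gt0.
have e1 : (th + (1 - th) = 1)%R by ring.
have h1 : (0 <= s * a)%R by rewrite mulr_ge0 ?ltW.
have h2 : (0 <= s `^ (- (th / (1 - th))) * b)%R by rewrite mulr_ge0 ?powR_ge0 ?ltW.
have := @weighted_am_gm R _ _ th (1 - th) h1 h2 th0 th1' e1; rewrite !mulrA; apply: le_trans.
rewrite !powRM ?powR_ge0 ?(ltW a0) ?(ltW b0) ?(ltW s0)// -powRrM mulNr divfK ?gt_eqF// powRN.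
rewrite le_eqVlt; apply/orP; left; apply/eqP; field.
by rewrite gt_eqF// powR_gt0.
Qed.

(* Hoelder's inequality in the form of a family of Young inequalities, which
   makes sense for extended-real weights that may take the value [+oo]. *)
Lemma integral_le_interpolation D (h a b : T -> \bar R) (A B th : R) :
  measurable D -> measurable_fun D a -> measurable_fun D b ->
  (forall x, D x -> 0 <= h x) -> (forall x, D x -> 0 <= a x) -> (forall x, D x -> 0 <= b x) ->
  (0 < th)%R -> (th < 1)%R ->
  (forall x s, D x -> (0 < s)%R ->
     h x <= (th * s)%:E * a x + ((1 - th) * s `^ (- (th / (1 - th))))%:E * b x) ->
  \int[mu]_(x in D) a x = A%:E -> \int[mu]_(x in D) b x = B%:E ->
  \int[mu]_(x in D) h x <= (A `^ th * B `^ (1 - th))%:E.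
Proof.
move=> mD ma mb h0 a0 b0 th0 th1 H IA IB.
have th1' : (0 < 1 - th)%R by rewrite subr_gt0.
have Hs s : (0 < s)%R -> \int[mu]_(x in D) h x <=
    (th * s * A + (1 - th) * s `^ (- (th / (1 - th))) * B)%:E.
  move=> s0; apply: (@le_trans _ _ (\int[mu]_(x in D)
      ((th * s)%:E * a x + ((1 - th) * s `^ (- (th / (1 - th))))%:E * b x))).
    by apply: le_integral_nomeas => // x Dx; exact: H.
  have c1 : (0 <= th * s)%R by rewrite mulr_ge0// ltW.
  have c2 : (0 <= (1 - th) * s `^ (- (th / (1 - th))))%R by rewrite mulr_ge0 ?powR_ge0// ltW.
  rewrite ge0_integralD//; last 4 first.
  - by move=> x Dx; rewrite mule_ge0 ?lee_fin// a0.
  - exact: measurable_funeM.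
  - by move=> x Dx; rewrite mule_ge0 ?lee_fin// b0.
  - exact: measurable_funeM.
  by rewrite !ge0_integralZl// IA IB EFinD !EFinM.
have I0 : 0 <= \int[mu]_(x in D) h x by exact: integral_ge0.
have A0 : (0 <= A)%R by rewrite -lee_fin -IA integral_ge0.
have B0 : (0 <= B)%R by rewrite -lee_fin -IB integral_ge0.
have : \int[mu]_(x in D) h x \is a fin_num.
  by rewrite ge0_fin_numE// (le_lt_trans (Hs 1%R ltr01))// ltry.
move=> /fineK E; rewrite -E lee_fin; apply: interpolation_bound => // s s0.
by rewrite -lee_fin E; exact: Hs.
Qed.

End integral_bounds.

(** * Dyadic grids *)

Section grid.
Context {R : realType} {n : nat}.
Variables (a : 'rV[R]_n) (h : R) (L : nat).
Hypothesis h_gt0 : 0 < h.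

Let J := {ffun 'I_n -> 'I_(2 ^ L)}.

(** Dropping the last [L - l] binary digits of each coordinate names the ancestor at level [l].
    Beyond level [L] the truncated subtraction freezes the key, so that keys refine at every
    level. *)
Definition grid_key (l : nat) (m : J) : {ffun 'I_n -> nat} := [ffun i => m i %/ 2 ^ (L - l)]%N.

Definition leaf (m : J) : set 'rV[R]_n :=
  box (fun i => `[a ord0 i + h * (m i)%:R, a ord0 i + h * (m i).+1%:R[).

Definition cell (l : nat) (m : J) : set 'rV[R]_n :=
  box (fun i => `[a ord0 i + h * (grid_key l m i * 2 ^ (L - l))%N%:R,
                  a ord0 i + h * ((grid_key l m i).+1 * 2 ^ (L - l))%N%:R[).

Lemma grid_key_fine l x y : grid_key l.+1 x = grid_key l.+1 y -> grid_key l x = grid_key l y.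
Proof.
move=> /ffunP H; apply/ffunP => i; have := H i; rewrite !ffunE.
have [lL|lL] := ltnP l L.
  have -> : (L - l = (L - l.+1).+1)%N by rewrite subnSK.
  by rewrite expnSr !divnMA => ->.
have -> : (L - l = 0)%N by apply/eqP; rewrite subn_eq0.
have -> : (L - l.+1 = 0)%N by apply/eqP; rewrite subn_eq0 leqW.
by [].
Qed.

Lemma leaf_inj m m' x : leaf m x -> leaf m' x -> m = m'.
Proof.
move=> H H'; apply/ffunP => i; apply/val_inj/eqP.
have := H i; have := H' i; rewrite !in_itv/= => /andP[h1 h2] /andP[h3 h4].
have e1 : (m i < (m' i).+1)%N by rewrite -(ltr_nat R) -(ltr_pM2l h_gt0); lra.
have e2 : (m' i < (m i).+1)%N by rewrite -(ltr_nat R) -(ltr_pM2l h_gt0); lra.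
by move: e1 e2; rewrite !ltnS => e1 e2; rewrite eqn_leq e1.
Qed.

Lemma bigcup_leaf l m : (l <= L)%N ->
  \bigcup_(m' in [set m' | grid_key l m' = grid_key l m]) leaf m' = cell l m.
Proof.
move=> lL; pose M := (2 ^ (L - l))%N; have M0 : (0 < M)%N by rewrite expn_gt0.
apply/seteqP; split => [x [m' /= Em Hx] i|x Hx].
  have := Hx i; rewrite /cell !in_itv/= -Em ffunE -/M => /andP[h1 h2].
  apply/andP; split.
    by apply: le_trans h1; rewrite lerD2l ler_pM2l// ler_nat leq_trunc_div.
  apply: lt_le_trans h2 _; rewrite lerD2l ler_pM2l// ler_nat.
  exact: ltn_ceil.
have Hx' i : h * (grid_key l m i * M)%:R <= x ord0 i - a ord0 i < h * ((grid_key l m i).+1 * M)%:R.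
  by have := Hx i; rewrite in_itv/= -/M => /andP[h1 h2]; apply/andP; split; lra.
pose z i := (x ord0 i - a ord0 i) / h.
have z0 i : (grid_key l m i * M)%:R <= z i < ((grid_key l m i).+1 * M)%:R.
  by have := Hx' i; rewrite /z ler_pdivlMr// ltr_pdivrMr// ![_ * h]mulrC.
have zt i : (grid_key l m i * M <= Num.truncn (z i) < (grid_key l m i).+1 * M)%N.
  have /andP[h1 h2] := z0 i.
  have zi0 : 0 <= z i by apply: le_trans h1.
  by rewrite truncn_ge_nat// h1 truncn_lt_nat.
have lt2 i : (Num.truncn (z i) < 2 ^ L)%N.
  have /andP[_ h2] := zt i; apply: (leq_trans h2).
  have -> : (2 ^ L = 2 ^ l * M)%N by rewrite /M -expnD subnKC.
  rewrite leq_pmul2r// ffunE ltn_divLR// -/M.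
  by rewrite (_ : 2 ^ l * M = 2 ^ L)%N// /M -expnD subnKC.
exists [ffun i => Ordinal (lt2 i)].
  apply/ffunP => i; rewrite !ffunE /= -/M; have /andP[h1 h2] := zt i.
  apply/eqP; rewrite eqn_leq -ltnS ltn_divLR// leq_divRL//.
  by move: h1 h2; rewrite !ffunE -/M => -> ->.
move=> i; rewrite ffunE /= in_itv/=.
have /andP[h1 _] := z0 i; have zi0 : 0 <= z i by apply: le_trans h1.
have /andP[t1 t2] := truncn_itv zi0.
have zE : x ord0 i = a ord0 i + h * z i by rewrite /z mulrC divfK ?gt_eqF// addrC subrK.
by rewrite zE lerD2l ltrD2l ler_pM2l// ltr_pM2l// t1.
Qed.

Lemma measurable_leaf m : measurable (leaf m : set (@euclid R n)).
Proof. by apply: measurable_euclid; exact: measurable_box. Qed.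

Lemma measurable_cell l m : measurable (cell l m : set (@euclid R n)).
Proof. by apply: measurable_euclid; exact: measurable_box. Qed.

Lemma sum_integral_leaf l m (phi : 'rV[R]_n -> \bar R) : (l <= L)%N ->
  measurable_fun [set: @euclid R n] phi -> (forall x, 0 <= phi x)%E ->
  (\sum_(m' | grid_key l m' == grid_key l m) \int[leb n]_(x in leaf m') phi x =
   \int[leb n]_(x in cell l m) phi x)%E.
Proof.
move=> lL mphi phi0.
have E : cell l m = \big[setU/set0]_(m' <- [seq m' <- index_enum J | grid_key l m' == grid_key l m]) leaf m'.
  rewrite -bigcup_leaf// -bigcup_seq; apply/seteqP; split => x [m' /= Hm' Hx]; exists m' => //=.
    by rewrite mem_filter Hm' eqxx mem_index_enum.
  by move: Hm'; rewrite mem_filter => /andP[/eqP].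
rewrite E ge0_integral_bigsetU//.
- by rewrite big_filter.
- by move=> m'; exact: measurable_leaf.
- by rewrite filter_uniq// index_enum_uniq.
- by move=> m1 m2 _ _ [x [x1 x2]]; exact: leaf_inj x1 x2.
- exact: measurable_funTS.
Qed.

Definition side l : R := h * (2 ^ (L - l))%:R.

Lemma side_gt0 l : 0 < side l.
Proof. by rewrite mulr_gt0// ltr0n expn_gt0. Qed.

Lemma leb_cell l m : leb n (cell l m) = (side l ^+ n)%:E.
Proof.
apply: leb_box => [|i]; first exact: ltW (side_gt0 l).
rewrite lebesgue_measure_itv /= lte_fin ltrD2l ltr_pM2l// ltr_nat.
rewrite mulSn -[X in (X < _)%N]add0n ltn_add2r expn_gt0/= -EFinB; congr EFin.
by rewrite /side natrD; ring.
Qed.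

Lemma leaf_cell m : leaf m = cell L m.
Proof.
by rewrite /leaf /cell; congr box; apply/funext => i; rewrite ffunE subnn expn0 divn1 !muln1.
Qed.

Lemma leb_leaf m : leb n (leaf m) = (h ^+ n)%:E.
Proof. by rewrite leaf_cell leb_cell /side subnn expn0 mulr1. Qed.

(** The leaves of a cell are counted by volume, integrating the constant 1. *)
Lemma grid_card l m : (l <= L)%N ->
  \sum_(m' | grid_key l m' == grid_key l m) 1 = side l ^+ n / side L ^+ n.
Proof.
move=> lL; have H := sum_integral_leaf l m (cst 1%E) lL (measurable_cst _) (fun=> lee01).
have c1 A : measurable (A : set (@euclid R n)) -> (\int[leb n]_(x in A) cst 1%E x = leb n A)%E.
  by move=> mA; rewrite integral_cst// mul1e.
have E m' := etrans (c1 _ (measurable_leaf m')) (leb_leaf m').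
have E' := etrans (c1 _ (measurable_cell l m)) (leb_cell l m).
move: H; rewrite E'; under eq_bigr do rewrite E.
rewrite sumEFin => -[<-]; have -> : side L = h by rewrite /side subnn expn0 mulr1.
rewrite mulr_suml; apply: eq_bigr => m' _.
by rewrite divff// gt_eqF// exprn_gt0.
Qed.

Lemma cell_sub_cube l m :
  cell l m `<=` cube (\row_i (a ord0 i + h * (grid_key l m i * 2 ^ (L - l))%N%:R)) (side l).
Proof.
move=> x Hx i; have := Hx i; rewrite in_itv/= mxE => /andP[h1 /ltW h2]; rewrite h1/=.
by apply: le_trans h2 _; rewrite -addrA lerD2l /side mulSn natrD mulrDr addrC.
Qed.

End grid.

(** * Weighted bounds for grid potentials *)

Lemma ge0_addey {R : realType} (x : \bar R) : (0 <= x -> x + +oo = +oo)%E.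
Proof. by case: x. Qed.

Lemma interpolation_powR {R : realType} (x U S c e : R) : 0 <= x -> 0 < c -> 0 < e ->
  x <= U `^ (c / (c + e)) * S `^ (1 - c / (c + e)) -> x `^ (c + e) <= U `^ c * S `^ e.
Proof.
move=> x0 c0 e0 H; have d0 : 0 < c + e by rewrite addr_gt0.
have E : 1 - c / (c + e) = e / (c + e).
  by rewrite -[1 in LHS](divff (lt0r_neq0 d0)) -mulrBl addrAC subrr add0r.
have -> : U `^ c * S `^ e = (U `^ (c / (c + e)) * S `^ (1 - c / (c + e))) `^ (c + e).
  by rewrite E powRM ?powR_ge0// -!powRrM !divfK ?gt_eqF.
apply: (ge0_ler_powR (ltW d0)).
- by rewrite nnegrE.
- by rewrite nnegrE mulr_ge0 ?powR_ge0.
- exact: H.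
Qed.

Lemma interpolation_powRV {R : realType} (F A s p : R) : 0 <= F -> 0 <= A -> 0 < s -> 0 < p ->
  F <= A `^ p^-1 * s `^ (1 - p^-1) -> F `^ p * s `^ (1 - p) <= A.
Proof.
move=> F0 A0 s0 p0 H; have : F `^ p <= (A `^ p^-1 * s `^ (1 - p^-1)) `^ p.
  by apply: (ge0_ler_powR (ltW p0)); rewrite ?nnegrE ?mulr_ge0 ?powR_ge0.
rewrite powRM ?powR_ge0// -!powRrM mulVf ?gt_eqF// powRr1// => H2.
have := ler_wpM2r (powR_ge0 s (1 - p)) H2; rewrite -mulrA -powRD_gt0//.
by rewrite (_ : (1 - p^-1) * p + (1 - p) = 0) ?powRr0 ?mulr1//; field; rewrite gt_eqF.
Qed.

Section weighted_grid.
Context {R : realType} {n : nat}.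
Variables (p q K NF : R) (w f : 'rV[R]_n -> R).
Hypothesis n_gt0 : (0 < n)%N.
Hypothesis p_gt1 : 1 < p.
Hypothesis pq : p < q.
Hypothesis w_ge0 : forall x, 0 <= w x.
Hypothesis mw : measurable_fun [set: @euclid R n] w.
Hypothesis mf : measurable_fun [set: @euclid R n] f.

Definition weight_q (x : 'rV[R]_n) : \bar R := (w x `^ q)%:E.
Definition weight_dual (x : 'rV[R]_n) : \bar R := ((w x `^ (p / (p - 1)))%:E)^-1%E.
Definition weighted_power (x : 'rV[R]_n) : \bar R := (`|f x| `^ p * w x `^ p)%:E.

Let p0 : 0 < p. Proof. exact: lt_trans p_gt1. Qed.
Let q0 : 0 < q. Proof. exact: lt_trans pq. Qed.
Let p'0 : 0 < p / (p - 1). Proof. by rewrite divr_gt0// subr_gt0. Qed.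
Let pV : 0 < p^-1. Proof. by rewrite invr_gt0. Qed.
Let qV : 0 < q^-1. Proof. by rewrite invr_gt0. Qed.
Let pV1 : p^-1 < 1. Proof. by rewrite invf_lt1. Qed.

Lemma measurable_weight_q : measurable_fun [set: @euclid R n] weight_q.
Proof. by apply/measurable_EFinP; exact: (measurableT_comp (measurable_powR _)). Qed.

Lemma weight_q_ge0 x : (0 <= weight_q x)%E.
Proof. by rewrite lee_fin powR_ge0. Qed.

(** A form whose measurability is visible. Where [w] vanishes the first summand is 0, the value of
    [powR] at base 0 and nonzero exponent, and the second is [+oo]. *)
Lemma weight_dualE x : weight_dual x =
  ((w x `^ (- (p / (p - 1))))%:E + +oo * (\1_(w @^-1` [set 0]) x)%:E)%E.
Proof.
rewrite /weight_dual indicE; have [w0|w0] := eqVneq (w x) 0.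
  by rewrite mem_set// w0 !powR0 ?oppr_eq0 ?gt_eqF// mule1 add0e inve0.
rewrite memNset; last by apply/eqP.
by rewrite mule0 adde0 inver powR_eq0 (negbTE w0) powRN.
Qed.

Lemma weight_dual_ge0 x : (0 <= weight_dual x)%E.
Proof. by rewrite weight_dualE adde_ge0 ?lee_fin ?powR_ge0 ?mule_ge0. Qed.

Lemma measurable_weight_dual : measurable_fun [set: @euclid R n] weight_dual.
Proof.
rewrite (funext weight_dualE); apply: emeasurable_funD.
  by apply/measurable_EFinP; exact: (measurableT_comp (measurable_powR _)).
have m0 : measurable (w @^-1` [set 0] : set (@euclid R n)).
  by rewrite -[X in measurable X]setTI; exact: mw.
apply: (emeasurable_funM (measurable_cst _)).
by apply/measurable_EFinP; exact: measurable_indic.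
Qed.

Lemma measurable_weighted_power : measurable_fun [set: @euclid R n] weighted_power.
Proof.
apply/measurable_EFinP; apply: measurable_funM.
  by apply: (measurableT_comp (measurable_powR _)); exact: measurableT_comp.
exact: (measurableT_comp (measurable_powR _)).
Qed.

Hypothesis int_q : forall a l, 0 < l -> (\int[leb n]_(x in cube a l) weight_q x < +oo)%E.
Hypothesis int_dual : forall a l, 0 < l -> (\int[leb n]_(x in cube a l) weight_dual x < +oo)%E.
Hypothesis K_ge0 : 0 <= K.
Hypothesis cube_Apq : forall a l, 0 < l ->
  fine (\int[leb n]_(x in cube a l) weight_q x) `^ q^-1 *
  fine (\int[leb n]_(x in cube a l) weight_dual x) `^ (1 - p^-1) <=
  K * (l ^+ n) `^ (q^-1 + (1 - p^-1)).
Hypothesis int_f : (\int[leb n]_x weighted_power x = NF%:E)%E.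

Variables (a : 'rV[R]_n) (h : R) (L : nat).
Hypothesis h_gt0 : 0 < h.

Let J := {ffun 'I_n -> 'I_(2 ^ L)}.

Definition leaf_int (phi : 'rV[R]_n -> \bar R) (m : J) : R :=
  fine (\int[leb n]_(x in leaf a h L m) phi x).

Let mcube b l : measurable (cube b l : set (@euclid R n)).
Proof.
apply: measurable_euclid; rewrite (_ : cube b l = box (fun i => `[b ord0 i, b ord0 i + l])).
  exact: measurable_box.
by apply/seteqP; split => x Hx i; have := Hx i; rewrite in_itv.
Qed.

Let mleaf m := measurable_leaf a h L m.
Let mcell l m := measurable_cell a h L l m.

Lemma fin_cell phi l m : measurable_fun [set: @euclid R n] phi -> (forall x, 0 <= phi x)%E ->
  (forall a l, 0 < l -> (\int[leb n]_(x in cube a l) phi x < +oo)%E) ->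
  (\int[leb n]_(x in cell a h L l m) phi x)%E \is a fin_num.
Proof.
move=> mphi phi0 H; rewrite ge0_fin_numE; last exact: integral_ge0.
apply: le_lt_trans (H _ _ (side_gt0 h L h_gt0 l)).
exact: (ge0_subset_integral _ (mcell l m) (mcube _ _) (measurable_funTS mphi) (fun x _ => phi0 x)
  (cell_sub_cube _ _ _ _ _)).
Qed.

Let fin_leaf phi m : measurable_fun [set: @euclid R n] phi -> (forall x, 0 <= phi x)%E ->
  (forall a l, 0 < l -> (\int[leb n]_(x in cube a l) phi x < +oo)%E) ->
  (\int[leb n]_(x in leaf a h L m) phi x = (leaf_int phi m)%:E)%E.
Proof. by move=> m1 m2 m3; rewrite /leaf_int fineK// leaf_cell; exact: fin_cell. Qed.

Let uE m := fin_leaf weight_q m measurable_weight_q weight_q_ge0 int_q.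
Let sE m := fin_leaf weight_dual m measurable_weight_dual weight_dual_ge0 int_dual.

(** Hoelder for [1 = (w^q)^th * (w^(-p'))^(1 - th)], where [th] is chosen so that the powers of [w]
    cancel. Besides feeding [sparse_mass_le] it shows that both leaf masses are positive. *)
Lemma leaf_lower m : (h ^+ n) `^ (q^-1 + (1 - p^-1)) <=
  leaf_int weight_q m `^ q^-1 * leaf_int weight_dual m `^ (1 - p^-1).
Proof.
set d := q^-1 + (1 - p^-1); have d0 : 0 < d by rewrite addr_gt0 ?subr_gt0.
pose th := q^-1 / d; have th0 : 0 < th by rewrite divr_gt0.
have th1E : 1 - th = (1 - p^-1) / d by rewrite /th -[1 in LHS](divff (lt0r_neq0 d0)) -mulrBl; congr (_ / _); rewrite /d; ring.
have th1 : th < 1 by rewrite -subr_gt0 th1E divr_gt0 ?subr_gt0.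
have := @integral_le_interpolation _ (@euclid R n) R (leb n) (leaf a h L m) (cst 1%E)
  weight_q weight_dual _ _ th (mleaf m) (measurable_funTS measurable_weight_q)
  (measurable_funTS measurable_weight_dual) (fun _ _ => lee01) (fun x _ => weight_q_ge0 x)
  (fun x _ => weight_dual_ge0 x) th0 th1 _ (uE m) (sE m).
have -> : (\int[leb n]_(x in leaf a h L m) cst 1%E x = (h ^+ n)%:E)%E.
  by rewrite integral_cst; [rewrite mul1e; exact: leb_leaf|exact: mleaf].
rewrite lee_fin => H.
have H1 : h ^+ n <= leaf_int weight_q m `^ th * leaf_int weight_dual m `^ (1 - th).
  apply: H => x s _ s0; have [w0|w0] := eqVneq (w x) 0.
    rewrite /weight_dual w0 powR0 ?gt_eqF// inve0 [X in (_ + X)%E]gt0_muley ?lte_fin; last first.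
      by rewrite mulr_gt0 ?powR_gt0 ?subr_gt0.
    rewrite ge0_addey ?leey//.
    by apply: mule_ge0; [rewrite lee_fin mulr_ge0 ?(ltW th0) ?(ltW s0)|exact: weight_q_ge0].
  have wp : 0 < w x by rewrite lt_neqAle eq_sym w0 w_ge0.
  rewrite /weight_q /weight_dual inver powR_eq0 (negbTE w0) /= -powRN -!EFinM -EFinD lee_fin.
  apply: le_trans (weighted_young _ _ _ _ _ (powR_gt0 _ wp) (powR_gt0 _ wp) th0 th1 s0).
  rewrite -!powRrM -powRD_gt0// th1E /th.
  rewrite (_ : _ + _ = 0) ?powRr0//; field.
  by rewrite !gt_eqF// subr_gt0.
have pV2 : 0 < 1 - p^-1 by rewrite subr_gt0.
exact: (interpolation_powR _ _ _ _ _ (exprn_ge0 n (ltW h_gt0)) qV pV2 H1).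
Qed.

Let leaf_lower_gt0 m : 0 < leaf_int weight_q m `^ q^-1 * leaf_int weight_dual m `^ (1 - p^-1).
Proof. by apply: lt_le_trans (leaf_lower m); rewrite powR_gt0 ?exprn_gt0. Qed.

Lemma leaf_q_gt0 m : 0 < leaf_int weight_q m.
Proof.
have : 0 <= leaf_int weight_q m by rewrite fine_ge0// integral_ge0// => x _; exact: weight_q_ge0.
rewrite le_eqVlt => /predU1P[E|//]; have := leaf_lower_gt0 m.
by rewrite -E powR0 ?gt_eqF// mul0r ltxx.
Qed.

Lemma leaf_dual_gt0 m : 0 < leaf_int weight_dual m.
Proof.
have : 0 <= leaf_int weight_dual m by rewrite fine_ge0// integral_ge0// => x _; exact: weight_dual_ge0.
rewrite le_eqVlt => /predU1P[E|//]; have := leaf_lower_gt0 m.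
by rewrite -E powR0 ?subr_eq0 ?gt_eqF// mulr0 ltxx.
Qed.

(** Hoelder for [|f| = (|f|^p * w^p)^(1/p) * (w^(-p'))^(1/p')]; it also shows that [f] is integrable
    on leaves. *)
Lemma leaf_f_le m :
  (\int[leb n]_(x in leaf a h L m) (`|f x|)%:E <=
   (leaf_int weighted_power m `^ p^-1 * leaf_int weight_dual m `^ (1 - p^-1))%:E)%E.
Proof.
have AE : (\int[leb n]_(x in leaf a h L m) weighted_power x = (leaf_int weighted_power m)%:E)%E.
  rewrite /leaf_int fineK// ge0_fin_numE; last first.
    by apply: integral_ge0 => x _; rewrite lee_fin mulr_ge0 ?powR_ge0.
  apply: (@le_lt_trans _ _ (\int[leb n]_x weighted_power x)%E); last by rewrite int_f ltry.
  apply: (ge0_subset_integral _ (mleaf m) measurableT measurable_weighted_power _ (@subsetT _ _)).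
  by move=> x _; rewrite lee_fin mulr_ge0 ?powR_ge0.
apply: (@integral_le_interpolation _ (@euclid R n) R (leb n) (leaf a h L m) _
  weighted_power weight_dual _ _ p^-1 (mleaf m) (measurable_funTS measurable_weighted_power)
  (measurable_funTS measurable_weight_dual) _ _ (fun x _ => weight_dual_ge0 x) pV pV1 _ AE (sE m)).
- by move=> x _; rewrite lee_fin.
- by move=> x _; rewrite lee_fin mulr_ge0 ?powR_ge0.
move=> x s _ s0.
have c2 : 0 < (1 - p^-1) * s `^ (- (p^-1 / (1 - p^-1))) by rewrite mulr_gt0 ?powR_gt0 ?subr_gt0.
have c1 : 0 < p^-1 * s by rewrite mulr_gt0.
have [w0|w0] := eqVneq (w x) 0.
  rewrite /weight_dual w0 powR0 ?gt_eqF// inve0 [X in (_ + X)%E]gt0_muley ?lte_fin//.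
  rewrite ge0_addey ?leey//.
  by rewrite mule_ge0 ?lee_fin ?(ltW c1) ?mulr_ge0 ?powR_ge0.
have wp : 0 < w x by rewrite lt_neqAle eq_sym w0 w_ge0.
rewrite /weighted_power /weight_dual inver powR_eq0 (negbTE w0) /= -powRN -!EFinM -EFinD lee_fin.
have [f0|f0] := eqVneq `|f x| 0.
  by rewrite f0 addr_ge0// mulr_ge0 ?(ltW c1) ?(ltW c2) ?mulr_ge0 ?powR_ge0.
have fp : 0 < `|f x| by rewrite lt_neqAle eq_sym f0 normr_ge0.
have A0 : 0 < `|f x| `^ p * w x `^ p by rewrite mulr_gt0 ?powR_gt0.
apply: le_trans (weighted_young _ _ _ _ _ A0 (powR_gt0 _ wp) pV pV1 s0).
rewrite powRM ?powR_ge0// -!powRrM divff ?gt_eqF// !powRr1// -mulrA.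
rewrite -[X in _ <= _ * (X * _)]powRr1// -powRD_gt0//.
by rewrite (_ : 1 + - (p / (p - 1)) * (1 - p^-1) = 0) ?powRr0 ?mulr1//; field; rewrite !gt_eqF// subr_gt0.
Qed.

Let fE m : (\int[leb n]_(x in leaf a h L m) (`|f x|)%:E = (leaf_int (fun x => (`|f x|)%:E) m)%:E)%E.
Proof.
rewrite /leaf_int fineK// ge0_fin_numE; last by apply: integral_ge0 => x _; rewrite lee_fin.
by apply: le_lt_trans (leaf_f_le m) _; rewrite ltry.
Qed.

Lemma leaf_f_powR_le m :
  leaf_int (fun x => (`|f x|)%:E) m `^ p * leaf_int weight_dual m `^ (1 - p) <=
  leaf_int weighted_power m.
Proof.
have s0 := leaf_dual_gt0 m; have := leaf_f_le m; rewrite fE lee_fin.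
set F := leaf_int _ m; set A := leaf_int weighted_power m; set s := leaf_int weight_dual m in s0 *.
have F0 : 0 <= F by rewrite fine_ge0// integral_ge0// => x _; rewrite lee_fin.
have A0 : 0 <= A.
  by rewrite fine_ge0// integral_ge0// => x _; rewrite lee_fin mulr_ge0 ?powR_ge0.
exact: interpolation_powRV.
Qed.

Definition vol (l : nat) : R := side h L l ^+ n.

(** The exponent [p^-1 - q^-1] is [beta / n] in the application. *)
Definition grid_potential : J -> R :=
  potential L (grid_key L) vol (leaf_int (fun x => (`|f x|)%:E)) (p^-1 - q^-1).

Definition grid_fun (x : 'rV[R]_n) : R := \sum_(m : J) grid_potential m * \1_(leaf a h L m) x.

Lemma vol_gt0 l : 0 < vol l.
Proof. by rewrite exprn_gt0// side_gt0. Qed.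

Lemma volS l : (l < L)%N -> vol l = 2 ^+ n * vol l.+1.
Proof.
move=> lL; rewrite /vol /side -exprMn; congr (_ ^+ _).
by rewrite -[(L - l)%N]subnSK// expnS natrM mulrCA.
Qed.

Lemma volL : vol L = h ^+ n.
Proof. by rewrite /vol /side subnn expn0 mulr1. Qed.

Let g := p^-1 - q^-1.
Let b : R := 2 ^+ n.
Definition geom_sum_const : R := (1 - b `^ (- g))^-1.

Let g0 : 0 < g. Proof. by rewrite subr_gt0 ltf_pV2 ?posrE. Qed.
Let b1 : 1 < b. Proof. by rewrite exprn_egt1 ?ltr1n// -lt0n. Qed.
Let c1 : b `^ (- g) < 1.
Proof.
rewrite powRN invf_lt1 ?powR_gt0 ?(lt_trans ltr01 b1)//.
by have := gt0_ltr_powR g0 _ _ b1; rewrite powR1; apply; rewrite nnegrE// ltW// (lt_trans ltr01).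
Qed.

Lemma vol_geom k : (k <= L)%N ->
  \sum_(k <= l < L.+1) vol l `^ g <= geom_sum_const * vol k `^ g.
Proof.
move=> kL; have d0 : 0 < 1 - b `^ (- g) by rewrite subr_gt0.
suff H j : (j <= L)%N -> \sum_(L - j <= l < L.+1) vol l `^ g <= geom_sum_const * vol (L - j) `^ g.
  by have := H _ (leq_subr k L); rewrite subKn.
elim: j => [_|j IH jL].
  rewrite subn0 big_nat1 ler_peMl ?powR_ge0// /geom_sum_const invf_ge1// gerBl powR_ge0//.
have jL' := ltnW jL; have E : (L - j = (L - j.+1).+1)%N by rewrite subnSK.
rewrite big_ltn ?ltnS ?leq_subr// -E.
have lt : (L - j.+1 < L)%N by rewrite ltn_subrL (leq_trans _ jL).
apply: (le_trans (lerD (lexx _) (IH jL'))).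
have -> : vol (L - j) `^ g = b `^ (- g) * vol (L - j.+1) `^ g.
  rewrite (volS _ lt) -E powRM ?(ltW (vol_gt0 _)) ?exprn_ge0// powRN mulKf// gt_eqF// powR_gt0//.
  exact: lt_trans b1.
rewrite le_eqVlt; apply/orP; left; apply/eqP; rewrite /geom_sum_const; field.
by rewrite gt_eqF.
Qed.

Lemma mass_leaf_int phi l m : (l <= L)%N -> measurable_fun [set: @euclid R n] phi ->
  (forall x, 0 <= phi x)%E ->
  (forall m', \int[leb n]_(x in leaf a h L m') phi x = (leaf_int phi m')%:E)%E ->
  (\int[leb n]_(x in cell a h L l m) phi x = (mass (grid_key L) (leaf_int phi) l m)%:E)%E.
Proof.
move=> lL mphi phi0 H; rewrite -sum_integral_leaf// /mass -sumEFin.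
by apply: eq_bigr => m' _; exact: H.
Qed.

Lemma cell_Apq l m : (l <= L)%N ->
  mass (grid_key L) (leaf_int weight_q) l m `^ q^-1 *
  mass (grid_key L) (leaf_int weight_dual) l m `^ (1 - p^-1) <=
  K * vol l `^ (q^-1 + (1 - p^-1)).
Proof.
move=> lL.
have H1 := mass_leaf_int _ l m lL measurable_weight_q weight_q_ge0 uE.
have H2 := mass_leaf_int _ l m lL measurable_weight_dual weight_dual_ge0 sE.
have sub := cell_sub_cube a h L l m; have s0 := side_gt0 h L h_gt0 l.
have le phi : measurable_fun [set: @euclid R n] phi -> (forall x, 0 <= phi x)%E ->
   (forall a l, 0 < l -> (\int[leb n]_(x in cube a l) phi x < +oo)%E) ->
   (\int[leb n]_(x in cell a h L l m) phi x <= (fine (\int[leb n]_(x in cube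
      (\row_i (a ord0 i + h * (grid_key L l m i * 2 ^ (L - l))%N%:R)) (side h L l)) phi x))%:E)%E.
  move=> mphi phi0 fphi; rewrite fineK.
    exact: (ge0_subset_integral _ (mcell l m) (mcube _ _) (measurable_funTS mphi) (fun x _ => phi0 x) sub).
  by rewrite ge0_fin_numE ?fphi//; exact: integral_ge0.
have := le _ measurable_weight_q weight_q_ge0 int_q; rewrite H1 lee_fin => le1.
have := le _ measurable_weight_dual weight_dual_ge0 int_dual; rewrite H2 lee_fin => le2.
apply: le_trans (cube_Apq _ _ s0).
have m1 : 0 <= mass (grid_key L) (leaf_int weight_q) l m.
  by apply: mass_ge0 => m'; exact: ltW (leaf_q_gt0 m').
have m2 : 0 <= mass (grid_key L) (leaf_int weight_dual) l m.
  by apply: mass_ge0 => m'; exact: ltW (leaf_dual_gt0 m').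
apply: ler_pM; rewrite ?powR_ge0//.
  exact: (ge0_ler_powR (ltW qV) m1 (le_trans m1 le1) le1).
have pV2 : 0 <= 1 - p^-1 by rewrite subr_ge0 ltW.
exact: (ge0_ler_powR pV2 m2 (le_trans m2 le2) le2).
Qed.

(** On a single leaf the lower bound [leaf_lower] meets the upper bound of the weight condition. *)
Lemma Apq_const_ge1 (m : J) : 1 <= K.
Proof.
have mE phi : measurable_fun [set: @euclid R n] phi -> (forall x, 0 <= phi x)%E ->
    (forall m, \int[leb n]_(x in leaf a h L m) phi x = (leaf_int phi m)%:E)%E ->
    mass (grid_key L) (leaf_int phi) L m = leaf_int phi m.
  move=> mphi phi0 E; have := mass_leaf_int phi L m (leqnn L) mphi phi0 E.
  by rewrite -leaf_cell E => -[].
have := cell_Apq L m (leqnn L); rewrite volL.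
rewrite (mE _ measurable_weight_q weight_q_ge0 uE).
rewrite (mE _ measurable_weight_dual weight_dual_ge0 sE).
move=> H; have := le_trans (leaf_lower m) H.
by rewrite -[X in X <= _]mul1r ler_pM2r// powR_gt0// exprn_gt0.
Qed.

Lemma grid_potential_norm_le :
  (\sum_m leaf_int weight_q m * grid_potential m `^ q) `^ q^-1 <=
  2 * geom_sum_const * (geom_const g b * K *
    ((2 * K) `^ ((1 - p^-1) / q^-1) + (2 * K) `^ (q^-1 / (1 - p^-1)))) * (p / (p - 1)) * q *
  NF `^ p^-1.
Proof.
have gE : q^-1 = p^-1 - g by rewrite /g; ring.
have D0 : 0 <= geom_sum_const by rewrite invr_ge0 subr_ge0 ltW.
have F0 m : 0 <= leaf_int (fun x => (`|f x|)%:E) m.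
  by rewrite fine_ge0// integral_ge0// => x _; rewrite lee_fin.
have leafV m : vol L `^ (q^-1 + (1 - p^-1)) <=
    leaf_int weight_q m `^ q^-1 * leaf_int weight_dual m `^ (1 - p^-1).
  by rewrite volL; exact: leaf_lower.
have H := dyadic_potential_le L (grid_key L) vol (grid_key_fine L) vol_gt0
  (grid_card a h L h_gt0) (leaf_int (fun x => (`|f x|)%:E)) (leaf_int weight_dual)
  (leaf_int weight_q) p q g b geom_sum_const K F0 leaf_dual_gt0 leaf_q_gt0 p_gt1 pq gE g0 b1
  volS K_ge0 leafV cell_Apq D0 vol_geom.
apply: (le_trans H); apply: ler_wpM2l.
  have K2 : 0 <= (2 * K) `^ ((1 - p^-1) / q^-1) + (2 * K) `^ (q^-1 / (1 - p^-1)).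
    by rewrite addr_ge0 ?powR_ge0.
  have e1 : 0 < 1 - p^-1 by rewrite subr_gt0.
  have ex : g + q^-1 + (1 - p^-1) = 1 by rewrite gE; ring.
  have G0 : 0 <= geom_const g b.
    apply: le_trans (geom_const_ge q^-1 (1 - p^-1) g b qV e1 g0 ex b1).
    have r1 := geom_ratio_gt1 q^-1 (1 - p^-1) g b qV e1 ex b1.
    by rewrite divr_ge0 ?subr_ge0 ?(ltW r1)// (le_trans ler01 (ltW r1)).
  apply: mulr_ge0 (ltW q0); apply: mulr_ge0 (ltW p'0).
  exact: mulr_ge0 (mulr_ge0 (ler0n _ 2) D0) (mulr_ge0 (mulr_ge0 G0 K_ge0) K2).
have leafA m : (\int[leb n]_(x in leaf a h L m) weighted_power x = (leaf_int weighted_power m)%:E)%E.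
  rewrite /leaf_int fineK// ge0_fin_numE; last first.
    by apply: integral_ge0 => x _; rewrite lee_fin mulr_ge0 ?powR_ge0.
  apply: (@le_lt_trans _ _ (\int[leb n]_x weighted_power x)%E); last by rewrite int_f ltry.
  apply: (ge0_subset_integral _ (mleaf m) measurableT measurable_weighted_power _ (@subsetT _ _)).
  by move=> x _; rewrite lee_fin mulr_ge0 ?powR_ge0.
have sumle : \sum_m leaf_int weighted_power m <= NF.
  rewrite -lee_fin -int_f -sumEFin; under eq_bigr do rewrite -leafA.
  rewrite -(@ge0_integral_bigsetU _ _ _ (leb n) _ (leaf a h L) weighted_power (index_enum J)) //.
  - apply: (ge0_subset_integral _ _ measurableT measurable_weighted_power _ (@subsetT _ _)).
      by apply: bigsetU_measurable => m _; exact: mleaf.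
    by move=> x _; rewrite lee_fin mulr_ge0 ?powR_ge0.
  - exact: index_enum_uniq.
  - by move=> m1 m2 _ _ [x [x1 x2]]; exact: (leaf_inj _ _ _ h_gt0 _ _ x x1 x2).
  - exact: measurable_funTS measurable_weighted_power.
  - by move=> x _; rewrite lee_fin mulr_ge0 ?powR_ge0.
have S0 : 0 <= \sum_m leaf_int (fun x => (`|f x|)%:E) m `^ p * leaf_int weight_dual m `^ (1 - p).
  by apply: sumr_ge0 => m _; rewrite mulr_ge0 ?powR_ge0.
have le : \sum_m leaf_int (fun x => (`|f x|)%:E) m `^ p * leaf_int weight_dual m `^ (1 - p) <= NF.
  by apply: le_trans sumle; apply: ler_sum => m _; exact: leaf_f_powR_le.
exact: (ge0_ler_powR (ltW pV) S0 (le_trans S0 le) le).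
Qed.

Lemma measurable_grid_fun : measurable_fun [set: @euclid R n] grid_fun.
Proof.
by apply: measurable_sum => m; apply: measurable_funM => //.
Qed.

Lemma grid_fun_leaf m x : leaf a h L m x -> grid_fun x = grid_potential m.
Proof.
move=> Hx; rewrite /grid_fun (bigD1 m)//= indicE mem_set// mulr1 big1 ?addr0// => m' /eqP mm'.
by rewrite indicE memNset ?mulr0// => Hx'; apply: mm'; exact: (leaf_inj _ _ _ h_gt0 _ _ x Hx' Hx).
Qed.

Lemma grid_potential_ge0 m : 0 <= grid_potential m.
Proof.
apply: sumr_ge0 => l _; rewrite mulr_ge0 ?powR_ge0//; apply: mass_ge0 => m'.
by rewrite fine_ge0// integral_ge0// => x _; rewrite lee_fin.
Qed.

Lemma grid_fun_ge0 x : 0 <= grid_fun x.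
Proof. by apply: sumr_ge0 => m _; rewrite mulr_ge0 ?grid_potential_ge0. Qed.

Lemma grid_fun_norm_le :
  (\int[leb n]_x (grid_fun x `^ q * w x `^ q)%:E <=
   ((2 * geom_sum_const * (geom_const g b * K *
    ((2 * K) `^ ((1 - p^-1) / q^-1) + (2 * K) `^ (q^-1 / (1 - p^-1)))) * (p / (p - 1)) * q *
    NF `^ p^-1) `^ q)%:E)%E.
Proof.
have E x : (grid_fun x `^ q * w x `^ q)%:E =
   (\sum_m (grid_potential m `^ q)%:E * (weight_q \_ (leaf a h L m)) x)%E.
  have [[m Hm]|H] := pselect (exists m, leaf a h L m x).
    rewrite (grid_fun_leaf _ _ Hm) (bigD1 m)//= patchE mem_set// big1 ?adde0//.
    move=> m' /eqP mm'; rewrite patchE memNset ?mule0// => Hx'.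
    by apply: mm'; exact: (leaf_inj _ _ _ h_gt0 _ _ x Hx' Hm).
  rewrite big1; last first.
    by move=> m _; rewrite patchE memNset ?mule0// => Hm; apply: H; exists m.
  rewrite /grid_fun big1 ?powR0 ?gt_eqF ?mul0r// => m _.
  by rewrite indicE memNset ?mulr0// => Hm; apply: H; exists m.
under eq_integral do rewrite E.
have mp m : measurable_fun [set: @euclid R n] (weight_q \_ (leaf a h L m)).
  by apply/(measurable_restrictT _ (mleaf m)).1; exact: measurable_funTS measurable_weight_q.
have p0' m x : (0 <= (weight_q \_ (leaf a h L m)) x)%E.
  by rewrite patchE; case: ifP => // _; exact: weight_q_ge0.
rewrite (ge0_integral_sum _ measurableT); last 2 first.
- by move=> m; exact: measurable_funeM.
- by move=> m x _; rewrite mule_ge0 ?lee_fin ?powR_ge0.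
under eq_bigr => m _.
  rewrite ge0_integralZl//; last by rewrite lee_fin powR_ge0.
  rewrite -integral_mkcond uE -EFinM. over.
rewrite sumEFin lee_fin.
under eq_bigr do rewrite mulrC.
have S0 : 0 <= \sum_m leaf_int weight_q m * grid_potential m `^ q.
  by apply: sumr_ge0 => m _; rewrite mulr_ge0 ?powR_ge0// ltW// leaf_q_gt0.
have -> : \sum_m leaf_int weight_q m * grid_potential m `^ q =
  ((\sum_m leaf_int weight_q m * grid_potential m `^ q) `^ q^-1) `^ q.
  by rewrite -powRrM mulVf ?gt_eqF// powRr1.
have H := grid_potential_norm_le.
exact: (ge0_ler_powR (ltW q0) (powR_ge0 _ _) (le_trans (powR_ge0 _ _) H) H).
Qed.

End weighted_grid.

(** * Shifted grids *)

Section shifted_grids.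
Context {R : realType}.

(* [2 ^ l / 3] is at distance at least [1 / 3] from the integers *)
Lemma third_shift (l : nat) (z : R) : exists (t : bool) (k : int), forall d : R, `|d| <= 8^-1 ->
  k%:~R <= z - t%:R * (2 ^+ l / 3) + d < (k + 1)%:~R.
Proof.
pose k := Num.floor z; pose m := (2 ^ l %/ 3)%N; pose r := (2 ^ l %% 3)%N.
have /andP[k1 k2] := floor_itv z.
rewrite -/k in k1 k2.
have E : 2 ^+ l = (m%:R * 3 + r%:R : R).
  by rewrite -natrX [in LHS](divn_eq (2 ^ l) 3) natrD natrM.
have r3 : (r < 3)%N by rewrite ltn_mod.
have r0 : (0 < r)%N.
  rewrite lt0n; apply/negP => /eqP r0; have : (3 %| 2 ^ l)%N by rewrite /dvdn -/r r0.
  by rewrite Euclid_dvdX.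
have r1R : 1 <= (r%:R : R) by rewrite ler1n.
have r2R : (r%:R : R) <= 2 by rewrite (ler_nat R r 2).
(* The point keeps its position if it is at least [1/8] away from both ends of its unit interval;
   near either end, the shift by [m + r / 3] with [r] equal to 1 or 2 moves it to a safe
   position. *)
have [h1|h1] := ltP (z - k%:~R) 8^-1.
  exists true, (k - m%:Z - 1) => d; rewrite ler_norml => /andP[d1 d2].
  rewrite E !intrD !intrN /= -!pmulrn; apply/andP; split; lra.
have [h2|h2] := ltP (z - k%:~R) (7 / 8).
  exists false, k => d; rewrite ler_norml => /andP[d1 d2].
  rewrite intrD (_ : false%:R = 0 :> R)// mul0r subr0; apply/andP; split; lra.
exists true, (k - m%:Z) => d; rewrite ler_norml => /andP[d1 d2].
rewrite E !intrD !intrN /= -!pmulrn; apply/andP; move: k2; rewrite intrD => k2; split; lra.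
Qed.

Variable (n : nat).

(** The grid of side [2 ^ N] is centred at 0 and then shifted, in the coordinates selected by [t],
    by a third of its whole side. The central cube [|x i| <= 2 ^ N / 8] stays inside every shifted
    grid. *)
Definition anchor (N : nat) (t : {ffun 'I_n -> bool}) : 'rV[R]_n :=
  \row_i (2 ^+ N * ((t i)%:R / 3 - 2^-1)).

Definition mesh (N : nat) : R := 2 ^- N.

Lemma mesh_gt0 N : 0 < mesh N.
Proof. by rewrite invr_gt0 exprn_gt0. Qed.

Lemma side_mesh N l : (l <= N.*2)%N -> side (mesh N) N.*2 l * 2 ^+ l = 2 ^+ N.
Proof.
move=> lN; rewrite /side /mesh natrX -mulrA -exprD subnK// -addnn exprD.
by rewrite mulKf// expf_neq0.
Qed.

Lemma leaf_exists (a x : 'rV[R]_n) h L : 0 < h ->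
  (forall i, a ord0 i <= x ord0 i < a ord0 i + h * (2 ^ L)%:R) -> exists m, leaf a h L m x.
Proof.
move=> h0 H; have L0 : (0 < 2 ^ L)%N by rewrite expn_gt0.
pose m0 : {ffun 'I_n -> 'I_(2 ^ L)} := [ffun=> Ordinal L0].
have : cell a h L 0 m0 x.
  move=> i; rewrite /grid_key !ffunE /= subn0 div0n mul0n mul1n in_itv/= mulr0 addr0; exact: H.
by rewrite -bigcup_leaf// => -[m _ Hm]; exists m.
Qed.

Lemma leaf_anchor N t (x : 'rV[R]_n) : (forall i, `|x ord0 i| <= 2 ^+ N / 8) ->
  exists m, leaf (anchor N t) (mesh N) N.*2 m x.
Proof.
move=> H; apply: leaf_exists; first exact: mesh_gt0.
have N0 : 0 < 2 ^+ N :> R by rewrite exprn_gt0.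
move=> i; have := H i; rewrite ler_norml mxE => /andP[h1 h2].
have -> : mesh N * (2 ^ N.*2)%:R = 2 ^+ N.
  by rewrite /mesh natrX -addnn exprD mulKf// expf_neq0.
by case: (t i) => /=; apply/andP; split; lra.
Qed.

Lemma ball_sub_cell N l (x : 'rV[R]_n) : (l <= N.*2)%N ->
  (forall i, `|x ord0 i| <= 2 ^+ N / 8) ->
  exists t, forall m, leaf (anchor N t) (mesh N) N.*2 m x ->
    [set y : 'rV[R]_n | forall i, `|y ord0 i - x ord0 i| <= side (mesh N) N.*2 l / 8]
      `<=` cell (anchor N t) (mesh N) N.*2 l m.
Proof.
move=> lN H; set s := side (mesh N) N.*2 l.
have s0 : 0 < s by exact: (side_gt0 _ _ (mesh_gt0 N) _).
have sE : s * 2 ^+ l = 2 ^+ N by exact: side_mesh.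
have /fin_all_exists[t /fin_all_exists[k tk]] : forall i, exists (t : bool) (k : int), forall d : R,
    `|d| <= 8^-1 -> k%:~R <= (x ord0 i + 2 ^+ N / 2) / s - t%:R * (2 ^+ l / 3) + d < (k + 1)%:~R.
  by move=> i; exact: third_shift.
exists [ffun i => t i] => m Hm y Hy i.
pose M := (2 ^ (N.*2 - l))%N; have M0 : (0 < M)%N by rewrite expn_gt0.
have MR : 0 < (M%:R : R) by rewrite ltr0n.
have sM : s = mesh N * M%:R by [].
set a := anchor N _ in Hm *.
have aE : a ord0 i = - (2 ^+ N / 2) + (t i)%:R * (2 ^+ l / 3) * s.
  rewrite /a mxE ffunE -sE; ring.
have key d : `|d| <= s / 8 ->
    (k i)%:~R * s <= x ord0 i - a ord0 i + d < (k i + 1)%:~R * s.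
  move=> ds; have : `|d / s| <= 8^-1.
    by rewrite normrM normfV (gtr0_norm s0) ler_pdivrMr// mulrC.
  move=> /(tk i); rewrite -(ler_pM2r s0) -(ltr_pM2r s0).
  rewrite (_ : (_ + d / s) * s = x ord0 i - a ord0 i + d)//.
  by rewrite aE; field; rewrite gt_eqF.
have := Hm i; rewrite in_itv/= => /andP[m1 m2].
have h0 := mesh_gt0 N.
have := key 0; rewrite normr0 divr_ge0 ?(ltW s0)// addr0 => /(_ isT) /andP[k1 k2].
(* The real inequalities locating [x] in its leaf become integer ones, which pin the ancestor's key
   to [k i]. *)
have e1 : (k i * M%:Z < (m i)%:Z + 1)%R.
  rewrite -(ltr_int R) intrD intrM -!pmulrn -(ltr_pM2l h0).
  move: k1; rewrite sM => k1.
  rewrite (_ : mesh N * ((k i)%:~R * M%:R) = (k i)%:~R * (mesh N * M%:R)); last by ring.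
  by apply: (le_lt_trans k1); move: m2; rewrite -natr1; lra.
have e2 : ((m i)%:Z < (k i + 1) * M%:Z)%R.
  rewrite -(ltr_int R) intrM -!pmulrn -(ltr_pM2l h0).
  move: k2; rewrite sM => k2.
  rewrite (_ : mesh N * ((k i + 1)%:~R * M%:R) = (k i + 1)%:~R * (mesh N * M%:R)); last by ring.
  by apply: le_lt_trans k2; lra.
have [k' kE] : exists k' : nat, k i = k'%:Z.
  have : (0 <= k i)%R by nia.
  by case: (k i) => // k' _; exists k'.
have gk : grid_key N.*2 l m i = k'.
  rewrite ffunE -/M; apply/eqP; rewrite eqn_leq -ltnS ltn_divLR// leq_divRL//.
  by move: e1 e2; rewrite kE; lia.
have := key (y ord0 i - x ord0 i) (Hy i) => /andP[c1 c2].
rewrite /cell in_itv/= gk -/M !natrM.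
have kr : (k i)%:~R = k'%:R :> R by rewrite kE -pmulrn.
move: c1 c2; rewrite intrD kr sM -natr1 => c1 c2.
rewrite !(mulrCA (mesh N)); apply/andP; split; lra.
Qed.

End shifted_grids.

(** * Riesz potentials *)

Lemma le_limn_einf {R : realType} (u : (\bar R)^nat) N (c : \bar R) :
  (forall k, (N <= k)%N -> c <= u k)%E -> (c <= limn_einf u)%E.
Proof.
move=> H; rewrite limn_einf_lim.
have nd := @nondecreasing_einfs R u.
rewrite (cvg_lim _ (ereal_nondecreasing_cvgn nd))//.
apply: (@le_trans _ _ (einfs u N)); last by apply: ereal_sup_ubound; exists N.
by apply: le_ereal_inf_tmp => _ [k /= Nk <-]; exact: H.
Qed.

Lemma limn_einf_le {R : realType} (u : (\bar R)^nat) (c : \bar R) :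
  (forall k, u k <= c)%E -> (limn_einf u <= c)%E.
Proof.
move=> H; rewrite limn_einf_lim.
have nd := @nondecreasing_einfs R u.
rewrite (cvg_lim _ (ereal_nondecreasing_cvgn nd))//.
apply: ge_ereal_sup => _ [k _ <-]; apply: le_trans (H k).
by apply: ereal_inf_lbound; exists k => /=.
Qed.

Lemma sum_powR_card_le {R : realType} (I : finType) (x : I -> R) (q : R) :
  0 < q -> (forall i, 0 <= x i) ->
  (\sum_i x i) `^ q <= #|I|%:R `^ q * \sum_i x i `^ q.
Proof.
move=> q0 x0; set S := \sum_i x i `^ q.
have S0 : 0 <= S by apply: sumr_ge0 => i _; exact: powR_ge0.
have xS i : x i <= S `^ q^-1.
  have -> : x i = (x i `^ q) `^ q^-1 by rewrite -powRrM divff ?gt_eqF// powRr1.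
  have le : x i `^ q <= S.
    by rewrite /S (bigD1 i)//= lerDl; apply: sumr_ge0 => j _; exact: powR_ge0.
  have qV0 : 0 <= q^-1 by rewrite invr_ge0 ltW.
  exact: (ge0_ler_powR qV0 (powR_ge0 _ _) S0 le).
have le : \sum_i x i <= #|I|%:R * S `^ q^-1.
  by rewrite mulr_natl -sumr_const; apply: ler_sum => i _; exact: xS.
have -> : #|I|%:R `^ q * S = (#|I|%:R * S `^ q^-1) `^ q.
  by rewrite powRM ?powR_ge0// -powRrM mulVf ?gt_eqF// powRr1.
apply: (ge0_ler_powR (ltW q0)) => //; rewrite nnegrE; first exact: sumr_ge0.
by rewrite mulr_ge0 ?powR_ge0.
Qed.

Section riesz.
Context {R : realType} {n : nat}.
Implicit Types (x y : 'rV[R]_n).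

Lemma enorm_ge0 x : 0 <= enorm x.
Proof. exact: sqrtr_ge0. Qed.

Lemma coord_le_enorm x i : `|x ord0 i| <= enorm x.
Proof.
rewrite /enorm -sqrtr_sqr ler_wsqrtr// (bigD1 i)//= lerDl.
by apply: sumr_ge0 => j _; rewrite sqr_ge0.
Qed.

Lemma enorm_eq0 x : enorm x = 0 -> x = 0.
Proof.
move=> x0; apply/rowP => i; apply/eqP; rewrite mxE -normr_le0 -x0.
exact: coord_le_enorm.
Qed.

Lemma measurable_enorm_sub x : measurable_fun [set: @euclid R n] (fun y => enorm (x - y)).
Proof.
apply: measurable_fun_euclid.
rewrite (_ : (fun y => _) = enorm \o affine x (-1)).
  by apply: measurableT_comp; [exact: measurable_enorm|exact: measurable_affine].
by apply/funext => y; rewrite /= /affine scaleN1r.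
Qed.

Lemma exists_annulus (s : R) (m : nat) r : 0 < s -> s / 2 ^+ m.+1 < r -> r <= s ->
  exists2 l, (l <= m)%N & s / 2 ^+ l.+1 < r <= s / 2 ^+ l.
Proof.
move=> s0; elim: m => [|m IH] h1 h2.
  by exists 0%N => //; rewrite h1 expr0 divr1 h2.
have [h|h] := ltP (s / 2 ^+ m.+1) r.
  by have [l lm H] := IH h h2; exists l => //; exact: leqW.
by exists m.+1 => //; rewrite h1 h.
Qed.

Variables (p q beta : R) (f : 'rV[R]_n -> R).
Hypothesis n_gt0 : (0 < n)%N.
Hypothesis mf : measurable_fun [set: @euclid R n] f.
Hypothesis beta_lt : beta < n%:R.
Hypothesis gE : p^-1 - q^-1 = beta / n%:R.
Hypothesis fin_leaf : forall a h L m, 0 < h ->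
  (\int[leb n]_(x in leaf a h L m) (`|f x|)%:E < +oo)%E.

Definition riesz_kernel x y : \bar R := (`|f y| / enorm (x - y) `^ (n%:R - beta))%:E.

Definition riesz x : \bar R := (\int[leb n]_y riesz_kernel x y)%E.

Lemma riesz_kernel_ge0 x y : (0 <= riesz_kernel x y)%E.
Proof. by rewrite lee_fin divr_ge0 ?powR_ge0. Qed.

Lemma measurable_abs_f : measurable_fun [set: @euclid R n] (fun y => (`|f y|)%:E).
Proof. by apply/measurable_EFinP; exact: measurableT_comp. Qed.

Lemma riesz_kernelE x y : riesz_kernel x y = (`|f y| * enorm (x - y) `^ (- (n%:R - beta)))%:E.
Proof. by rewrite /riesz_kernel powRN. Qed.

Lemma measurable_riesz_kernel x : measurable_fun [set: @euclid R n] (riesz_kernel x).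
Proof.
rewrite (funext (riesz_kernelE x)); apply/measurable_EFinP; apply: measurable_funM.
  exact: measurableT_comp.
by apply: (measurableT_comp (measurable_powR _)); exact: measurable_enorm_sub.
Qed.

(** The outer radius is an eighth of the coarsest side and halving it [2 * N + 1] times gives the
    inner radius, so the shell is the union of one annulus for each of the [2 * N + 1] levels. *)
Definition shell (N : nat) x : set 'rV[R]_n :=
  [set y | mesh N / 16 < enorm (x - y) <= 2 ^+ N / 8].

Lemma measurable_shell N x : measurable (shell N x : set (@euclid R n)).
Proof.
rewrite (_ : shell N x = setT `&` (fun y => enorm (x - y)) @^-1` `](mesh N / 16), (2 ^+ N / 8)]).
  exact: measurable_enorm_sub.
by rewrite setTI; apply/seteqP; split => y; rewrite /= in_itv.
Qed.

Definition grid_sum (N : nat) x : R :=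
  \sum_(t : {ffun 'I_n -> bool}) grid_fun p q f (anchor n N t) (mesh N) N.*2 x.

(** On the annulus of level [l] the distance lies between [s l / 16] and [s l / 8]: the lower bound
    costs [16^(n - beta)] in the kernel, and by the upper bound the annulus fits in a cell of one
    shifted grid. Summing over all shifts removes the dependence of that grid on [l]. *)
Lemma shell_riesz_le N x : (forall i, `|x ord0 i| <= 2 ^+ N / 8) ->
  (\int[leb n]_(y in shell N x) riesz_kernel x y <=
   (16 `^ (n%:R - beta) * grid_sum N x)%:E)%E.
Proof.
move=> xN; pose s l := side (mesh N : R) N.*2 l.
have h0 := @mesh_gt0 R N.
have s0 l : 0 < s l by exact: side_gt0.
have nb0 : 0 < n%:R - beta by rewrite subr_gt0.
pose B l := box (fun i => `[x ord0 i - s l / 8, x ord0 i + s l / 8]).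
have mB l : measurable (B l : set (@euclid R n)).
  by apply: measurable_euclid; exact: measurable_box.
pose c l := (s l / 16) `^ (- (n%:R - beta)).
have c0 l : 0 <= c l by exact: powR_ge0.
have sE l : (l <= N.*2)%N -> s l = 2 ^+ N / 2 ^+ l.
  by move=> lN; rewrite -(@side_mesh R N l lN) mulfK// expf_neq0.
apply: (@le_trans _ _ (\int[leb n]_y (\sum_(0 <= l < N.*2.+1) (c l)%:E * ((fun y => (`|f y|)%:E) \_ (B l)) y))%E).
  rewrite integral_mkcond; apply: le_integral_nomeas => y _.
    by rewrite patchE; case: ifP => // _; exact: riesz_kernel_ge0.
  have pos l : (0 <= (c l)%:E * ((fun y => (`|f y|)%:E) \_ (B l)) y)%E.
    by rewrite mule_ge0 ?lee_fin// patchE; case: ifP.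
  rewrite patchE; case: ifPn => [|_]; last by apply: sume_ge0 => l _; exact: pos.
  rewrite inE /shell /= => /andP[y1 y2].
  have r0 : 0 < 2 ^+ N / 8 :> R by rewrite divr_gt0// exprn_gt0.
  have lo : 2 ^+ N / 8 / 2 ^+ N.*2.+1 < enorm (x - y).
    apply: le_lt_trans y1; rewrite /mesh exprS -addnn exprD le_eqVlt; apply/orP; left; apply/eqP.
    by field; rewrite expf_neq0.
  have [l lN /andP[l1 l2]] := exists_annulus _ _ _ r0 lo y2.
  rewrite (bigD1_seq l) ?mem_index_iota ?ltnS ?iota_uniq//=; apply: (@le_trans _ _ ((c l)%:E * ((fun y => (`|f y|)%:E) \_ (B l)) y)%E); last first.
    by rewrite leeDl//; apply: sume_ge0 => k _; exact: pos.
  have lE := sE l lN.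
  have By : B l y.
    move=> i; rewrite in_itv/=.
    have := coord_le_enorm (x - y) i; rewrite !mxE ler_norml => /andP[z1 z2].
    have : enorm (x - y) <= s l / 8 by rewrite lE mulrAC.
    by move=> z3; apply/andP; split; lra.
  rewrite patchE mem_set// riesz_kernelE -EFinM lee_fin mulrC; apply: ler_wpM2r => //.
  have sl0 : 0 < s l / 16 by rewrite divr_gt0.
  have rle : s l / 16 <= enorm (x - y).
    apply: ltW; apply: le_lt_trans l1; rewrite lE exprS le_eqVlt; apply/orP; left; apply/eqP.
    by field; rewrite expf_neq0.
  rewrite /c !powRN lef_pV2 ?posrE ?powR_gt0 ?(lt_le_trans sl0 rle)//.
  by apply: (ge0_ler_powR (ltW nb0)); rewrite ?nnegrE ?(ltW sl0) ?enorm_ge0.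
have mg l : measurable_fun [set: @euclid R n] ((fun y => (`|f y|)%:E) \_ (B l)).
  by apply/(measurable_restrictT _ (mB l)).1; exact: measurable_funTS measurable_abs_f.
rewrite (ge0_integral_sum _ measurableT); last 2 first.
- by move=> l; exact: measurable_funeM.
- by move=> l y _; rewrite mule_ge0 ?lee_fin// patchE; case: ifP.
have /fin_all_exists[m Hm] : forall t : {ffun 'I_n -> bool}, exists m, leaf (anchor n N t) (mesh N) N.*2 m x.
  by move=> t; exact: leaf_anchor.
pose F t := leaf_int (anchor n N t) (mesh N) N.*2 (fun y => (`|f y|)%:E).
pose mss t l := mass (grid_key N.*2) (F t) l (m t).
have mss0 t l : 0 <= mss t l.
  by apply: mass_ge0 => z; rewrite fine_ge0// integral_ge0// => y _; rewrite lee_fin.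
have Bl l : (l < N.*2.+1)%N -> (\int[leb n]_y ((fun y => (`|f y|)%:E) \_ (B l)) y <= (\sum_t mss t l)%:E)%E.
  move=> lN; rewrite -integral_mkcond.
  have [t Ht] := @ball_sub_cell R n N l x lN xN.
  apply: (@le_trans _ _ (mss t l)%:E); last first.
    by rewrite lee_fin (bigD1 t)//= lerDl sumr_ge0.
  have leafE m' : (\int[leb n]_(y in leaf (anchor n N t) (mesh N) N.*2 m') (`|f y|)%:E = (F t m')%:E)%E.
    rewrite /F /leaf_int fineK// ge0_fin_numE ?fin_leaf//.
    by apply: integral_ge0 => y _; rewrite lee_fin.
  have absf0 y : (0 <= (`|f y|)%:E)%E by rewrite lee_fin.
  rewrite -(mass_leaf_int _ _ _ h0 _ l (m t) lN measurable_abs_f absf0 leafE).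
  apply: (ge0_subset_integral _ (mB l) (measurable_cell _ _ _ _ _) (measurable_funTS measurable_abs_f)).
    by move=> y _; rewrite lee_fin.
  apply: subset_trans (Ht (m t) (Hm t)) => y By i; have := By i; rewrite in_itv/= => /andP[y1 y2].
  by rewrite ler_norml; apply/andP; split; rewrite -/(s l); lra.
apply: (@le_trans _ _ (\sum_(0 <= l < N.*2.+1) (c l * \sum_t mss t l)%:E)%E).
  rewrite !big_nat; apply: lee_sum => l /andP[_ lN].
  have g0 y : (0 <= ((fun y => (`|f y|)%:E) \_ (B l)) y)%E by rewrite patchE; case: ifP.
  have -> : (\int[leb n]_y ((c l)%:E * ((fun y => (`|f y|)%:E) \_ (B l)) y) =
      (c l)%:E * \int[leb n]_y ((fun y => (`|f y|)%:E) \_ (B l)) y)%E.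
    exact: ge0_integralZl_EFin.
  by rewrite EFinM; apply: lee_pmul; [rewrite lee_fin|exact: integral_ge0| |exact: Bl].
rewrite sumEFin lee_fin.
under eq_bigr do rewrite mulr_sumr.
rewrite exchange_big/= /grid_sum mulr_sumr; apply: ler_sum => t _.
rewrite (grid_fun_leaf _ _ _ _ _ _ h0 (m t) x (Hm t)) /grid_potential /potential mulr_sumr.
rewrite !big_nat; apply: ler_sum => l /andP[_ lN].
rewrite mulrA -/(F t) -/(mss t l); apply: ler_wpM2r => //.
have n0 : n%:R != 0 :> R by rewrite pnatr_eq0 -lt0n.
have -> : @vol R n (mesh N) N.*2 l `^ (p^-1 - q^-1 - 1) = (s l) `^ (- (n%:R - beta)).
  have -> : @vol R n (mesh N) N.*2 l = s l `^ n%:R by rewrite powR_mulrn// ltW.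
  rewrite -powRrM gE; congr (_ `^ _).
  by field.
rewrite /c powRM ?invr_ge0 ?(ltW (s0 l))// mulrC le_eqVlt; apply/orP; left; apply/eqP; congr (_ * _).
by rewrite -powR_inv1// -powRrM mulN1r opprK.
Qed.

Lemma shell_riesz_cvg x :
  (\int[leb n]_(y in shell N x) riesz_kernel x y)%E @[N --> \oo] --> riesz x.
Proof.
have -> : riesz x = (\int[leb n]_(y in \bigcup_N shell N x) riesz_kernel x y)%E.
  rewrite /riesz [RHS]integral_mkcond; apply: eq_integral => y _; rewrite patchE.
  case: ifPn => //; rewrite notin_setE => H.
  (* On the diagonal the kernel is 0, as [powR] gives 0 there and so does division by 0; every other
     point belongs to some shell. *)
  have [e0|e0] := eqVneq (enorm (x - y)) 0.
    by rewrite /riesz_kernel e0 powR0 ?invr0 ?mulr0// subr_eq0 gt_eqF.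
  exfalso; apply: H.
  have ep : 0 < enorm (x - y) by rewrite lt_neqAle eq_sym e0 enorm_ge0.
  have [N1 HN1] : exists N : nat, enorm (x - y) <= 2 ^+ N / 8.
    exists (Num.truncn (8 * enorm (x - y))).+1; rewrite ler_pdivlMr// mulrC.
    have h0 : 0 <= 8 * enorm (x - y) by rewrite mulr_ge0 ?enorm_ge0.
    apply: le_trans (ltW (truncnS_gt _)) _; rewrite -natrX ler_nat ltnW// ltn_expl//.
  have [N2 HN2] : exists N : nat, mesh N / 16 < enorm (x - y).
    exists (Num.truncn (enorm (x - y))^-1).+1; rewrite /mesh ltr_pdivrMr//.
    rewrite invf_plt ?posrE ?mulr_gt0 ?exprn_gt0//.
    have i0 : 0 <= (enorm (x - y))^-1 by rewrite invr_ge0 enorm_ge0.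
    apply: (@lt_le_trans _ _ (enorm (x - y))^-1).
      rewrite invfM -[ltRHS]mulr1 ltr_pM2l ?invr_gt0//.
      by rewrite invf_lt1// ltr1n.
    apply: le_trans (ltW (truncnS_gt _)) _; rewrite -natrX ler_nat ltnW// ltn_expl//.
  exists (maxn N1 N2) => //; rewrite /shell /=; apply/andP; split.
    apply: le_lt_trans HN2; rewrite ler_pM2r ?invr_gt0// /mesh lef_pV2 ?posrE ?exprn_gt0//.
    by rewrite ler_eXn2l ?leq_maxr// ltr1n.
  apply: (le_trans HN1); rewrite ler_pM2r ?invr_gt0//.
  by rewrite ler_eXn2l ?leq_maxl// ltr1n.
apply: ge0_nondecreasing_set_cvg_integral.
- move=> N M NM; apply/subsetPset => y; rewrite /shell /= => /andP[y1 y2]; apply/andP; split.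
    apply: le_lt_trans y1; rewrite ler_pM2r ?invr_gt0// /mesh lef_pV2 ?posrE ?exprn_gt0//.
    by rewrite ler_eXn2l// ltr1n.
  by apply: (le_trans y2); rewrite ler_pM2r ?invr_gt0// ler_eXn2l// ltr1n.
- by move=> N; exact: measurable_shell.
- by move=> N; exact: measurable_funTS (measurable_riesz_kernel x).
- by move=> N y _; exact: riesz_kernel_ge0.
Qed.

Variable (w : 'rV[R]_n -> R).
Hypothesis mw : measurable_fun [set: @euclid R n] w.
Hypothesis w_ge0 : forall x, 0 <= w x.
Hypothesis q_gt0 : 0 < q.

Let C := 16 `^ (n%:R - beta).

(** For fixed [x] and [M], all large [N] have [x] in the central cube and [shell M x] inside
    [shell N x]. Hence each shell integral is controlled by the liminf, and then [M] tends to
    infinity. The values [w x = 0] and liminf [+oo] are split off because a root is taken. *)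
Lemma riesz_weighted_le_liminf x :
  (riesz x `^ q * (w x `^ q)%:E <=
   limn_einf (fun N => ((C * grid_sum N x) `^ q * w x `^ q)%:E))%E.
Proof.
set Lam := limn_einf _.
have Lam0 : (0 <= Lam)%E by apply: (@le_limn_einf _ _ 0%N) => k _; rewrite lee_fin mulr_ge0 ?powR_ge0.
have [w0|w0] := eqVneq (w x) 0; first by rewrite w0 powR0 ?gt_eqF// mule0.
have wp : 0 < w x by rewrite lt_neqAle eq_sym w0 w_ge0.
have wq : 0 < w x `^ q by exact: powR_gt0.
case LamE : Lam Lam0 => [lam| |]//; last by move=> _; rewrite leey.
rewrite lee_fin => lam0.
have [N0 HN0] : exists N0 : nat, forall N, (N0 <= N)%N -> forall i, `|x ord0 i| <= 2 ^+ N / 8.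
  exists (Num.truncn (8 * enorm x)).+1 => N NN i; apply: (le_trans (coord_le_enorm x i)).
  rewrite ler_pdivlMr// mulrC.
  have h0 : 0 <= 8 * enorm x by rewrite mulr_ge0 ?enorm_ge0.
  apply: le_trans (ltW (truncnS_gt _)) _; rewrite -natrX ler_nat.
  by apply: (leq_trans NN); rewrite ltnW// ltn_expl.
have shell_mono M N : (M <= N)%N -> (\int[leb n]_(y in shell M x) riesz_kernel x y <=
     \int[leb n]_(y in shell N x) riesz_kernel x y)%E.
  move=> MN; apply: (ge0_subset_integral _ (measurable_shell M x) (measurable_shell N x)
    (measurable_funTS (measurable_riesz_kernel x)) (fun y _ => riesz_kernel_ge0 x y)).
  move=> y; rewrite /shell /= => /andP[y1 y2]; apply/andP; split.
    apply: le_lt_trans y1; rewrite ler_pM2r ?invr_gt0// /mesh lef_pV2 ?posrE ?exprn_gt0//.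
    by rewrite ler_eXn2l// ltr1n.
  by apply: (le_trans y2); rewrite ler_pM2r ?invr_gt0// ler_eXn2l// ltr1n.
have bound M : (\int[leb n]_(y in shell M x) riesz_kernel x y <= ((lam / w x `^ q) `^ q^-1)%:E)%E.
  set I := (\int[leb n]_(y in shell M x) riesz_kernel x y)%E.
  have I0 : (0 <= I)%E by apply: integral_ge0 => y _; exact: riesz_kernel_ge0.
  have le N : (maxn M N0 <= N)%N -> (I <= (C * grid_sum N x)%:E)%E.
    rewrite geq_max => /andP[MN NN]; apply: (le_trans (shell_mono _ _ MN)).
    exact: (shell_riesz_le N x (HN0 N NN)).
  have If : I = (fine I)%:E.
    by rewrite fineK// ge0_fin_numE// (le_lt_trans (le _ (leqnn _)))// ltry.
  have I0' : 0 <= fine I by rewrite -lee_fin -If.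
  have : ((fine I `^ q * w x `^ q)%:E <= Lam)%E.
    apply: (@le_limn_einf _ _ (maxn M N0)) => N /le; rewrite If !lee_fin => H.
    apply: ler_wpM2r; first exact: powR_ge0.
    exact: (ge0_ler_powR (ltW q_gt0) I0' (le_trans I0' H) H).
  rewrite LamE If !lee_fin -ler_pdivlMr// => H.
  have -> : fine I = (fine I `^ q) `^ q^-1 by rewrite -powRrM divff ?gt_eqF// powRr1.
  have qV0 : 0 <= q^-1 by rewrite invr_ge0 ltW.
  exact: (ge0_ler_powR qV0 (powR_ge0 _ _) (le_trans (powR_ge0 _ _) H) H).
have rle : (riesz x <= ((lam / w x `^ q) `^ q^-1)%:E)%E.
  rewrite -(cvg_lim _ (shell_riesz_cvg x))//; apply: lime_le.
    by apply/cvg_ex; exists (riesz x); exact: shell_riesz_cvg.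
  by apply: nearW => M; exact: bound.
have r0 : (0 <= riesz x)%E by apply: integral_ge0 => y _; exact: riesz_kernel_ge0.
move: rle r0; case: (riesz x) => [r| |]//.
rewrite !lee_fin => rle r0.
have z0 : 0 <= lam / w x `^ q by rewrite divr_ge0 ?powR_ge0.
have := ge0_ler_powR (ltW q_gt0) r0 (powR_ge0 _ _) rle.
by rewrite -powRrM mulVf ?gt_eqF// powRr1// ler_pdivlMr.
Qed.

(** One factor [2 ^ n] comes from the [q]-th power of a sum over [2 ^ n] grids; the other from
    adding [2 ^ n] integrals, where [2 ^ n] is enlarged to its [q]-th power. *)
Lemma riesz_norm_le (B : R) : 1 <= q -> 0 <= B ->
  (forall N t, \int[leb n]_x (grid_fun p q f (anchor n N t) (mesh N) N.*2 x `^ q * w x `^ q)%:E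
     <= (B `^ q)%:E)%E ->
  (\int[leb n]_x (riesz x `^ q * (w x `^ q)%:E) <= ((C * (2 ^+ n) ^+ 2 * B) `^ q)%:E)%E.
Proof.
move=> q1 B0 HB; have C0 : 0 <= C by exact: powR_ge0.
apply: (@le_trans _ _ (\int[leb n]_x limn_einf (fun N => ((C * grid_sum N x) `^ q * w x `^ q)%:E))%E).
  apply: le_integral_nomeas => x _; last exact: riesz_weighted_le_liminf.
  by rewrite mule_ge0 ?poweR_ge0// lee_fin powR_ge0.
have mS N : measurable_fun [set: @euclid R n] (grid_sum N).
  by apply: measurable_sum => t; exact: measurable_grid_fun.
have mwq : measurable_fun [set: @euclid R n] (fun x => w x `^ q).
  exact: (measurableT_comp (measurable_powR _)).
have S0 N x : 0 <= grid_sum N x by apply: sumr_ge0 => t _; exact: grid_fun_ge0.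
have mg N : measurable_fun [set: @euclid R n] (fun x => ((C * grid_sum N x) `^ q * w x `^ q)%:E).
  apply/measurable_EFinP.
  exact: (measurable_funM (measurableT_comp (measurable_powR _)
    (measurable_funM (measurable_cst C) (mS N))) mwq).
apply: le_trans (fatou (leb n) measurableT mg _) _.
  by move=> N x _; rewrite lee_fin mulr_ge0 ?powR_ge0.
apply: limn_einf_le => N.
pose T := #|{ffun 'I_n -> bool}|.
have TE : T%:R = 2 ^+ n :> R by rewrite /T card_ffun card_bool card_ord natrX.
pose gt t x : \bar R := (grid_fun p q f (anchor n N t) (mesh N) N.*2 x `^ q * w x `^ q)%:E.
have gt0 t x : (0 <= gt t x)%E by rewrite lee_fin mulr_ge0 ?powR_ge0.
have mgt t : measurable_fun [set: @euclid R n] (gt t).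
  apply/measurable_EFinP.
  exact: (measurable_funM (measurableT_comp (measurable_powR _) (measurable_grid_fun _ _ _ _ _ _)) mwq).
have k0 : 0 <= C `^ q * T%:R `^ q by rewrite mulr_ge0 ?powR_ge0.
apply: (@le_trans _ _ (\int[leb n]_x ((C `^ q * T%:R `^ q)%:E * \sum_t gt t x))%E).
  apply: le_integral_nomeas => x _; first by rewrite lee_fin mulr_ge0 ?powR_ge0.
  rewrite /gt sumEFin -EFinM lee_fin -mulr_suml mulrA; apply: ler_wpM2r; first exact: powR_ge0.
  rewrite powRM// -mulrA; apply: ler_wpM2l; first exact: powR_ge0.
  by apply: sum_powR_card_le => // t; exact: grid_fun_ge0.
have sum0 x : (0 <= \sum_t gt t x)%E by apply: sume_ge0.
have msum : measurable_fun [set: @euclid R n] (fun x => \sum_t gt t x)%E by exact: emeasurable_sum.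
have -> : (\int[leb n]_x ((C `^ q * T%:R `^ q)%:E * \sum_t gt t x) =
    (C `^ q * T%:R `^ q)%:E * \int[leb n]_x \sum_t gt t x)%E.
  apply: ge0_integralZl_EFin; [exact: measurableT|by move=> x _; exact: sum0|exact: msum|exact: k0].
rewrite ge0_integral_sum//.
apply: (@le_trans _ _ ((C `^ q * T%:R `^ q)%:E * \sum_(t : {ffun 'I_n -> bool}) (B `^ q)%:E)%E).
  apply: lee_wpmul2l; first by rewrite lee_fin.
  by apply: lee_sum => t _; exact: HB.
rewrite sumEFin -EFinM lee_fin sumr_const -/T -[B `^ q *+ _]mulr_natl TE.
set t := 2 ^+ n; have t1 : 1 <= t :> R by rewrite exprn_ege1// ler1n.
have t0 : 0 <= t by exact: le_trans t1.
rewrite powRM ?mulr_ge0 ?exprn_ge0// powRM ?exprn_ge0// expr2 (powRM _ t0 t0).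
have -> : C `^ q * t `^ q * (t * B `^ q) = C `^ q * (t `^ q * t) * B `^ q by ring.
apply: ler_wpM2r; first exact: powR_ge0.
apply: ler_wpM2l; first exact: powR_ge0.
by apply: ler_wpM2l; [exact: powR_ge0|exact: le1r_powR].
Qed.

End riesz.

(** * Directions *)

Section null_cones.
Context {R : realType} {n : nat}.

Lemma measurable_null (A : set (@euclid R n)) : leb n A = 0%E -> measurable A.
Proof.
move=> A0; apply: le_caratheodory_measurable => X.
have XA0 : (((borel_lebesgue n)^*)%mu (X `&` A) <= 0)%E.
  by rewrite -[leRHS]A0; apply: le_outer_measure; exact: subIsetr.
have XAC : (((borel_lebesgue n)^*)%mu (X `&` ~` A) <= ((borel_lebesgue n)^*)%mu X)%E.
  by apply: le_outer_measure; exact: subIsetl.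
by have := leeD XA0 XAC; rewrite add0e.
Qed.

Lemma leb_null_sub (A B : set (@euclid R n)) : A `<=` B -> leb n B = 0%E -> leb n A = 0%E.
Proof.
move=> AB B0; apply/eqP; rewrite eq_le; apply/andP; split; last exact: outer_measure_ge0.
by rewrite -[leRHS]B0; exact: le_outer_measure.
Qed.

Lemma leb_null_bigcup (A : (set (@euclid R n))^nat) :
  (forall k, leb n (A k) = 0%E) -> leb n (\bigcup_k A k) = 0%E.
Proof.
move=> A0; have [B [mB B0 AB]] : (leb n).-negligible (\bigcup_k A k).
  by apply: negligible_bigcup => k; exists (A k); split=> //; [exact/measurable_null/A0|exact: A0].
exact: leb_null_sub AB B0.
Qed.

Lemma leb_null_setU (A B : set (@euclid R n)) :
  leb n A = 0%E -> leb n B = 0%E -> leb n (A `|` B) = 0%E.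
Proof.
move=> A0 B0; have : (leb n).-negligible (A `|` B).
  apply: negligibleU; [exists A|exists B]; split=> //; exact: measurable_null.
by move=> [C [mC C0 ABC]]; exact: leb_null_sub ABC C0.
Qed.

Hypothesis n_gt0 : (0 < n)%N.

Lemma leb_set0 : leb n [set (0 : 'rV[R]_n)] = 0%E.
Proof.
apply: (@leb_null_sub _ (box (fun=> `[0, 0]))).
  by move=> _ -> i; rewrite mxE in_itv/= lexx.
have -> : leb n (box (fun=> `[0 : R, 0])) = (0 ^+ n)%:E.
  by apply: leb_box => // i; rewrite lebesgue_measure_itv/= ltxx.
by rewrite expr0n gtn_eqF.
Qed.

Lemma leb_ball_fin_gt0 : (0 < leb n (@punctured_ball R n) < +oo)%E.
Proof.
have mB := @measurable_punctured_ball R n.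
have nR : 0 < (n%:R : R) by rewrite ltr0n.
apply/andP; split.
  (* The cube with coordinates between [1 / (2 n)] and [1 / n] lies in the punctured ball. *)
  pose e : R := (2 * n%:R)^-1; have e0 : 0 < e by rewrite invr_gt0 mulr_gt0.
  apply: (@lt_le_trans _ _ (leb n (box (fun=> `[e, 2 * e[)))).
    rewrite (leb_box _ _ e (ltW e0)) ?lte_fin ?exprn_gt0// => i.
    rewrite lebesgue_measure_itv/= lte_fin ltr_pMl// ltr1n -EFinB; congr EFin; ring.
  apply: le_outer_measure => x Hx; rewrite /punctured_ball /=; apply/andP; split.
    have := Hx (Ordinal n_gt0); rewrite in_itv/= => /andP[h _].
    apply: lt_le_trans (coord_le_enorm x (Ordinal n_gt0)).
    by apply: lt_le_trans e0 (le_trans h (ler_norm _)).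
  rewrite /enorm -[leRHS]sqrtr1 ler_sqrt//.
  apply: (@le_trans _ _ (\sum_(i < n) (n%:R^-1 ^+ 2 : R))).
    apply: ler_sum => i _; have := Hx i; rewrite in_itv/= => /andP[h1 h2].
    have -> : n%:R^-1 = 2 * e by rewrite /e invfM mulrA divff ?mul1r.
    by rewrite lerXn2r ?nnegrE ?(le_trans (ltW e0) h1) ?mulr_ge0 ?(ltW e0)// ltW.
  rewrite sumr_const card_ord -[leLHS]mulr_natl.
  have -> : n%:R * n%:R^-1 ^+ 2 = (n%:R : R)^-1 by field; rewrite gt_eqF.
  by rewrite invf_le1// ler1n.
apply: (@le_lt_trans _ _ (leb n (box (fun=> `[-1, 1])))).
  apply: le_outer_measure => x; rewrite /punctured_ball /= => /andP[_ h] i.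
  by rewrite in_itv/= -ler_norml (le_trans (coord_le_enorm x i)).
have -> : leb n (box (fun=> `[-1 : R, 1])) = (2 ^+ n)%:E.
  apply: leb_box => // i; rewrite lebesgue_measure_itv/= lte_fin (lt_trans (@ltrN10 R) ltr01).
  by rewrite -EFinB opprK.
exact: ltry.
Qed.

Lemma enormZ (c : R) (x : 'rV[R]_n) : 0 <= c -> enorm (c *: x) = c * enorm x.
Proof.
move=> c0; rewrite /enorm; have -> : \sum_i (c *: x) ord0 i ^+ 2 = c ^+ 2 * \sum_i x ord0 i ^+ 2.
  by rewrite mulr_sumr; apply: eq_bigr => i _; rewrite mxE exprMn.
by rewrite sqrtrM ?sqr_ge0// sqrtr_sqr ger0_norm.
Qed.

Lemma unitvZ (c : R) (x : 'rV[R]_n) : 0 < c -> unitv (c *: x) = unitv x.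
Proof.
move=> c0; rewrite /unitv enormZ ?(ltW c0)// scalerA invfM.
by rewrite [X in X * _]mulrC mulfVK ?gt_eqF.
Qed.

(* The exceptional set of directions generates a cone; the dyadic dilates of
   its part in the unit ball exhaust it. *)
Lemma sphere_supnorm_bound (Omega : 'rV[R]_n -> R) :
  in_sphere_Loo Omega -> homogeneous0 Omega ->
  exists2 M : R, 0 <= M & sphere_supnorm Omega = M%:E /\
   exists2 N : set (@euclid R n), leb n N = 0%E &
     (N (0 : 'rV[R]_n)) /\ forall z : 'rV[R]_n, ~ N z -> `|Omega z| <= M.
Proof.
move=> [mO Ofin] hom; have /andP[b0 boo] := leb_ball_fin_gt0.
have bfin : leb n (@punctured_ball R n) \is a fin_num by rewrite ge0_fin_numE// ltW.
have c0 : 0 < fine (leb n (@punctured_ball R n)) by rewrite fine_gt0// b0 boo.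
have muT : (0 < sphere_measure R n setT)%E.
  rewrite /sphere_measure preimage_setT setTI -(fineK bfin) -EFinM lte_fin.
  by rewrite mulVf ?gt_eqF.
have supE : sphere_supnorm Omega = ess_sup (sphere_measure R n) (abse \o (EFin \o Omega)).
  by rewrite /sphere_supnorm unlock muT.
have sup0 : (0 <= sphere_supnorm Omega)%E by exact: Lnorm_ge0.
have supfin : sphere_supnorm Omega \is a fin_num by rewrite ge0_fin_numE.
exists (fine (sphere_supnorm Omega)); first by rewrite fine_ge0.
rewrite fineK//; split => //.
have [A [mA A0 HA]] := ess_sup_ge (sphere_measure R n) (abse \o (EFin \o Omega)).
rewrite -supE in HA.
pose Z : set (@euclid R n) := unitv @^-1` A.
have Z0 : leb n (Z `&` @punctured_ball R n) = 0%E.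
  have : (((fine (leb n (@punctured_ball R n)))^-1)%:E * leb n (Z `&` @punctured_ball R n) = 0)%E.
    exact: A0.
  by move/eqP; rewrite mule_eq0 eqe invr_eq0 (gt_eqF c0) => /eqP.
pose Zk k : set (@euclid R n) := affine 0 (2 ^- k) @^-1` (Z `&` @punctured_ball R n).
have Zk0 k : leb n (Zk k) = 0%E.
  by apply: leb_affine_null => //; rewrite gt_eqF// invr_gt0 exprn_gt0.
exists ([set (0 : 'rV[R]_n)] `|` \bigcup_k Zk k).
  by apply: leb_null_setU; [exact: leb_set0|exact: leb_null_bigcup].
split; first by left.
move=> z Nz; have z0 : 0 < enorm z.
  rewrite lt_neqAle eq_sym enorm_ge0 andbT; apply/eqP => /enorm_eq0 z0.
  by apply: Nz; left.
have -> : Omega z = Omega (unitv z) by rewrite /unitv hom ?invr_gt0.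
apply: contrapT => H; apply: Nz; right.
(* With this [k] one has [enorm z <= k <= 2 ^ k], so the dilate [2 ^- k *: z], which has the
   direction of [z], is in the unit ball. *)
exists (Num.truncn (enorm z)).+1 => //; rewrite /Zk /= /affine add0r.
set k := (Num.truncn (enorm z)).+1.
have k0 : 0 < 2 ^- k :> R by rewrite invr_gt0 exprn_gt0.
split.
  rewrite /Z /= unitvZ//; apply: HA => /=; rewrite -(fineK supfin) lee_fin; exact: H.
rewrite /punctured_ball /= enormZ ?(ltW k0)// mulr_gt0//= mulrC ler_pdivrMr ?exprn_gt0// mul1r.
apply: le_trans (ltW (truncnS_gt _)) _; rewrite -natrX ler_nat ltnW// ltn_expl//.
Qed.

End null_cones.

(** * The square function *)

Lemma integral_inv_sqr {R : realType} (a : R) : 0 < a ->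
  (\int[@lebesgue_measure R]_(t in `[a, +oo[) ((t ^+ 2)^-1)%:E = (a^-1)%:E)%E.
Proof.
move=> a0; have ne t : a <= t -> t != 0 by move=> h; rewrite gt_eqF// (lt_le_trans a0).
rewrite (@ge0_continuous_FTC2y _ _ (fun t => - t^-1) a 0).
- by rewrite sub0e -EFinN opprK.
- by move=> t _; rewrite invr_ge0 sqr_ge0.
- apply: continuous_in_subspaceT => t; rewrite inE/= in_itv/= andbT => /ne t0.
  apply: (@continuousV _ _ (fun t : R => t ^+ 2)); first by rewrite expf_neq0.
  exact: exprn_continuous.
- rewrite -[X in _ --> X]oppr0; apply: cvgN.
  apply/(@gtr0_cvgV0 _ _ _ _ id) => //.
  by exists 0; split => // t.
- move=> t /ltW/ne t0; apply: derivableN; exact: derivableV.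
- apply: cvg_at_right_filter; apply: continuousN; apply: continuousV => //.
  exact: ne.
- move=> t; rewrite in_itv/= andbT => /ltW/ne t0.
  rewrite derive1E deriveN; last exact: derivableV.
  by rewrite deriveV// derive_id scaleNr opprK /GRing.scale/= mulr1.
Qed.

Lemma powR_inv_sqr {R : realType} (t : R) : 0 <= t -> t `^ (- 2) = (t ^+ 2)^-1.
Proof. by move=> t0; rewrite powRN powR_mulrn. Qed.

Section square_function.
Local Open Scope ereal_scope.
Context d (T : measurableType d) (R : realType).
Variable mu : {sigma_finite_measure set T -> \bar R}.
Variables (k : T -> \bar R) (r : T -> R).
Hypothesis mk : measurable_fun [set: T] k.
Hypothesis k0 : forall y, 0 <= k y.
Hypothesis mr : measurable_fun [set: T] r.
Hypothesis r0 : forall y, (0 <= r y)%R.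

Let region : set (T * measurableTypeR R) := [set z | (r z.1 <= z.2 /\ 0 < z.2)%R].

Let m_region : measurable region.
Proof.
rewrite (_ : region = (setT `&` (fun z : T * measurableTypeR R => z.2 - r z.1)%R @^-1` `[0%R, +oo[)
    `&` (setT `&` snd @^-1` `]0%R, +oo[)); last first.
  apply/seteqP; split => z; rewrite /region /= !in_itv/= !andbT subr_ge0; first by case.
  by case=> -[_ ?] [_ ?].
apply: measurableI; last exact: (@measurable_snd _ _ T (measurableTypeR R)).
have mf : measurable_fun [set: T * measurableTypeR R]
    (fun z : T * measurableTypeR R => z.2 - r z.1)%R.
  apply: measurable_funB; first exact: measurable_snd.
  exact: (measurableT_comp mr (@measurable_fst _ _ T (measurableTypeR R))).
exact: mf.
Qed.

(** The integrand of the inner integral, already divided by [t ^ 2] and extended to the product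
    space by an indicator, so that Tonelli applies. *)
Let G (z : T * measurableTypeR R) : \bar R :=
  k z.1 * (r z.1 * (\1_region z * z.2 `^ (- 2)))%:E.

Let mG : measurable_fun setT G.
Proof.
apply: emeasurable_funM; first exact: (measurableT_comp mk (@measurable_fst _ _ T (measurableTypeR R))).
apply/measurable_EFinP; apply: measurable_funM.
  exact: (measurableT_comp mr (@measurable_fst _ _ T (measurableTypeR R))).
apply: measurable_funM; first exact: measurable_indic.
exact: (measurableT_comp (measurable_powR _) (@measurable_snd _ _ T (measurableTypeR R))).
Qed.

Let G0 z : 0 <= G z.
Proof.
by rewrite /G mule_ge0// lee_fin mulr_ge0// mulr_ge0 ?powR_ge0.
Qed.

Let m_slice y : measurable_fun [set: measurableTypeR R] (fun t => \1_region (y, t) : R).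
Proof.
have := measurableT_comp (measurable_indic (R := R) (D := setT) m_region) (@pair1_measurable _ _ T (measurableTypeR R) y).
exact.
Qed.

(** [r * \int_r^oo t^(-2) dt] is 1 for positive [r], and the left side is 0 for [r = 0]. *)
Let int_G y : \int[@lebesgue_measure R]_t G (y, t) <= k y.
Proof.
rewrite /G /= ge0_integralZl//; last 2 first.
- apply/measurable_EFinP; apply: measurable_funM => //.
  apply: measurable_funM; last exact: measurable_powR.
  exact: m_slice.
- by move=> t _; rewrite lee_fin mulr_ge0// mulr_ge0 ?powR_ge0.
apply: (@le_trans _ _ (k y * 1)); last by rewrite mule1.
apply: lee_wpmul2l => //.
have := r0 y; rewrite le_eqVlt => /predU1P[<-|ry].
  by rewrite integral0_eq// => t _; rewrite mul0r.
have -> : \int[@lebesgue_measure R]_t (r y * (\1_region (y, t) * t `^ (- 2)))%:E =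
    (r y)%:E * \int[@lebesgue_measure R]_(t in `[r y, +oo[) (t `^ (- 2))%:E.
  rewrite -ge0_integralZl ?lee_fin ?(ltW ry)//; last 2 first.
  - by apply/measurable_EFinP; apply: measurable_funTS; exact: measurable_powR.
  - by move=> t _; rewrite lee_fin powR_ge0.
  rewrite [in RHS]integral_mkcond; apply: eq_integral => t _.
  rewrite patchE mem_setE in_itv/= andbT indicE.
  have -> : ((y, t) \in region) = (r y <= t)%R.
    apply/idP/idP; first by rewrite inE => -[].
    by move=> h; rewrite inE; split => //=; exact: lt_le_trans ry h.
  by case: ifP => _; rewrite ?mul1r ?mul0r ?mulr0// EFinM.
rewrite (eq_integral (fun t : measurableTypeR R => (((t : R) ^+ 2)^-1)%:E)); last first.
  by move=> t; rewrite inE/= in_itv/= andbT => ht; rewrite powR_inv_sqr// (le_trans (ltW ry) ht).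
by rewrite integral_inv_sqr// -EFinM divff ?gt_eqF.
Qed.

Lemma square_function_le :
  \int[@lebesgue_measure R]_(t in `]0%R, +oo[)
     ((\int[mu]_(y in [set y | (r y <= t)%R]) (k y * (r y)%:E)) ^+ 2 * ((t ^+ 3)^-1)%:E)
  <= (\int[mu]_y k y) ^+ 2.
Proof.
set I := \int[mu]_y k y.
have I0 : 0 <= I by exact: integral_ge0.
pose F t := \int[mu]_y G (y, t).
have mF : measurable_fun setT F by exact: measurable_fun_fubini_tonelli_G.
have F0 t : 0 <= F t by exact: integral_ge0.
have H t : (0 < t)%R -> \int[mu]_(y in [set y | (r y <= t)%R]) (k y * (r y)%:E) = F t * (t ^+ 2)%:E.
  move=> t0; rewrite muleC /F -ge0_integralZl ?lee_fin ?sqr_ge0//; last first.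
    exact: (measurableT_comp mG (pair2_measurable t)).
  rewrite [in LHS]integral_mkcond; apply: eq_integral => y _; rewrite patchE /G /= indicE.
  have -> : (y \in [set y | (r y <= t)%R]) = (r y <= t)%R by apply/idP/idP; rewrite inE.
  have -> : ((y, t) \in region) = (r y <= t)%R.
    apply/idP/idP; first by rewrite inE => -[].
    by move=> h; rewrite inE; split.
  case: ifP => _; last by rewrite mul0r mulr0 !mule0.
  rewrite powR_inv_sqr ?(ltW t0)// muleCA -EFinM; congr (_ * _%:E).
  by rewrite mul1r; field; rewrite gt_eqF.
apply: (@le_trans _ _ (\int[@lebesgue_measure R]_(t in `]0%R, +oo[) (I * F t))).
  apply: le_integral_nomeas => t; rewrite /= in_itv/= andbT => t0.
    apply: mule_ge0; last by rewrite lee_fin invr_ge0 exprn_ge0// ltW.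
    by apply: mule_ge0; apply: integral_ge0 => y _; rewrite mule_ge0// lee_fin.
  have Ft : F t * (t ^+ 2)%:E <= t%:E * I.
    rewrite -H// /I -ge0_integralZl ?lee_fin ?(ltW t0)//.
    rewrite [in leLHS]integral_mkcond; apply: le_integral_nomeas => y _; rewrite patchE.
      by case: ifP => // _; rewrite mule_ge0// lee_fin.
    case: ifP => [|_]; last by rewrite mule_ge0// lee_fin ltW.
    by rewrite inE/= muleC => h; rewrite lee_wpmul2r// lee_fin.
  rewrite H//.
  have -> : (F t * (t ^+ 2)%:E) * (F t * (t ^+ 2)%:E) * ((t ^+ 3)^-1)%:E =
     (F t * (t ^+ 2)%:E) * (F t * (t^-1)%:E).
    rewrite -!muleA -EFinM; congr (_ * (_ * (_ * _%:E))).
    by field; rewrite gt_eqF.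
  apply: (@le_trans _ _ (t%:E * I * (F t * (t^-1)%:E))).
    by rewrite lee_wpmul2r// mule_ge0// lee_fin invr_ge0 ltW.
  have -> : t%:E * I * (F t * (t^-1)%:E) = (t%:E * (t^-1)%:E) * (I * F t).
    by rewrite [F t * _]muleC muleACA.
  by rewrite -EFinM divff ?gt_eqF// mul1e.
apply: (@le_trans _ _ (\int[@lebesgue_measure R]_t (I * F t))).
  rewrite [in leLHS]integral_mkcond; apply: le_integral_nomeas => t _; rewrite patchE; case: ifP => // _;
    by rewrite mule_ge0.
rewrite ge0_integralZl// expe2; apply: lee_wpmul2l => //.
rewrite -(fubini_tonelli (m1 := mu) (m2 := @lebesgue_measure R) _ mG G0).
by apply: le_integral_nomeas => y _; [apply: integral_ge0 => t _; exact: G0|exact: int_G].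
Qed.

End square_function.

Section leb_sigma_finite.
Context {R : realType} (n : nat).

Let leb_sigma_finite : sigma_finite setT (@leb R n).
Proof.
exact/completed_measure_extension_sigma_finite/sigma_finiteT.
Qed.

HB.instance Definition _ := Measure_isSigmaFinite.Build _ _ _ (@leb R n) leb_sigma_finite.

End leb_sigma_finite.

(** * Domination of the Marcinkiewicz integral by the Riesz potential *)

Section marcinkiewicz_riesz.
Local Open Scope ereal_scope.
Context {R : realType} {n : nat}.
Variables (beta M : R) (f Omega : 'rV[R]_n -> R) (N : set (@euclid R n)).
Hypothesis mf : measurable_fun [set: @euclid R n] f.
Hypothesis M_ge0 : (0 <= M)%R.
Hypothesis N_null : leb n N = 0.
Hypothesis N0 : N (0%R : 'rV[R]_n).
Hypothesis Omega_le : forall z : 'rV[R]_n, ~ N z -> (`|Omega z| <= M)%R.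

Lemma marcinkiewicz_le x : marcinkiewicz Omega beta f x <= M%:E * riesz beta f x.
Proof.
have mr := measurable_enorm_sub x.
have mk : measurable_fun [set: @euclid R n] (riesz_kernel beta f x) by exact: measurable_riesz_kernel.
have mrE : measurable_fun [set: @euclid R n] (fun y => (enorm (x - y))%:E) by exact/measurable_EFinP.
have k0 := riesz_kernel_ge0 beta f x.
have r0 y : (0 <= enorm (x - y))%R by exact: enorm_ge0.
have I0 : 0 <= riesz beta f x by exact: integral_ge0.
(* The exceptional points [y], those with [x - y] in [N]. As [N] contains 0, the complement of [N']
   also excludes [y = x]. *)
pose N' : set (@euclid R n) := affine x (-1) @^-1` N.
have N'0 : leb n N' = 0 by apply: leb_affine_null => //; rewrite oppr_eq0 oner_eq0.
have mN' : measurable N' by exact: measurable_null.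
pose k y := M%:E * riesz_kernel beta f x y.
have mk' : measurable_fun [set: @euclid R n] k by exact: measurable_funeM.
have k'0 y : 0 <= k y by rewrite mule_ge0.
have Ik : \int[leb n]_y k y = M%:E * riesz beta f x by rewrite ge0_integralZl.
have inner t : `|\int[leb n]_(y in [set y | (enorm (x - y) <= t)%R])
    (Omega (x - y) / enorm (x - y) `^ (n%:R - 1 - beta) * f y)%:E| <=
    \int[leb n]_(y in [set y | (enorm (x - y) <= t)%R]) (k y * (enorm (x - y))%:E).
  have mH : measurable_fun [set: @euclid R n] (fun y => k y * (enorm (x - y))%:E).
    exact: (emeasurable_funM mk' mrE).
  have mD : measurable ([set y | (enorm (x - y) <= t)%R] : set (@euclid R n)).
    rewrite [X in measurable X](_ : _ = setT `&` (fun y => enorm (x - y)) @^-1` `]-oo, t]).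
      exact: mr.
    by rewrite setTI; apply/seteqP; split => y /=; rewrite in_itv.
  have H0 y : 0 <= k y * (enorm (x - y))%:E by rewrite mule_ge0// lee_fin.
  apply: (@abse_integral_le_ae _ _ _ _ _ N' _ _ mD mN' N'0 (measurable_funTS mH) (fun y _ => H0 y)).
  move=> y _ N'y.
  have Nxy : ~ N (x - y)%R by move: N'y; rewrite /N' /= /affine scaleN1r.
  have xy : (0 < enorm (x - y))%R.
    rewrite lt_neqAle eq_sym r0 andbT; apply/eqP => /enorm_eq0 e.
    by apply: Nxy; rewrite e.
  have e : (enorm (x - y) `^ (n%:R - beta) =
      enorm (x - y) `^ (n%:R - 1 - beta) * enorm (x - y))%R.
    by rewrite -[X in _ = (_ * X)%R]powRr1 ?(ltW xy)// -powRD_gt0//; congr powR; ring.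
  have pos := powR_gt0 (n%:R - 1 - beta)%R xy.
  rewrite /k /riesz_kernel abse_EFin -!EFinM lee_fin !normrM normfV (ger0_norm (ltW pos)) e.
  rewrite [leRHS](_ : _ = M / enorm (x - y) `^ (n%:R - 1 - beta) * `|f y|)%R; last first.
    by field; rewrite !gt_eqF.
  apply: ler_wpM2r => //; apply: ler_wpM2r; first by rewrite invr_ge0 ltW.
  exact: Omega_le.
have F2 := @square_function_le _ _ _ (leb n) _ _ mk' k'0 mr r0.
rewrite Ik in F2.
have MI0 : 0 <= M%:E * riesz beta f x by rewrite mule_ge0.
have sq0 (z : \bar R) t : (0 < t)%R -> 0 <= z -> 0 <= z ^+ 2 * ((t ^+ 3)^-1)%:E.
  by move=> t0 z0; rewrite mule_ge0 ?expe_ge0// lee_fin invr_ge0 exprn_ge0// ltW.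
rewrite /marcinkiewicz; apply: (@le_trans _ _ (((M%:E * riesz beta f x) ^+ 2) `^ 2^-1)).
  apply: gt0_ler_poweR; rewrite ?invr_ge0 ?ler0n//.
  - rewrite in_itv/= leey andbT; apply: integral_ge0 => t; rewrite /= in_itv/= andbT => t0.
    exact: sq0.
  - by rewrite in_itv/= leey andbT mule_ge0.
  apply: le_trans F2; apply: le_integral_nomeas => t; rewrite /= in_itv/= andbT => t0.
    exact: sq0.
  apply: lee_wpmul2r; first by rewrite lee_fin invr_ge0 exprn_ge0// ltW.
  by apply: lee_pmul => //; exact: inner.
have -> : (M%:E * riesz beta f x) ^+ 2 = (M%:E * riesz beta f x) `^ 2.
  move: MI0; case: (M%:E * _) => [r r_ge0|_|//]; last by rewrite expe2 mulyy poweRyr.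
  by rewrite poweR_EFin powR_mulrn// EFin_expe.
by rewrite -poweRrM divff// poweRe1.
Qed.

End marcinkiewicz_riesz.

(** * The weight class *)

Section Apq_class.
Context {R : realType} {n : nat}.
Variables (p q : R) (w : 'rV[R]_n -> R).
Hypothesis p_gt1 : 1 < p.
Hypothesis pq : p < q.
Hypothesis w_ge0 : forall x, 0 <= w x.
Hypothesis mw : measurable_fun [set: @euclid R n] w.
Hypothesis char_fin : (Apq_char p q w < +oo)%E.

Let p0 : 0 < p. Proof. exact: lt_trans p_gt1. Qed.
Let q0 : 0 < q. Proof. exact: lt_trans pq. Qed.
Let p'0 : 0 < p / (p - 1). Proof. by rewrite divr_gt0// subr_gt0. Qed.
Let r0 : 0 < q / (p / (p - 1)). Proof. exact: divr_gt0. Qed.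

Local Notation U a l := (\int[leb n]_(x in cube a l) weight_q q w x)%E.
Local Notation S a l := (\int[leb n]_(x in cube a l) weight_dual p w x)%E.

Lemma cube_box (a : 'rV[R]_n) l : cube a l = box (fun i => `[a ord0 i, a ord0 i + l]).
Proof. by apply/seteqP; split => x Hx i; have := Hx i; rewrite in_itv. Qed.

Lemma measurable_cube (a : 'rV[R]_n) l : measurable (cube a l : set (@euclid R n)).
Proof. by apply: measurable_euclid; rewrite cube_box; exact: measurable_box. Qed.

Lemma leb_cube (a : 'rV[R]_n) l : 0 < l -> leb n (cube a l) = (l ^+ n)%:E.
Proof.
move=> l0; rewrite cube_box; apply: leb_box => [|i]; first exact: ltW.
by rewrite lebesgue_measure_itv/= lte_fin ltrDl l0 -EFinB addrAC subrr add0r.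
Qed.

Lemma int_weight_q_ge0 a l : (0 <= U a l)%E.
Proof. by apply: integral_ge0 => x _; exact: weight_q_ge0. Qed.

Lemma int_weight_dual_ge0 a l : (0 <= S a l)%E.
Proof. by apply: integral_ge0 => x _; exact: weight_dual_ge0. Qed.

Lemma Apq_char_ge a l : 0 < l ->
  (((l ^+ n)^-1)%:E * U a l * (((l ^+ n)^-1)%:E * S a l) `^ (q / (p / (p - 1)))
   <= Apq_char p q w)%E.
Proof.
move=> l0; have ne : l ^+ n != 0 by rewrite gt_eqF// exprn_gt0.
apply: ereal_sup_ubound; exists (a, l) => //=.
by rewrite /average (leb_cube _ _ l0) inver (negbTE ne).
Qed.

Let dual_ge0 x : (0 <= weight_dual p w x)%E.
Proof. exact: weight_dual_ge0. Qed.

Let uq_ge0 x : (0 <= weight_q q w x)%E.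
Proof. exact: weight_q_ge0. Qed.

Let mq a l : measurable_fun (cube a l : set (@euclid R n)) (weight_q q w).
Proof. exact: measurable_funTS (measurable_weight_q _ _ mw). Qed.

Let md a l : measurable_fun (cube a l : set (@euclid R n)) (weight_dual p w).
Proof. exact: measurable_funTS (measurable_weight_dual _ _ p_gt1 mw). Qed.

Let addye_ge0 (x : \bar R) : (0 <= x -> +oo + x = +oo)%E.
Proof. by move=> x_ge0; rewrite addeC ge0_addey. Qed.

Let int_infty_cube a l : 0 < l -> (\int[leb n]_(x in cube a l) (+oo : \bar R) = +oo)%E.
Proof.
move=> l0; have -> : (\int[leb n]_(x in cube a l) (+oo : \bar R) = +oo * leb n (cube a l))%E.
  exact: (integral_cst (leb n) (measurable_cube a l)).
by rewrite (leb_cube _ _ l0) gt0_mulye// lte_fin exprn_gt0.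
Qed.

(* [+oo * weight_q] has integral [0] as soon as [weight_q] has, and it is [+oo]
   wherever [w] does not vanish. *)
Let int_infty_null (D : set (@euclid R n)) phi : measurable D -> measurable_fun D phi ->
  (forall x, 0 <= phi x)%E -> (\int[leb n]_(x in D) phi x = 0)%E ->
  (\int[leb n]_(x in D) (+oo * phi x) = 0)%E.
Proof. by move=> mD mphi phi0 E; rewrite ge0_integralZl// E mule0. Qed.

(** [weight_dual + +oo * weight_q] equals [+oo] everywhere, and its second summand has integral
    0. *)
Lemma dual_infty_of_null a l : 0 < l -> U a l = 0%E -> S a l = +oo%E.
Proof.
move=> l0 U0; apply/eqP; rewrite -leye_eq -(int_infty_cube a l l0).
have mqy : measurable_fun (cube a l : set (@euclid R n)) (fun x => +oo * weight_q q w x)%E.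
  by apply: measurable_funeM; exact: mq.
have qy0 x : (0 <= +oo * weight_q q w x)%E by exact: mule_ge0.
apply: (@le_trans _ _ (\int[leb n]_(x in cube a l) (weight_dual p w x + +oo * weight_q q w x))%E).
  apply: le_integral_nomeas => // x _; have [wx|wx] := eqVneq (w x) 0.
    by rewrite /weight_dual wx (powR0 (lt0r_neq0 p'0)) inver eqxx addye_ge0.
  rewrite gt0_mulye; last by rewrite lte_fin powR_gt0// lt_neqAle eq_sym wx w_ge0.
  by rewrite ge0_addey.
rewrite (ge0_integralD (leb n) (measurable_cube a l) (fun x _ => dual_ge0 x) (md a l) (fun x _ => qy0 x) mqy).
by rewrite (int_infty_null _ _ (measurable_cube a l) (mq a l) uq_ge0 U0) adde0.
Qed.

(** The weight takes finite values, so [weight_dual] is positive everywhere, and [+oo] times it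
    cannot have integral 0. *)
Lemma dual_gt0 a l : 0 < l -> (0 < S a l)%E.
Proof.
move=> l0; rewrite lt_neqAle int_weight_dual_ge0 andbT; apply/eqP => S0.
have : (\int[leb n]_(x in cube a l) (+oo : \bar R) <= \int[leb n]_(x in cube a l) (+oo * weight_dual p w x))%E.
  apply: le_integral_nomeas => // x _; rewrite gt0_mulye//.
  rewrite /weight_dual inver; case: ifP => // h; rewrite lte_fin invr_gt0.
  by rewrite lt_neqAle eq_sym h powR_ge0.
by rewrite (int_infty_null _ _ (measurable_cube a l) (md a l) dual_ge0 (esym S0)) int_infty_cube.
Qed.

Let vol_inv_gt0 l : 0 < l -> (0 < ((l ^+ n)^-1)%:E :> \bar R)%E.
Proof. by move=> l0; rewrite lte_fin invr_gt0 exprn_gt0. Qed.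

Lemma dual_fin a l : 0 < l -> (0 < U a l)%E -> (S a l < +oo)%E.
Proof.
move=> l0 U0; rewrite ltey; apply/eqP => Soo.
have := le_lt_trans (Apq_char_ge a l l0) char_fin; rewrite Soo gt0_muley ?vol_inv_gt0//.
rewrite poweRyr ?(lt0r_neq0 r0)// gt0_muley ?ltxx//.
by rewrite mule_gt0// vol_inv_gt0.
Qed.

Lemma weight_q_fin a l : 0 < l -> (U a l < +oo)%E.
Proof.
move=> l0; rewrite ltey; apply/eqP => Uoo.
have := le_lt_trans (Apq_char_ge a l l0) char_fin; rewrite Uoo gt0_muley ?vol_inv_gt0//.
rewrite gt0_mulye ?ltxx// poweR_gt0// mule_gt0 ?vol_inv_gt0//.
exact: dual_gt0.
Qed.

(** Nullness spreads outward: an infinite dual integral on the small cube is inherited by the large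
    one, where [dual_fin] then excludes a positive integral of [w ^ q]. *)
Lemma null_of_null_subcube a l a' l' : 0 < l -> 0 < l' -> cube a l `<=` cube a' l' ->
  U a l = 0%E -> U a' l' = 0%E.
Proof.
move=> l0 l'0 sub U0; apply/eqP; rewrite eq_le int_weight_q_ge0 andbT leNgt; apply/negP => U'0.
have : (S a l <= S a' l')%E.
  exact: (ge0_subset_integral _ (measurable_cube a l) (measurable_cube a' l') (md a' l')
    (fun x _ => dual_ge0 x) sub).
by rewrite dual_infty_of_null// leye_eq => /eqP E; have := dual_fin _ _ l'0 U'0; rewrite E.
Qed.

Lemma weight_q_null a l : 0 < l -> U a l = 0%E -> (\int[leb n]_x weight_q q w x = 0)%E.
Proof.
move=> l0 U0.
pose Q k := cube (\row_i (a ord0 i - k%:R)) (l + 2 * k%:R).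
have Qk k : (\int[leb n]_(x in Q k) weight_q q w x = 0)%E.
  apply: (null_of_null_subcube _ _ _ _ l0 _ _ U0).
    by rewrite ltr_wpDr// mulr_ge0.
  move=> x Hx i; rewrite mxE; have /andP[h1 h2] := Hx i.
  have k0 : 0 <= k%:R :> R by rewrite ler0n.
  apply/andP; split; lra.
have QT : \bigcup_k Q k = setT.
  rewrite -subTset => x _.
  pose M := \sum_(i < n) `|x ord0 i - a ord0 i|.
  exists (Num.truncn M).+1 => // i; rewrite mxE.
  have h1 : `|x ord0 i - a ord0 i| <= M.
    by rewrite /M (bigD1 i)//= lerDl sumr_ge0.
  have := le_trans h1 (ltW (truncnS_gt _)); rewrite ler_norml => /andP[h2 h3].
  apply/andP; split; lra.
have mQ k : measurable (Q k : set (@euclid R n)) by exact: measurable_cube.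
have ndQ : {homo Q : k m / (k <= m)%N >-> (k <= m)%O}.
  move=> k m km; apply/subsetPset => x Hx i; have := Hx i; rewrite !mxE => /andP[h1 h2].
  have h3 : k%:R <= m%:R :> R by rewrite ler_nat.
  apply/andP; split; lra.
have := @ge0_nondecreasing_set_cvg_integral _ (@euclid R n) R Q (weight_q q w) (leb n) ndQ mQ
   (fun k => mq _ _) (fun k x _ => uq_ge0 x).
rewrite QT (_ : (fun k => _) = cst 0%E) => [H|]; last exact/funext/Qk.
by rewrite -(cvg_lim _ H)// lim_cst.
Qed.

Lemma wnorm_null (g : 'rV[R]_n -> \bar R) :
  (\int[leb n]_x weight_q q w x = 0)%E -> wnorm q w g = 0%E.
Proof.
move=> U0; rewrite /wnorm.
suff -> : (\int[leb n]_x (`|g x| `^ q * (w x `^ q)%:E) = 0)%E by rewrite poweR0r// invr_eq0 gt_eqF.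
apply/eqP; rewrite eq_le; apply/andP; split; last first.
  by apply: integral_ge0 => x _; rewrite mule_ge0 ?poweR_ge0// lee_fin powR_ge0.
have <- : (\int[leb n]_x (+oo * weight_q q w x) = 0)%E.
  exact: (int_infty_null _ _ measurableT (measurable_weight_q _ _ mw) uq_ge0 U0).
apply: le_integral_nomeas => x _; first by rewrite mule_ge0 ?poweR_ge0// lee_fin powR_ge0.
by apply: lee_wpmul2r; [exact: uq_ge0|exact: leey].
Qed.

(** The [q]-th root of the condition, with [(q / p') / q = 1 - 1/p]; this is why the constant on the
    grids is [[w]^(1/q)]. *)
Lemma cube_Apq_of_char a l : 0 < l -> (0 < U a l)%E ->
  fine (U a l) `^ q^-1 * fine (S a l) `^ (1 - p^-1) <=
  fine (Apq_char p q w) `^ q^-1 * (l ^+ n) `^ (q^-1 + (1 - p^-1)).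
Proof.
move=> l0 U0; have := Apq_char_ge a l l0.
have Uf : U a l \is a fin_num by rewrite ge0_fin_numE ?int_weight_q_ge0 ?weight_q_fin.
have Sf : S a l \is a fin_num by rewrite ge0_fin_numE ?int_weight_dual_ge0 ?dual_fin.
have u0 : 0 <= fine (U a l) by rewrite fine_ge0 ?int_weight_q_ge0.
have s0 : 0 <= fine (S a l) by rewrite fine_ge0 ?int_weight_dual_ge0.
have v0 : 0 < l ^+ n by rewrite exprn_gt0.
rewrite -(fineK Uf) -(fineK Sf) -!EFinM /=.
set v := l ^+ n in v0 *; set u := fine (U a l) in u0 *; set s := fine (S a l) in s0 *.
move=> H; have Wf : Apq_char p q w \is a fin_num.
  by rewrite fin_numE (lt_eqF char_fin) andbT gt_eqF// (lt_le_trans _ H)// ltNyr.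
move: H; rewrite -(fineK Wf) lee_fin /=.
set W := fine _; set r := q / (p / (p - 1)) => H.
have x0 : 0 <= v^-1 * u * (v^-1 * s) `^ r.
  by rewrite mulr_ge0 ?powR_ge0// mulr_ge0// invr_ge0 ltW.
have qV : 0 <= q^-1 by rewrite invr_ge0 ltW.
have := ge0_ler_powR qV x0 (le_trans x0 H) H.
have vi : 0 <= v^-1 by rewrite invr_ge0 ltW.
rewrite powRM ?powR_ge0 ?mulr_ge0// -powRrM.
have -> : r * q^-1 = 1 - p^-1.
  by rewrite /r; field; rewrite !gt_eqF// subr_gt0.
rewrite !powRM//.
have vV e : v^-1 `^ e = (v `^ e)^-1 by rewrite -(powR_inv1 (ltW v0)) -powRrM mulN1r powRN.
rewrite !vV => H1.
have va0 := powR_gt0 q^-1 v0; have vb0 := powR_gt0 (1 - p^-1) v0.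
rewrite (powRD_gt0 _ q^-1 (1 - p^-1) v0).
set va := v `^ q^-1 in va0 H1 *; set vb := v `^ (1 - p^-1) in vb0 H1 *.
rewrite -ler_pdivrMr ?mulr_gt0//.
have E (x y z t : R) : x * y / (z * t) = z^-1 * x * (t^-1 * y) by rewrite invfM; ring.
rewrite E; exact: H1.
Qed.

End Apq_class.

(** * The weighted bound *)

Lemma measurable_riesz {R : realType} {n : nat} (beta : R) (f : 'rV[R]_n -> R) :
  measurable_fun [set: @euclid R n] f -> measurable_fun [set: @euclid R n] (riesz beta f).
Proof.
move=> mf.
pose T := @euclid R n.
have mcoord (i : 'I_n) : measurable_fun [set: T] (fun x : T => (x : 'rV[R]_n) ord0 i).
  by apply: measurable_fun_euclid; exact: measurable_coord.
have mE : measurable_fun [set: T * T] (fun z : T * T => enorm ((z.1 : 'rV[R]_n) - z.2)).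
  apply: (measurableT_comp measurable_enorm); apply: measurable_fun_rV => i.
  rewrite (_ : (fun z => _) = (fun z : T * T => (z.1 : 'rV[R]_n) ord0 i - (z.2 : 'rV[R]_n) ord0 i)).
    apply: measurable_funB.
      exact: (measurableT_comp (mcoord i) (@measurable_fst _ _ T T)).
    exact: (measurableT_comp (mcoord i) (@measurable_snd _ _ T T)).
  by apply/funext => z; rewrite !mxE.
have mk : measurable_fun [set: T * T] (fun z => riesz_kernel beta f z.1 z.2).
  rewrite (_ : (fun z => _) = (fun z : T * T => (`|f z.2| * enorm ((z.1 : 'rV[R]_n) - z.2) `^ (- (n%:R - beta)))%:E)).
    apply/measurable_EFinP; apply: measurable_funM.
      exact: (measurableT_comp (measurableT_comp (@normr_measurable R setT) mf) (@measurable_snd _ _ T T)).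
    exact: (measurableT_comp (measurable_powR _) mE).
  by apply/funext => z; rewrite riesz_kernelE.
exact: (measurable_fun_fubini_tonelli_F (m2 := leb n) _ mk (fun z => riesz_kernel_ge0 beta f z.1 z.2)).
Qed.

(** * Constants and the powers of the characteristic *)

Section constants.
Context {R : realType}.
Variables (n : nat) (p q : R).
Hypothesis n_gt0 : (0 < n)%N.
Hypothesis p_gt1 : 1 < p.
Hypothesis pq : p < q.

Let p0 : 0 < p. Proof. exact: lt_trans p_gt1. Qed.
Let q0 : 0 < q. Proof. exact: lt_trans pq. Qed.
Let pV1 : 0 < 1 - p^-1. Proof. by rewrite subr_gt0 invf_lt1. Qed.
Let qV : 0 < q^-1. Proof. by rewrite invr_gt0. Qed.

Definition potential_const : R :=
  2 * @geom_sum_const R n p q * geom_const (p^-1 - q^-1) (2 ^+ n) * (p / (p - 1)) * q.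

Definition weight_const : R := 2 `^ ((1 - p^-1) / q^-1) + 2 `^ (q^-1 / (1 - p^-1)).

(** The factor [16 ^ n] replaces the kernel loss [16^(n - beta)], [(2 ^ n)^2] comes from the shifted
    grids, and the rest from the dyadic bound. No [beta] occurs, so the constant can be chosen
    before it. *)
Definition final_const : R := 16 ^+ n * (2 ^+ n) ^+ 2 * potential_const * weight_const.

Lemma potential_const_gt0 : 0 < potential_const.
Proof.
have g0 : 0 < p^-1 - q^-1 by rewrite subr_gt0 ltf_pV2 ?posrE.
have b1 : 1 < 2 ^+ n :> R by rewrite exprn_egt1 ?ltr1n// -lt0n.
have c1 : (2 ^+ n) `^ (- (p^-1 - q^-1)) < 1 :> R.
  rewrite powRN invf_lt1 ?powR_gt0 ?(lt_trans ltr01 b1)//.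
  by have := gt0_ltr_powR g0 _ _ b1; rewrite powR1; apply; rewrite nnegrE// ltW// (lt_trans ltr01).
have ex : p^-1 - q^-1 + q^-1 + (1 - p^-1) = 1 by ring.
have G1 := geom_const_ge q^-1 (1 - p^-1) _ _ qV pV1 g0 ex b1.
have r1 := geom_ratio_gt1 q^-1 (1 - p^-1) _ _ qV pV1 ex b1.
have G0 : 0 < geom_const (p^-1 - q^-1) (2 ^+ n) :> R.
  by apply: lt_le_trans G1; rewrite divr_gt0 ?subr_gt0// (lt_trans ltr01 r1).
have D0 : 0 < @geom_sum_const R n p q by rewrite invr_gt0 subr_gt0.
have p1 : 0 < p / (p - 1) by rewrite divr_gt0// subr_gt0.
exact: mulr_gt0 (mulr_gt0 (mulr_gt0 (mulr_gt0 (ltr0n _ 2) D0) G0) p1) q0.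
Qed.

Lemma final_const_gt0 : 0 < final_const.
Proof.
have w0 : 0 < weight_const by rewrite addr_gt0// powR_gt0.
have h1 : 0 < 16 ^+ n * (2 ^+ n) ^+ 2 :> R by rewrite mulr_gt0// !exprn_gt0.
exact: mulr_gt0 (mulr_gt0 h1 potential_const_gt0) w0.
Qed.

(** With [g = 1/p - 1/q] the two exponents are [1/q + (1 - 1/p) = 1 - g] and
    [1/q + p' / q^2 = p'/q * (1 - g)]; since [1 <= W], both powers are at most the one with the
    larger exponent. *)
Lemma weight_exponents (W : R) : 1 <= W ->
  W `^ q^-1 * ((2 * W `^ q^-1) `^ ((1 - p^-1) / q^-1) + (2 * W `^ q^-1) `^ (q^-1 / (1 - p^-1)))
  <= weight_const * W `^ (Num.max (p / (p - 1) / q * (1 - (p^-1 - q^-1))) (1 - (p^-1 - q^-1))).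
Proof.
move=> W1; have W0 : 0 < W by exact: lt_le_trans W1.
rewrite !powRM ?powR_ge0// -!powRrM mulrDr /weight_const [leRHS]mulrDl.
rewrite ![W `^ q^-1 * _]mulrCA -!powRD_gt0//.
set e := Num.max _ _.
have le s : s <= e -> W `^ s <= W `^ e by move=> h; exact: ler_powR.
apply: lerD; (apply: ler_wpM2l; first exact: powR_ge0); apply: le; rewrite /e le_max; apply/orP.
  right; rewrite le_eqVlt; apply/orP; left; apply/eqP; field.
  by rewrite !gt_eqF.
left; rewrite le_eqVlt; apply/orP; left; apply/eqP; field.
by rewrite !gt_eqF// subr_gt0.
Qed.

End constants.

(** * The weighted bound for the Riesz potential *)

Section main_bound.
Context {R : realType} {n : nat}.
Variables (p q beta NF : R) (w f : 'rV[R]_n -> R).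
Hypothesis n_gt0 : (0 < n)%N.
Hypothesis p_gt1 : 1 < p.
Hypothesis pq : p < q.
Hypothesis w_ge0 : forall x, 0 <= w x.
Hypothesis mw : measurable_fun [set: @euclid R n] w.

Let p0 : 0 < p. Proof. exact: lt_trans p_gt1. Qed.
Let q0 : 0 < q. Proof. exact: lt_trans pq. Qed.

Lemma wnorm_le_scale (M : R) (g h : 'rV[R]_n -> \bar R) : 0 <= M ->
  measurable_fun [set: @euclid R n] h -> (forall x, 0 <= h x)%E ->
  (forall x, 0 <= g x)%E -> (forall x, g x <= M%:E * h x)%E ->
  (wnorm q w g <= M%:E * wnorm q w h)%E.
Proof.
move=> M0 mh h0 g0 gh; rewrite /wnorm.
have mq : measurable_fun [set: @euclid R n] (fun x => (w x `^ q)%:E) by exact: measurable_weight_q.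
have mH : measurable_fun [set: @euclid R n] (fun x => `|h x| `^ q * (w x `^ q)%:E)%E.
  apply: (emeasurable_funM _ mq); apply: (measurableT_comp (measurable_poweR _)).
  exact: (measurableT_comp (@abse_measurable R setT) mh).
have H0 x : (0 <= `|h x| `^ q * (w x `^ q)%:E)%E by rewrite mule_ge0 ?poweR_ge0// lee_fin powR_ge0.
have I0 : (0 <= \int[leb n]_x (`|h x| `^ q * (w x `^ q)%:E))%E by exact: integral_ge0.
have -> : M%:E = ((M `^ q)%:E `^ q^-1)%E by rewrite poweR_EFin -powRrM divff ?gt_eqF// powRr1.
rewrite -poweRM//; last by rewrite lee_fin powR_ge0.
have Mq0 : (0 <= (M `^ q)%:E)%E by rewrite lee_fin powR_ge0.
apply: gt0_ler_poweR; first by rewrite invr_ge0 ltW.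
- by rewrite in_itv/= leey andbT; apply: integral_ge0 => x _; rewrite mule_ge0 ?poweR_ge0// lee_fin powR_ge0.
- by rewrite in_itv/= leey andbT mule_ge0.
have <- : (\int[leb n]_x ((M `^ q)%:E * (`|h x| `^ q * (w x `^ q)%:E)) =
    (M `^ q)%:E * \int[leb n]_x (`|h x| `^ q * (w x `^ q)%:E))%E.
  by apply: ge0_integralZl; [exact: measurableT|exact: mH|by move=> x _; exact: H0|exact: Mq0].
apply: le_integral_nomeas => x _; first by rewrite mule_ge0 ?poweR_ge0// lee_fin powR_ge0.
rewrite muleA; apply: lee_wpmul2r; first by rewrite lee_fin powR_ge0.
rewrite -poweR_EFin -poweRM// ?lee_fin//.
apply: gt0_ler_poweR; first exact: ltW.
- by rewrite in_itv/= leey andbT.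
- by rewrite in_itv/= leey andbT mule_ge0.
by rewrite !gee0_abs.
Qed.

Hypothesis mf : measurable_fun [set: @euclid R n] f.
Hypothesis beta_gt0 : 0 < beta.
Hypothesis beta_lt : beta < n%:R.
Hypothesis gE : p^-1 - q^-1 = beta / n%:R.
Hypothesis char_fin : (Apq_char p q w < +oo)%E.
Hypothesis U_gt0 : forall a l, 0 < l -> (0 < \int[leb n]_(x in cube a l) weight_q q w x)%E.
Hypothesis int_f : (\int[leb n]_x weighted_power p w f x = NF%:E)%E.

Let W : R := fine (Apq_char p q w).

Let K_ge0 : 0 <= W `^ q^-1. Proof. exact: powR_ge0. Qed.

Let int_q a l : 0 < l -> (\int[leb n]_(x in cube a l) weight_q q w x < +oo)%E.
Proof. by move=> l0; apply: (weight_q_fin p). Qed.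

Let int_dual a l : 0 < l -> (\int[leb n]_(x in cube a l) weight_dual p w x < +oo)%E.
Proof. by move=> l0; apply: (dual_fin p q) => //; exact: U_gt0. Qed.

Let char_cube a l : 0 < l ->
  fine (\int[leb n]_(x in cube a l) weight_q q w x) `^ q^-1 *
  fine (\int[leb n]_(x in cube a l) weight_dual p w x) `^ (1 - p^-1) <=
  W `^ q^-1 * (l ^+ n) `^ (q^-1 + (1 - p^-1)).
Proof. by move=> l0; apply: (cube_Apq_of_char p q) => //; exact: U_gt0. Qed.

Lemma Apq_char_ge1 : 1 <= W.
Proof.
(* The grid with [L = 0] has the single leaf of side 1 anchored at 0. *)
have K1 := Apq_const_ge1 p q (W `^ q^-1) w p_gt1 pq w_ge0 mw int_q int_dual char_cube
  0 1 0 ltr01 [ffun=> Ordinal (ltnSn 0) : 'I_(2 ^ 0)].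
have W0 : 0 <= W.
  apply: fine_ge0; apply: le_trans (Apq_char_ge p q w 0 1 ltr01).
  apply: mule_ge0 (poweR_ge0 _ _); apply: mule_ge0; first by rewrite lee_fin invr_ge0 exprn_ge0.
  exact: ltW (U_gt0 _ _ ltr01).
rewrite leNgt; apply/negP => W1; move: K1; rewrite leNgt => /negP; apply.
have qV : 0 < q^-1 by rewrite invr_gt0.
by have := gt0_ltr_powR qV W0 _ W1; rewrite powR1; apply; rewrite nnegrE.
Qed.

Lemma riesz_wnorm_le :
  (wnorm q w (riesz beta f) <= (final_const n p q *
     W `^ (Num.max (p / (p - 1) / q * (1 - beta / n%:R)) (1 - beta / n%:R)) * NF `^ p^-1)%:E)%E.
Proof.
have q1 : 1 <= q by exact: ltW (lt_trans p_gt1 pq).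
set B := potential_const n p q * (W `^ q^-1 * ((2 * W `^ q^-1) `^ ((1 - p^-1) / q^-1) +
   (2 * W `^ q^-1) `^ (q^-1 / (1 - p^-1)))) * NF `^ p^-1.
have pc := potential_const_gt0 n p q n_gt0 p_gt1 pq.
have B0 : 0 <= B.
  apply: mulr_ge0 (powR_ge0 _ _); apply: mulr_ge0 (ltW pc) _.
  by apply: mulr_ge0; rewrite ?addr_ge0 ?powR_ge0.
have grid N t : (\int[leb n]_x (grid_fun p q f (anchor n N t) (mesh N) N.*2 x `^ q * w x `^ q)%:E
     <= (B `^ q)%:E)%E.
  have := grid_fun_norm_le p q (W `^ q^-1) NF w f n_gt0 p_gt1 pq w_ge0 mw mf int_q int_dual
    K_ge0 char_cube int_f (anchor n N t) (mesh N) N.*2 (mesh_gt0 N).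
  rewrite [X in (X `^ q)%:E](_ : _ = B)//.
  by rewrite /B /potential_const; ring.
have fin_leaf a h L m : 0 < h -> (\int[leb n]_(x in leaf a h L m) (`|f x|)%:E < +oo)%E.
  move=> h0; apply: le_lt_trans (leaf_f_le p NF w f p_gt1 w_ge0 mw mf int_dual int_f a h L h0 m) _.
  exact: ltry.
have H := riesz_norm_le p q beta f n_gt0 mf beta_lt gE fin_leaf w mw w_ge0 q0 B q1 B0 grid.
have int0 : (0 <= \int[leb n]_x (riesz beta f x `^ q * (w x `^ q)%:E))%E.
  by apply: integral_ge0 => x _; rewrite mule_ge0 ?poweR_ge0// lee_fin powR_ge0.
set D := 16 `^ (n%:R - beta) * (2 ^+ n) ^+ 2 * B in H.
have D0 : 0 <= D by apply: mulr_ge0 B0; apply: mulr_ge0 (powR_ge0 _ _) (sqr_ge0 _).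
apply: (@le_trans _ _ D%:E).
  have -> : D%:E = ((D `^ q)%:E `^ q^-1)%E by rewrite poweR_EFin -powRrM divff ?gt_eqF// powRr1.
  have rz0 x : (0 <= riesz beta f x)%E by apply: integral_ge0 => y _; exact: riesz_kernel_ge0.
  rewrite /wnorm; under eq_integral do rewrite (gee0_abs (rz0 _)).
  apply: gt0_ler_poweR; first by rewrite invr_ge0 ltW.
  - by rewrite in_itv/= leey andbT.
  - by rewrite in_itv/= leey andbT lee_fin powR_ge0.
  exact: H.
rewrite lee_fin -gE.
have le16 : 16 `^ (n%:R - beta) <= 16 ^+ n :> R.
  rewrite -powR_mulrn//; apply: ler_powR; first by rewrite ler1n.
  by rewrite lerBlDr lerDl ltW.
have we := weight_exponents p q p_gt1 pq W Apq_char_ge1.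
have s2 : 0 <= (2 ^+ n) ^+ 2 :> R by exact: sqr_ge0.
apply: (@le_trans _ _ (16 ^+ n * (2 ^+ n) ^+ 2 * B)).
  exact: (ler_wpM2r B0 (ler_wpM2r s2 le16)).
have c0 : 0 <= 16 ^+ n * (2 ^+ n) ^+ 2 * potential_const n p q.
  by apply: mulr_ge0 (ltW pc); apply: mulr_ge0 s2; exact: exprn_ge0.
have := ler_wpM2r (powR_ge0 NF p^-1) (ler_wpM2l c0 we).
by rewrite /B /final_const !mulrA.
Qed.

End main_bound.

Theorem theorem1p1 (R : realType) (n : nat) (p q : R) :
  (2 <= n)%N -> 1 < p -> p < q ->
  exists C : R, 0 < C /\
    forall beta : R, 0 < beta -> beta < n%:R ->
      1 / q = 1 / p - beta / n%:R ->
    forall Omega : 'rV[R]_n -> R,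
      in_sphere_Loo Omega ->
      homogeneous0 Omega ->
      (\int[sphere_measure R n]_(x in sphere R n) (Omega x)%:E = 0)%E ->
    forall w : 'rV[R]_n -> R, Apq p q w ->
    forall f : 'rV[R]_n -> R, in_wLp p w f ->
    let p' := p / (p - 1) in
      (beta < 1 / 2 ->
        (wnorm q w (marcinkiewicz Omega beta f)
         <= C%:E * sphere_supnorm Omega
            * Apq_char p q w `^ (Num.max 1 (p' / q))%R
            * Apq_char p q w `^
                (Num.max (p' / q * (1 - beta / n%:R)) (1 / 2 - beta / n%:R))%R
            * wnorm p w (EFin \o f))%E)
      /\
      (1 / 2 <= beta ->
        (wnorm q w (marcinkiewicz Omega beta f)
         <= C%:E * sphere_supnorm Omega
            * Apq_char p q w `^
                (Num.max (p' / q * (1 - beta / n%:R)) (1 - beta / n%:R))%R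
            * wnorm p w (EFin \o f))%E).
Proof.
move=> n2 p_gt1 pq; have n_gt0 : (0 < n)%N by exact: ltnW.
have p0 : 0 < p := lt_trans ltr01 p_gt1.
have q0 : 0 < q := lt_trans p0 pq.
have fc0 : 0 < final_const n p q by exact: final_const_gt0.
exists (final_const n p q); split=> // beta beta0 betan; rewrite !div1r => gE0.
have gE : p^-1 - q^-1 = beta / n%:R by rewrite gE0; ring.
move=> Omega OmegaL hom _ w [[w_ge0 mw _] char_fin] f [mf f_fin] p'.
have [M M0 [supE [N N0 [N_0 OmegaM]]]] := sphere_supnorm_bound n_gt0 Omega OmegaL hom.
rewrite supE; set W := Apq_char p q w.
have fw0 : (0 <= wnorm p w (EFin \o f))%E by exact: poweR_ge0.
(* Degenerate weights: if [w ^ q] has integral 0 on one cube it is null on the whole space, and both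
   left-hand norms are 0. *)
have [[a [l [l0 U0]]]|nondeg] := pselect (exists a l, 0 < l /\
    (\int[leb n]_(x in cube a l) weight_q q w x = 0)%E).
  have Z := wnorm_null p q w p_gt1 pq mw (marcinkiewicz Omega beta f)
    (weight_q_null p q w p_gt1 pq w_ge0 mw char_fin a l l0 U0).
  by rewrite Z; split=> _; rewrite !mule_ge0 ?poweR_ge0// lee_fin// ltW.
have U_gt0 a l : 0 < l -> (0 < \int[leb n]_(x in cube a l) weight_q q w x)%E.
  move=> l0; rewrite lt_neqAle; apply/andP; split.
    by apply/eqP => E; apply: nondeg; exists a, l.
  by apply: integral_ge0 => x _; exact: weight_q_ge0.
have [NF int_f] : exists NF : R, (\int[leb n]_x weighted_power p w f x = NF%:E)%E.
  exists (fine (\int[leb n]_x weighted_power p w f x)%E); rewrite fineK// ge0_fin_numE.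
    by apply: lty_poweRy f_fin; rewrite invr_eq0 gt_eqF.
  by apply: integral_ge0 => x _; rewrite lee_fin mulr_ge0 ?powR_ge0.
have fE : wnorm p w (EFin \o f) = (NF `^ p^-1)%:E.
  by rewrite -poweR_EFin -int_f.
have W1 := Apq_char_ge1 p q w p_gt1 pq w_ge0 mw char_fin U_gt0.
have WE : W = (fine W)%:E.
  by move: W1; rewrite /W; case: (Apq_char p q w) => //=; rewrite ler10.
have bound : (wnorm q w (marcinkiewicz Omega beta f) <= (final_const n p q)%:E * M%:E *
    W `^ (Num.max (p' / q * (1 - beta / n%:R)) (1 - beta / n%:R))%R * wnorm p w (EFin \o f))%E.
  have rz0 x : (0 <= riesz beta f x)%E by apply: integral_ge0 => y _; exact: riesz_kernel_ge0.
  have mrz := measurable_riesz beta f mf.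
  have step : (wnorm q w (marcinkiewicz Omega beta f) <= M%:E * wnorm q w (riesz beta f))%E.
    apply: (wnorm_le_scale p) => //; first by move=> x; exact: poweR_ge0.
    by move=> x; exact: (marcinkiewicz_le beta M f Omega N).
  apply: (le_trans step).
  have H := riesz_wnorm_le p q beta NF w f n_gt0 p_gt1 pq w_ge0 mw mf beta0 betan gE char_fin U_gt0 int_f.
  apply: le_trans (lee_wpmul2l _ H) _; first by rewrite lee_fin.
  rewrite fE WE poweR_EFin -!EFinM lee_fin.
  rewrite [leLHS](_ : _ = final_const n p q * M * fine W `^ Num.max (p' / q * (1 - beta / n%:R)) (1 - beta / n%:R) * NF `^ p^-1)//; rewrite /W /p'; ring.
split=> // _; apply: (le_trans bound); apply: lee_wpmul2r => //.
rewrite -[leRHS]muleA; apply: lee_wpmul2l.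
  by rewrite mule_ge0// lee_fin// ltW.
have g0 : 0 <= beta / n%:R by rewrite divr_ge0// ltW.
have g1 : 0 <= 1 - beta / n%:R by rewrite subr_ge0 ler_pdivrMr ?ltr0n// mul1r ltW.
have pq'0 : 0 <= p' / q * (1 - beta / n%:R).
  by rewrite mulr_ge0// !divr_ge0 ?subr_ge0 ?(ltW p0) ?(ltW q0) ?(ltW p_gt1).
rewrite WE !poweR_EFin -EFinM lee_fin -powRD_gt0; last exact: lt_le_trans W1.
apply: ler_powR => //.
have a1 : 1 <= Num.max 1 (p' / q) by rewrite le_max lexx.
have b1 : p' / q * (1 - beta / n%:R) <=
    Num.max (p' / q * (1 - beta / n%:R)) (2^-1 - beta / n%:R) by rewrite le_max lexx.
(* The first exponent of (ii) already occurs in the second maximum of (i); the second,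
   [1 - beta / n], is at most 1 and hence at most the first maximum. *)
rewrite ge_max; apply/andP; split.
  by apply: le_trans b1 _; rewrite lerDr (le_trans ler01 a1).
apply: (@le_trans _ _ (Num.max 1 (p' / q))); last by rewrite lerDl (le_trans pq'0 b1).
by apply: le_trans a1; rewrite gerBl.
Qed.
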